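(* Let $\tau>0$ be a fixed constant. For each $n\ge1$ consider the observations $$\bar Y_{i,n}=\int_0^{i/n}X_s\,ds+\tau\epsilon_{i,n},\qquad i=1,\ldots,n,\qquad\text{where } X_t=\int_0^t\sigma(s)\,dW_s .$$ (1) Let $\alpha>1/2$, $L>0$ and $0<l<u<\infty$. Then there exists a constant $C>0$ (depending only on $\alpha,L,l,u$ and the fixed constant $\tau$) such that $$\liminf_{n\to\infty}\ \inf_{\hat\sigma_n^2}\ \sup_{\sigma^2\in\mathcal{C}^b(\alpha,L)}\ \operatorname{E}\left(n^{\frac{\alpha}{4\alpha+2}}\left\|\hat\sigma_n^2-\sigma^2\right\|_2^2\right)\ge C,$$ where the infimum is over all estimators $\hat\sigma_n^2$ of the function $\sigma^2$ based on $\bar Y_{1,n},\ldots,\bar Y_{n,n}$. (2) Furthermore, for constant $\sigma$ and $0<\sigma_{\min}<\sigma_{\max}<\infty$, there exists a constant $\tilde C>0$ (depending on $\sigma_{\min},\sigma_{\max}$ and the fixed constant $\tau$) such that $$\liminf_{n\to\infty}\ \inf_{\hat\sigma_n^2}\ \sup_{\sigma^2\in[\sigma_{\min},\sigma_{\max}]}\ \operatorname{E}\left(n^{1/4}\left(\hat\sigma_n^2-\sigma^2\right)^2\right)\ge\tilde C,$$ where the infimum is over all real-valued estimators $\hat\sigma_n^2$ of the number $\sigma^2$ based on $\bar Y_{1,n},\ldots,\bar Y_{n,n}$.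
   Context: $(W_t)_{t\in[0,1]}$ is a standard Brownian motion, and for each $n$ the variables $\epsilon_{1,n},\ldots,\epsilon_{n,n}$ are i.i.d. $\mathcal{N}(0,1)$, with $(W_t)_{t\in[0,1]}$ and $(\epsilon_{1,n},\ldots,\epsilon_{n,n})$ independent. The function $\sigma:[0,1]\to(0,\infty)$ is unknown, positive and deterministic; $\tau>0$ is a known constant. An estimator is a measurable function of $(\bar Y_{1,n},\ldots,\bar Y_{n,n})$, with values in $L_2([0,1])$ in part (1) and in $\mathbb{R}$ in part (2); $\|\cdot\|_2$ is the $L_2([0,1])$-norm; $\operatorname{E}$ is the expectation under the law of the observations when the true volatility is $\sigma$ (the positive square root of $\sigma^2$). For $\alpha>0$ let $[\alpha]:=\max\{z\in\mathbb{Z}:z\le\alpha\}$. The class of uniformly bounded Hölder continuous functions of index $\alpha$ on $[0,1]$ is $$\mathcal{C}^b(\alpha,L)=\mathcal{C}^b(\alpha,L,[l,u]):=\left\{f:[0,1]\to\mathbb{R}:\ f^{(p)}\text{ exists for }p=[\alpha],\ |f^{(p)}(x)-f^{(p)}(y)|\le L|x-y|^{\alpha-p}\ \forall x,y\in[0,1],\ 0<l\le f\le u<\infty\right\}.$$ *)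

(* Defs.v *)
From HB Require Import structures.
From mathcomp Require Import all_boot all_order all_algebra.
From mathcomp Require Import all_classical all_reals all_analysis.

Set Implicit Arguments.
Unset Strict Implicit.
Unset Printing Implicit Defensive.

Import Order.TTheory GRing.Theory Num.Theory.
Import numFieldNormedType.Exports.

Local Open Scope classical_set_scope.
Local Open Scope ring_scope.

(* Functions on [0,1] are represented by functions on R of which only the
   values on [0,1] matter. *)

Section L2.
Context {R : realType}.
Implicit Types f g : R -> R.

Definition in_L2 f : Prop :=
  f \_ `[0, 1] \in Lfun (@lebesgue_measure R) 2%:E.

Definition L2norm f : \bar R :=
  ('N[@lebesgue_measure R]_2%:E [EFin \o (f \_ `[0%R, 1%R])])%E.

(* Open sets for the (pseudo)distance of L_2([0,1]); such a set is saturated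
   for almost everywhere equality among square-integrable functions. *)
Definition L2_open (U : set (R -> R)) : Prop :=
  forall f, in_L2 f -> U f ->
    exists2 e : R, 0 < e &
      forall g, in_L2 g -> (L2norm (g \- f)%R < e%:E)%E -> U g.

End L2.

Section estimators.
Context {R : realType} (n : nat).

(* L_2([0,1]) carries the Borel sigma-algebra of its norm. *)
Definition L2_estimators : set (n.-tuple R -> R -> R) :=
  [set est | (forall y, in_L2 (est y)) /\
             (forall U, L2_open U -> measurable (est @^-1` U))].

Definition real_estimators : set (n.-tuple R -> R) :=
  [set est | measurable_fun setT est].

End estimators.

Arguments L2_estimators {R} n _.
Arguments real_estimators {R} n _.

Section hoelder_class.
Context {R : realType}.
Implicit Types f g : R -> R.

(* Derivatives at the endpoints 0 and 1 are one-sided. *)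
Definition is_derive01 f f' : Prop :=
  forall x, x \in `[0, 1] ->
    (fun y => (f y - f x) / (y - x)) @ within `[0, 1] x^' --> f' x.

Fixpoint is_derive01n (p : nat) f fp : Prop :=
  if p is q.+1 then exists2 fq, is_derive01n q f fq & is_derive01 fq fp
  else {in `[0, 1], fp =1 f}.

(* For a > 0, Num.truncn a is the largest integer z <= a. *)
Definition bounded_hoelder (a L l u : R) : set (R -> R) :=
  [set f | (exists2 fp, is_derive01n (Num.truncn a) f fp &
              {in `[0, 1] &, forall x y, `|fp x - fp y| <=
                  L * `|x - y| `^ (a - (Num.truncn a)%:R)}) /\
           {in `[0, 1], forall x, l <= f x <= u}].

End hoelder_class.

Section probability.
Context {R : realType} {d : measure_display} {T : measurableType d}.
Variable P : probability T R.

Definition mutually_independent k (Z : 'I_k -> T -> R) : Prop :=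
  forall A : 'I_k -> set R, (forall i, measurable (A i)) ->
    P (\bigcap_i (Z i @^-1` A i)) = (\prod_(i < k) P (Z i @^-1` A i))%E.

Definition generated_by (I : Type) (D : set I) (Z : I -> T -> R) :
    set (set T) :=
  <<s \bigcup_(i in D) preimage_set_system setT (Z i) measurable >>.

Definition independent_systems (G H : set (set T)) : Prop :=
  forall A B, G A -> H B -> P (A `&` B) = (P A * P B)%E.

(* The second parameter of normal_prob is the standard deviation. *)
Definition brownian_motion (W : R -> {RV P >-> R}) : Prop :=
  [/\ {ae P, forall w, W 0 w = 0},
      forall (k : nat) (t : nat -> R),
        (forall i, (i <= k)%N -> t i \in `[0, 1]) ->
        (forall i, (i < k)%N -> t i <= t i.+1) ->
        mutually_independent (fun i : 'I_k => W (t i.+1) \- W (t i)),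
      forall s t : R, 0 <= s -> s < t -> t <= 1 ->
        forall A, measurable A ->
          pushforward P (W t \- W s) A = normal_prob 0 (Num.sqrt (t - s)) A &
      {ae P, forall w, {within `[0, 1], continuous (W ^~ w)}}].

Definition noise_model (W : R -> {RV P >-> R})
    (eps : forall n : nat, 'I_n -> {RV P >-> R}) : Prop :=
  brownian_motion W /\
  forall n : nat,
    [/\ mutually_independent (eps n),
        forall i A, measurable A ->
          distribution P (eps n i) A = normal_prob 0 1 A &
        independent_systems (generated_by `[0, 1] W)
                            (generated_by setT (eps n))].

(* An entry ((a, b), c) stands for c times the indicator of ]a, b]. *)
Definition step_fun (s : seq (R * R * R)) (x : R) : R :=
  \sum_(q <- s) q.2 * \1_(`]q.1.1, q.1.2]) x.

Definition step_integral (W : R -> {RV P >-> R}) (s : seq (R * R * R))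
    (w : T) : R :=
  \sum_(q <- s) q.2 * (W q.1.2 w - W q.1.1 w).

Definition subdivided01 (s : seq (R * R * R)) : bool :=
  all (fun q => [&& 0 <= q.1.1, q.1.1 <= q.1.2 & q.1.2 <= 1]) s.

(* Wiener integral over [0,1] of a deterministic f: limit in L_2(P) of the
   integrals of step functions converging to f in L_2([0,1]). *)
Definition is_wiener_integral (W : R -> {RV P >-> R}) (f : R -> R)
    (Z : {RV P >-> R}) : Prop :=
  exists s : nat -> seq (R * R * R),
    [/\ forall k, subdivided01 (s k),
        L2norm (step_fun (s k) \- f)%R @[k --> \oo] --> 0%E &
        (Lnorm P 2%:E (fun w => (step_integral W (s k) w - Z w)%:E))
          @[k --> \oo] --> 0%E].

(* X is a continuous version of the process X_t = int_0^t sigma(s) dW_s. *)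
Definition is_integral_process (W : R -> {RV P >-> R}) (sigma : R -> R)
    (X : R -> {RV P >-> R}) : Prop :=
  (forall t, t \in `[0, 1] ->
     is_wiener_integral W (sigma \_ `[0, t]) (X t)) /\
  (forall w, {within `[0, 1], continuous (X ^~ w)}).

(* Component i : 'I_n is the observation at time (i+1)/n. *)
Definition observations (tau : R) (X : R -> {RV P >-> R})
    (eps : forall n : nat, 'I_n -> {RV P >-> R}) (n : nat) (w : T) :
    n.-tuple R :=
  [tuple (\int[lebesgue_measure]_(s in `[0%R, (i.+1%:R / n%:R)%R]) X s w)%R +
         tau * eps n i w | i < n].

End probability.

(* Main.v *)
Require Import Defs.
From HB Require Import structures.
From mathcomp Require Import all_boot all_order all_algebra.
From mathcomp Require Import all_classical all_reals all_analysis measurable_realfun.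
From mathcomp Require Import ring lra zify.

Set Implicit Arguments.
Unset Strict Implicit.
Unset Printing Implicit Defensive.

Import Order.TTheory GRing.Theory Num.Theory.
Import numFieldNormedType.Exports.

Local Open Scope classical_set_scope.
Local Open Scope ring_scope.

(** Two volatilities that are close cannot be told apart from the
    observations, because each model is carried to the other by small shifts
    of Gaussian vectors.

    A shift by [s] of a vector of independent centred normal variables with
    standard deviations [sd i] changes the expectation of a test with values
    in [0,1] by at most [4 * r] as soon as the sum of the squares of [s i / sd
    i] is at most [r ^+ 2] ([tuple_shift_le], a Cauchy-Schwarz inequality for
    the densities). Conditioning extends this to a random shift that depends
    only on coordinates which it leaves in place ([masked_shift_le]). No other
    comparison of laws is used.

    The observations are limits of [grid_observations], in which W is replaced
    by its increments x_j over a grid of mesh 1/N and time integrals by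
    Riemann sums: observation i is a sum over j of w_ij * sigma_j * x_j plus
    noise, where w_ij is affine in j up to time i and vanishes after it
    ([test_discretisation]). Bounded Lipschitz tests determine the
    probabilities of Borel sets up to a small error
    ([measurable_lip_approximable]), so it is enough to compare grid models.

    Cut [0,1] into short blocks. An observation made after a block feels the
    increments of that block only through the sums of sigma_j * x_j and of j *
    sigma_j * x_j. To pass from sigma1 to sigma0, the increments of the second
    half of each block are moved by a linear function of those of the first
    half, then those of the first half by a linear function of those of the
    second, in such a way that both sums for sigma0 and the moved increments
    agree with those for sigma1 and the original ones ([block_match]). What
    remains is felt only by the observations made inside the block, and a
    shift of the noise absorbs it. These are three admissible shifts
    ([shift_chain]). If |sigma1 - sigma0| is at most delta on a cell
    containing q blocks and 0 elsewhere, with p cells in all, the moves cost a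
    multiple of q * delta^2. The residual has a variance of order delta^2 / (p
    * q)^3 for each of the about n / p observations of the cell, hence costs a
    multiple of delta^2 * n / (p * (p * q)^3), which is at most q * delta^2
    when n <= (p * q)^4. So the two models stay close in total variation when
    q * delta^2 is small, with blocks of length about n^(-1/4)
    ([two_point_le], [volatility_tests]).

    For a constant volatility take p = 1: then delta^2 may be of order
    n^(-1/4), and one of two constants at distance delta is estimated with a
    squared error of this order ([constant_volatility_risk]). For the Hoelder
    class, take p of order n^(1/(8 alpha + 4)) cells and bumps of height
    p^(-alpha), one on each cell, each present or absent: the choice makes q *
    delta^2 bounded. No estimator can decide reliably whether a given bump is
    present, even if it knows the others, and averaging over all
    configurations ([assouad_sum]) yields a configuration for which the
    expected number of wrongly decided bumps is proportional to p. Each wrong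
    decision costs p^(-2 alpha) / p in squared L2 distance, and p^(-2 alpha)
    is of order n^(-alpha / (4 alpha + 2)) ([hoelder_risk]). *)

(** * Shifting a normal variable *)

(** The change of variables for a measure given by a density; the normal law
    is treated as Lebesgue measure with the density [normal_pdf]. *)
Section density.
Local Open Scope ereal_scope.
Context d (T : measurableType d) (R : realType).
Variables (mu nu : {measure set T -> \bar R}) (p : T -> R).
Hypotheses (mp : measurable_fun setT p) (p0 : forall x, (0 <= p x)%R).
Hypothesis nuE : forall A, measurable A -> nu A = \int[mu]_(x in A) (p x)%:E.

Import HBNNSimple.

Let density_indic E : measurable E ->
  \int[nu]_x (\1_E x)%:E = \int[mu]_x ((\1_E x)%:E * (p x)%:E).
Proof.
move=> mE; rewrite integral_indic// setIT nuE// integral_mkcond.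
apply: eq_integral => x _; rewrite patchE indicE.
by case: ifP => _; rewrite ?mul1e ?mul0e.
Qed.

Let density_nnsfun (f : {nnsfun T >-> R}) :
  \int[nu]_x (f x)%:E = \int[mu]_x ((f x)%:E * (p x)%:E).
Proof.
under [LHS]eq_integral do rewrite fimfunE -fsumEFin//.
rewrite [LHS]ge0_integral_fsum//; last 2 first.
  - by move=> r; exact/measurable_EFinP/measurableT_comp.
  - by move=> n x _; rewrite EFinM nnfun_muleindic_ge0.
under [RHS]eq_integral.
  move=> x xD; rewrite fimfunE -fsumEFin// muleC ge0_mule_fsumr; last first.
    by move=> r; rewrite EFinM nnfun_muleindic_ge0.
  over.
rewrite [RHS]ge0_integral_fsum//; last 2 first.
  - move=> r; apply/emeasurable_funM; first exact/measurable_EFinP.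
    exact/measurable_EFinP/measurableT_comp.
  - move=> n x _; apply: mule_ge0; first by rewrite lee_fin.
    by rewrite EFinM nnfun_muleindic_ge0.
apply: eq_fsbigr => r _.
rewrite integralZl_indic_nnsfun//= density_indic//.
have [r0|r0] := ltP r 0%R.
  rewrite preimage_nnfun0//.
  rewrite [in LHS]integral0_eq ?mule0; last by move=> x _; rewrite indic0 mul0e.
  by rewrite integral0_eq// => x _; rewrite indic0 mulr0 mule0.
rewrite -ge0_integralZl//.
- by apply: eq_integral => x _; rewrite EFinM [RHS]muleC muleA.
- apply/emeasurable_funM; last exact/measurable_EFinP.
  exact/measurable_EFinP.
- by move=> x _; rewrite mule_ge0 ?lee_fin.
Qed.

Lemma ge0_integral_density (f : T -> \bar R) :
  measurable_fun setT f -> (forall x, 0 <= f x) ->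
  \int[nu]_x f x = \int[mu]_x (f x * (p x)%:E).
Proof.
move=> mf f0.
pose f_ := nnsfun_approx measurableT mf.
transitivity (limn (fun n => \int[nu]_x (f_ n x)%:E)).
  rewrite -monotone_convergence//=.
  - apply: eq_integral => ? /[!inE] xD; apply/esym/cvg_lim => //=.
    exact: cvg_nnsfun_approx.
  - by move=> n; exact/measurable_EFinP/measurable_funTS.
  - by move=> n ? _; rewrite lee_fin.
  - by move=> ? _ ? ? mn; rewrite lee_fin; exact/lefP/nd_nnsfun_approx.
under eq_fun do rewrite density_nnsfun.
rewrite -monotone_convergence//=.
- apply: eq_integral => x _; apply/cvg_lim => //.
  by apply: cvgeZr => //; exact: cvg_nnsfun_approx.
- move=> n; apply/emeasurable_funM; last exact/measurable_EFinP.
  exact/measurable_EFinP.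
- by move=> n x _; rewrite mule_ge0 ?lee_fin.
- move=> x _ a b ab; apply: lee_wpmul2r; rewrite lee_fin//.
  exact/lefP/nd_nnsfun_approx.
Qed.

End density.

Section translation.
Context {R : realType}.
Notation mu := (@lebesgue_measure R).

Lemma lebesgue_measure_translation (s : R) A : measurable A ->
  pushforward mu (+%R^~ s : _ -> measurableTypeR R) A = mu A.
Proof.
move=> mA; have ms : measurable_fun setT (+%R^~ s : R -> R).
  exact: measurable_funD.
apply/esym/lebesgue_measure_unique => //= _ [[a b]] _ <-.
have -> : pushforward mu (+%R^~ s : _ -> measurableTypeR R) `]a, b] =
    mu `]a - s, b - s].
  rewrite /pushforward; congr (mu _); apply/seteqP; split=> x /=;
    by rewrite !in_itv/= ltrBlDr lerBrDr.
rewrite !lebesgue_measure_itv/= !lte_fin ltrD2r.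
by case: ifP => // _; rewrite -!EFinB; congr (_%:E); lra.
Qed.

Lemma ge0_integral_translation (s : R) (f : R -> \bar R) :
  measurable_fun setT f -> (forall x, 0 <= f x)%E ->
  (\int[mu]_x f (x + s)%R = \int[mu]_x f x)%E.
Proof.
move=> mf f0; have ms : measurable_fun setT (+%R^~ s : R -> R).
  exact: measurable_funD.
transitivity (\int[pushforward mu (+%R^~ s : _ -> measurableTypeR R)]_x f x)%E.
  by rewrite ge0_integral_pushforward.
by apply: eq_measure_integral => A mA _; exact: lebesgue_measure_translation.
Qed.

End translation.

Section normal_shift.
Context {R : realType}.
Notation mu := (@lebesgue_measure R).
Variables (sd : R) (sd_gt0 : 0 < sd).
Notation pdf := (normal_pdf 0 sd).

Let sd_neq0 : sd != 0. Proof. by rewrite gt_eqF. Qed.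

Lemma ge0_integral_normal (f : R -> \bar R) :
  measurable_fun setT f -> (forall x, 0 <= f x)%E ->
  (\int[normal_prob 0 sd]_x f x = \int[mu]_x (f x * (pdf x)%:E))%E.
Proof.
move=> mf f0; apply: ge0_integral_density => //.
- exact: measurable_normal_pdf.
- by move=> x; exact: normal_pdf_ge0.
Qed.

(** Completing the square; this is what makes the Cauchy-Schwarz inequality
    below explicit. *)
Lemma normal_pdf_shift_sqr (s x : R) :
  pdf (x - s) ^+ 2 = expR ((s / sd) ^+ 2) * pdf x * pdf (x - s *+ 2).
Proof.
rewrite !normal_pdfE// /normal_fun !subr0.
set k := normal_peak sd.
transitivity (k * k * (expR (- (x - s) ^+ 2 / (sd ^+ 2 *+ 2)) *
                       expR (- (x - s) ^+ 2 / (sd ^+ 2 *+ 2)))); first by ring.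
transitivity (k * k * (expR ((s / sd) ^+ 2) *
  expR (- x ^+ 2 / (sd ^+ 2 *+ 2)) *
  expR (- (x - s *+ 2) ^+ 2 / (sd ^+ 2 *+ 2)))); last by ring.
by congr (_ * _); rewrite -!expRD; congr expR; field.
Qed.

Let measurable_pdf_shift (c : R) : measurable_fun setT (fun x : R => pdf (x - c)).
Proof.
by apply: (measurableT_comp (measurable_normal_pdf 0 sd)); exact: measurable_funB.
Qed.

Let integral_pdf_shift (c : R) : (\int[mu]_x (pdf (x - c))%:E = 1)%E.
Proof.
rewrite (@ge0_integral_translation _ (- c) (EFin \o pdf)).
- exact: integral_normal_pdf.
- by apply/measurable_EFinP; exact: measurable_normal_pdf.
- by move=> x; rewrite lee_fin normal_pdf_ge0.
Qed.

Let pdf_gt0 x : 0 < pdf x.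
Proof. by rewrite normal_pdfE// mulr_gt0 ?expR_gt0// normal_peak_gt0. Qed.

(** The Cauchy-Schwarz inequality is obtained from an arithmetic-geometric one
    by optimising over [t], which needs no integrability. *)
Lemma sqr_le_of_amgm (A B : \bar R) (c : R) : (0 <= A)%E -> (0 <= B)%E -> 0 < c ->
  (forall t : R, (0 < t)%R -> 2%:E * A <= t%:E * B + (c / t)%:E)%E ->
  (A ^+ 2 <= c%:E * B)%E.
Proof.
move=> A0 B0 c0 AB.
case: B B0 AB => [b|_ _|]; last 2 first.
- by rewrite gt0_muley ?lte_fin// leey.
- by [].
rewrite lee_fin => b0 AB.
case: A A0 AB => [a|_ /(_ 1 ltr01)|]; last 2 first.
- by rewrite gt0_muley ?lte_fin.
- by [].
rewrite lee_fin le_eqVlt => /predU1P[<- _|a0 AB].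
  by rewrite expeS/= mul0e -EFinM lee_fin mulr_ge0// ltW.
have := AB (c / a) (divr_gt0 c0 a0).
rewrite -!EFinM -EFinD lee_fin invf_div mulrCA divff ?gt_eqF// mulr1 => h.
have {}h : a <= c / a * b by lra.
rewrite -EFin_expe lee_fin expr2.
by move: h; rewrite mulrAC ler_pdivlMr.
Qed.

(** Cauchy-Schwarz for the integral of f(x) pdf(x - s), written as f(x)
    pdf(x)^(1/2) times the square root of exp((s/sd)^2) pdf(x - 2s), whose
    square has integral exp((s/sd)^2). *)
Lemma normal_shift_sqr (s : R) (f : R -> \bar R) :
  measurable_fun setT f -> (forall x, 0 <= f x)%E ->
  ((\int[normal_prob 0 sd]_x f (x + s)%R) ^+ 2 <=
    (expR ((s / sd) ^+ 2))%:E * \int[normal_prob 0 sd]_x (f x ^+ 2))%E.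
Proof.
move=> mf f0.
have mfs : measurable_fun setT (fun x : R => f (x + s)).
  by apply: (measurableT_comp mf); exact: measurable_funD.
have mf2 : measurable_fun setT (fun x : R => f x ^+ 2)%E.
  by apply: emeasurable_funM.
have mps c : measurable_fun setT (fun x : R => (pdf (x - c))%:E).
  exact/measurable_EFinP.
have mp0 : measurable_fun setT (fun x : R => (pdf x)%:E).
  by apply/measurable_EFinP; exact: measurable_normal_pdf.
have m1 : measurable_fun setT (fun x : R => f x * (pdf (x - s))%:E)%E.
  exact: emeasurable_funM.
have m2 : measurable_fun setT (fun x : R => f x ^+ 2 * (pdf x)%:E)%E.
  exact: emeasurable_funM.
have f20 x : (0 <= f x ^+ 2)%E by rewrite expe2 mule_ge0.
apply: sqr_le_of_amgm.
- by apply: integral_ge0 => x _.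
- by apply: integral_ge0 => x _.
- exact: expR_gt0.
move=> t t0; rewrite !ge0_integral_normal//.
have -> : (\int[mu]_x (f (x + s)%R * (pdf x)%:E) =
    \int[mu]_x (f x * (pdf (x - s))%:E))%E.
  rewrite -(@ge0_integral_translation _ s (fun x : R => f x * (pdf (x - s))%:E)%E).
  - by apply: eq_integral => x _; rewrite addrK.
  - exact: emeasurable_funM.
  - by move=> x; rewrite mule_ge0// lee_fin normal_pdf_ge0.
rewrite -ge0_integralZl//; last first.
  by move=> x _; rewrite mule_ge0// lee_fin normal_pdf_ge0.
rewrite -ge0_integralZl//; last 2 first.
- by move=> x _; rewrite mule_ge0// lee_fin normal_pdf_ge0.
- by rewrite lee_fin ltW.
set c := expR _.
have -> : (c / t)%:E = (\int[mu]_x ((c / t)%:E * (pdf (x - s *+ 2))%:E))%E.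
  rewrite ge0_integralZl//.
  - by rewrite integral_pdf_shift mule1.
  - exact: mps.
  - by move=> x _; rewrite lee_fin normal_pdf_ge0.
  - by rewrite lee_fin divr_ge0// ?expR_ge0// ltW.
have mp2 : measurable_fun setT (fun x : R => (c / t)%:E * (pdf (x - s *+ 2))%:E)%E.
  exact: emeasurable_funM.
have mp : measurable_fun setT (fun x : R => t%:E * (f x ^+ 2 * (pdf x)%:E))%E.
  by apply: emeasurable_funM => //; exact: emeasurable_funM.
have p0 x : (0 <= t%:E * (f x ^+ 2 * (pdf x)%:E))%E.
  by rewrite !mule_ge0// lee_fin ?normal_pdf_ge0// ltW.
have p20 x : (0 <= (c / t)%:E * (pdf (x - s *+ 2))%:E)%E.
  by rewrite -EFinM lee_fin mulr_ge0 ?normal_pdf_ge0// divr_ge0 ?expR_ge0// ltW.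
have m3 : measurable_fun setT (fun x : R => 2%:E * (f x * (pdf (x - s))%:E))%E.
  exact: emeasurable_funM.
rewrite -ge0_integralD//.
apply: ge0_le_integral => //.
- by move=> x _; rewrite !mule_ge0// lee_fin normal_pdf_ge0.
- exact: emeasurable_funD mp mp2.
move=> x _; case: (f x) (f0 x) => [a|_|//]; last first.
  by rewrite expe2 mulyy !gt0_mulye ?lte_fin// !gt0_muley ?lte_fin// -EFinM addye// leey.
rewrite lee_fin => a0; rewrite -EFin_expe -!EFinM -EFinD lee_fin.
have := normal_pdf_shift_sqr s x; rewrite -/c.
have := pdf_gt0 (x - s); have := pdf_gt0 x; have := pdf_gt0 (x - s *+ 2).
move: (pdf (x - s)) (pdf x) (pdf (x - s *+ 2)) => ps p p2 p2_gt0 p_gt0 ps0 E.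
rewrite -ler_sqr ?nnegrE; last 2 first.
- by rewrite !mulr_ge0// ltW.
- by rewrite addr_ge0// !mulr_ge0// ?sqr_ge0 ?invr_ge0 ?expR_ge0// ltW.
have -> : (2 * (a * ps)) ^+ 2 =
    4 * (t * (a ^+ 2 * p)) * (c / t * p2).
  have -> : 4 * (t * (a ^+ 2 * p)) * (c / t * p2) =
    4 * a ^+ 2 * (c * p * p2) * (t / t) by ring.
  by rewrite -E divff ?gt_eqF//; ring.
have := sqr_ge0 (t * (a ^+ 2 * p) - c / t * p2).
by move: (t * (a ^+ 2 * p)) (c / t * p2) => u v; nra.
Qed.

End normal_shift.

(** * Shifting some coordinates of a Gaussian vector *)

Definition tuple_box {T : Type} K (A : 'I_K -> set T) : set (K.-tuple T) :=
  [set v | forall i, A i (tnth v i)].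

Lemma integral_probability_cst {R : realType} d (T : measurableType d)
    (P : probability T R) (c : \bar R) : (\int[P]_x c = c)%E.
Proof.
transitivity (c * P setT)%E; last by rewrite probability_setT mule1.
exact: integral_cst.
Qed.

Section tuple_measure.
Context {R : realType}.

Lemma measurable_tuple_box K (A : 'I_K -> set R) :
  (forall i, measurable (A i)) -> measurable (tuple_box A).
Proof.
move=> mA; have -> : tuple_box A =
    \bigcap_(i in [set: 'I_K]) ((@tnth K R)^~ i @^-1` A i).
  by apply/seteqP; split=> v /= h i; [move=> _|]; exact: h.
apply: fin_bigcap_measurable; first exact: finite_finset.
move=> i _; rewrite -[X in measurable X]setTI.
by apply: measurable_tnth => //; exact: mA.
Qed.

Lemma tuple_measure_unique K (m1 m2 : {measure set (K.-tuple R) -> \bar R}) :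
  (m1 setT < +oo)%E ->
  (forall A, (forall i, measurable (A i)) -> m1 (tuple_box A) = m2 (tuple_box A)) ->
  forall B, measurable B -> m1 B = m2 B.
Proof.
move=> m1oo m12 B mB.
have boxT : tuple_box (fun _ : 'I_K => [set: R]) = setT.
  by apply/seteqP; split.
apply: (@measure_unique _ _ _ [set C | exists2 A : 'I_K -> set R,
  (forall i, measurable (A i)) & C = tuple_box A] (fun=> setT)) => //.
- apply/seteqP; split.
    apply: smallest_sub; first exact: smallest_sigma_algebra.
    rewrite -bigcup_seq; apply: bigcup_sub => i _ _ [C mC <-].
    apply: sub_sigma_algebra => /=.
    exists (fun j => if j == i then C else setT) => [j|]; first by case: ifP.
    rewrite setTI; apply/seteqP; split=> v /=.
      by move=> Cv j; case: eqP => // ->.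
    by move/(_ i); rewrite eqxx.
  apply: smallest_sub; first exact: sigma_algebra_measurable.
  by move=> _ [A mA ->]; exact: measurable_tuple_box.
- move=> _ _ [A mA ->] [A' mA' ->]; exists (fun i => A i `&` A' i).
    by move=> i; exact: measurableI.
  apply/seteqP; split=> [v [h h'] i|v h]; first by split.
  by split=> i; case: (h i).
- by move=> _; exists (fun=> setT).
- by apply/seteqP; split=> // v _; exists 0%N.
- by move=> _ [A mA ->]; exact: m12.
Qed.

Definition tuple_shift K (s : 'I_K -> R) (v : K.-tuple R) : K.-tuple R :=
  [tuple tnth v i + s i | i < K].

Lemma measurable_tuple_shift K (s : 'I_K -> R) :
  measurable_fun setT (tuple_shift s).
Proof.
apply/measurable_fun_tnthP => i.
rewrite (_ : _ \o _ = fun v => tnth v i + s i); last first.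
  by apply/funext => v /=; rewrite tnth_mktuple.
by apply: measurable_funD => //; exact: measurable_tnth.
Qed.

(** The coordinates are independent, centred and normal with standard
    deviations [sd]; the measures of boxes determine the law. *)
Definition normal_law K (sd : 'I_K -> R) (nu : probability (K.-tuple R) R) :=
  forall A : 'I_K -> set R, (forall i, measurable (A i)) ->
    nu (tuple_box A) = (\prod_(i < K) normal_prob 0 (sd i) (A i))%E.

Definition mk_mfun d d' (T : measurableType d) (T' : measurableType d')
    (f : T -> T') (mf : measurable_fun setT f) : {mfun T >-> T'} :=
  HB.pack f (isMeasurableFun.Build _ _ _ _ _ mf).

End tuple_measure.

(** Fubini for a tuple: the first coordinate is integrated apart from the
    others, for inductions on the number of coordinates. *)
Section tuple_cons.
Context {R : realType} (K : nat).
Variables (sd : 'I_K.+1 -> R) (nu : probability (K.+1.-tuple R) R).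
Hypothesis nuN : normal_law sd nu.

Definition tail_law : probability (K.-tuple R) R :=
  distribution nu (mk_mfun (@measurable_behead _ R K)).

Lemma tail_law_normal : normal_law (fun i => sd (lift ord0 i)) tail_law.
Proof.
move=> A mA.
pose A' (i : 'I_K.+1) := if unlift ord0 i is Some j then A j else setT.
have -> : tail_law (tuple_box A) = nu (tuple_box A').
  rewrite /tail_law /distribution /pushforward; congr (nu _).
  apply/seteqP; split=> v /= h i.
    rewrite /A'; case: unliftP => // j ->.
    by have := h j; rewrite [in X in _ -> X](tuple_eta v) tnthS.
  have := h (lift ord0 i); rewrite /A' liftK.
  by rewrite [in X in X -> _](tuple_eta v) tnthS.
rewrite nuN; last by move=> i; rewrite /A'; case: unlift.
rewrite big_ord_recl {1}/A' unlift_none.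
rewrite (_ : normal_prob _ _ setT = 1%E); last exact: probability_setT.
by rewrite mul1e; apply: eq_bigr => i _; rewrite /A' liftK.
Qed.

Let tcons (z : R * K.-tuple R) : K.+1.-tuple R := [the K.+1.-tuple R of z.1 :: z.2].

Let mtcons : measurable_fun setT tcons.
Proof. by apply: measurable_cons; [exact: measurable_fst|exact: measurable_snd]. Qed.

Lemma ge0_integral_normal_law_cons (f : K.+1.-tuple R -> \bar R) :
  measurable_fun setT f -> (forall v, 0 <= f v)%E ->
  (\int[nu]_v f v = \int[normal_prob 0 (sd ord0)]_x
     \int[tail_law]_v f [the K.+1.-tuple R of x :: v])%E.
Proof.
move=> mf f0.
pose N := [the probability (measurableTypeR R) R of normal_prob 0 (sd ord0)].
have -> : (\int[nu]_v f v =
    \int[pushforward (N \x tail_law)%E tcons]_v f v)%E.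
  apply: eq_measure_integral => B mB _.
  apply: (tuple_measure_unique (m2 := pushforward (N \x tail_law)%E tcons)) => //.
    by apply: le_lt_trans (probability_le1 nu measurableT) _; rewrite ltry.
  move=> A mA.
  transitivity ((N \x tail_law)%E
      (A ord0 `*` tuple_box (fun i => A (lift ord0 i)))); last first.
    rewrite /pushforward; congr ((N \x tail_law)%E _).
    apply/seteqP; split => -[x v] /=.
      move=> [h h'] i; case: (unliftP ord0 i) => [j|] ->; rewrite ?tnthS ?tnth0//.
    move=> h; split; first by have := h ord0; rewrite tnth0.
    by move=> i; have := h (lift ord0 i); rewrite tnthS.
  rewrite product_measure1E//; [|exact: (mA ord0)|exact: measurable_tuple_box].
  transitivity (\prod_(i < K.+1) normal_prob 0 (sd i) (A i))%E; first exact: nuN.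
  rewrite big_ord_recl; congr *%E.
  by apply/esym/tail_law_normal => i; exact: mA.
rewrite ge0_integral_pushforward// fubini_tonelli1//=.
exact: measurableT_comp.
Qed.

End tuple_cons.

Section tuple_shift_bounds.
Context {R : realType}.

Lemma tuple_shift_cons K (s : 'I_K.+1 -> R) (x : R) (v : K.-tuple R) :
  tuple_shift s [the K.+1.-tuple R of x :: v] =
  [the K.+1.-tuple R of (x + s ord0) :: tuple_shift (fun i => s (lift ord0 i)) v].
Proof.
apply: eq_from_tnth => i; rewrite tnth_mktuple.
by case: (unliftP ord0 i) => [j|] ->; rewrite ?tnthS ?tnth0 ?tnth_mktuple.
Qed.

Lemma tuple_shift_sqr K (sd : 'I_K -> R) (nu : probability (K.-tuple R) R)
    (s : 'I_K -> R) (f : K.-tuple R -> \bar R) :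
  normal_law sd nu -> (forall i, 0 < sd i) ->
  measurable_fun setT f -> (forall v, 0 <= f v)%E ->
  ((\int[nu]_v f (tuple_shift s v)) ^+ 2 <=
    (expR (\sum_(i < K) (s i / sd i) ^+ 2))%:E * \int[nu]_v (f v ^+ 2))%E.
Proof.
elim: K => [|K IH] in sd nu s f *; move=> nuN sd0 mf f0.
  rewrite big_ord0 expR0 mul1e.
  have E (g : 0.-tuple R -> \bar R) : (\int[nu]_v g v = g [tuple])%E.
    transitivity (\int[nu]_v (cst (g [tuple]) v))%E.
      by apply: eq_integral => v _; rewrite (tuple0 v).
    exact: integral_probability_cst.
  by rewrite !E (tuple0 (tuple_shift s _)).
have msh : measurable_fun setT (fun v => f (tuple_shift s v)).
  by apply: (measurableT_comp mf); exact: measurable_tuple_shift.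
have mf2 : measurable_fun setT (fun v => f v ^+ 2)%E by exact: emeasurable_funM.
have f20 v : (0 <= f v ^+ 2)%E by rewrite expe2 mule_ge0.
rewrite (ge0_integral_normal_law_cons nuN msh)//.
rewrite (ge0_integral_normal_law_cons nuN mf2)//.
set nu' := tail_law nu; set s' := fun i => s (lift ord0 i).
set N := normal_prob 0 (sd ord0).
have mcons (g : K.+1.-tuple R -> \bar R) : measurable_fun setT g ->
    measurable_fun setT (fun z : R * K.-tuple R =>
      g [the K.+1.-tuple R of z.1 :: z.2]).
  by move=> mg; apply: (measurableT_comp mg); exact: measurable_cons.
have mpair (y : R) : measurable_fun setT (fun v : K.-tuple R => (y, v)).
  exact: measurable_pair1.
pose phi (y : R) := (\int[nu']_v f [the K.+1.-tuple R of y :: tuple_shift s' v])%E.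
pose H (y : R) := (\int[nu']_v (f [the K.+1.-tuple R of y :: v] ^+ 2))%E.
have msh' : measurable_fun setT (fun z : R * K.-tuple R =>
    f [the K.+1.-tuple R of z.1 :: tuple_shift s' z.2]).
  apply: (measurableT_comp mf); apply: measurable_cons => //.
  by apply: measurableT_comp => //; exact: measurable_tuple_shift.
have mphi : measurable_fun setT phi.
  exact: (@measurable_fun_fubini_tonelli_F _ _ _ _ _ nu' _ msh' (fun z => f0 _)).
have mH : measurable_fun setT H.
  exact: (@measurable_fun_fubini_tonelli_F _ _ _ _ _ nu' _ (mcons _ mf2)
    (fun z => f20 _)).
have phi0 y : (0 <= phi y)%E by apply: integral_ge0.
have H0 y : (0 <= H y)%E by apply: integral_ge0.
have phiH y : (phi y ^+ 2 <= (expR (\sum_(i < K) (s' i / sd (lift ord0 i)) ^+ 2))%:E * H y)%E.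
  apply: (IH (fun i => sd (lift ord0 i)) nu' s'
             (fun v => f [the K.+1.-tuple R of y :: v])) => //.
  - exact: tail_law_normal.
  - exact: (measurableT_comp (mcons _ mf) (mpair y)).
have -> : (\int[N]_x \int[nu']_v f (tuple_shift s [the K.+1.-tuple R of x :: v]) =
    \int[N]_x phi (x + s ord0)%R)%E.
  apply: eq_integral => x _; apply: eq_integral => v _.
  by rewrite tuple_shift_cons.
apply: (le_trans (normal_shift_sqr (sd0 ord0) (s ord0) mphi phi0)).
rewrite big_ord_recl expRD EFinM -muleA.
apply: lee_wpmul2l; first by rewrite lee_fin expR_ge0.
rewrite -ge0_integralZl//.
have mphi2 : measurable_fun setT (fun y => phi y ^+ 2)%E by exact: emeasurable_funM.
have mH2 : measurable_fun setT (fun y =>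
    (expR (\sum_(i < K) (s' i / sd (lift ord0 i)) ^+ 2))%:E * H y)%E.
  exact: emeasurable_funM.
apply: ge0_le_integral => //.
- by move=> y _; rewrite expe2 mule_ge0.
- by move=> y _; exact: H0.
Qed.

(** Applying [tuple_shift_sqr] to f would only bound the shifted expectation
    by a square root. It is applied to f + 1/r instead: as f is small compared
    with the constant, the inequality is linearised and its error is of order
    r. *)
Lemma tuple_shift_le K (sd : 'I_K -> R) (nu : probability (K.-tuple R) R)
    (s : 'I_K -> R) (f : K.-tuple R -> R) (r : R) :
  normal_law sd nu -> (forall i, 0 < sd i) ->
  measurable_fun setT f -> (forall v, 0 <= f v <= 1) ->
  0 < r -> \sum_(i < K) (s i / sd i) ^+ 2 <= r ^+ 2 ->
  (\int[nu]_v (f (tuple_shift s v))%:E <=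
     \int[nu]_v (f v)%:E + (4 * r)%:E)%E.
Proof.
move=> nuN sd0 mf f01 r0 sr.
have mfs : measurable_fun setT (fun v => f (tuple_shift s v)).
  by apply: (measurableT_comp mf); exact: measurable_tuple_shift.
have le1 (g : K.-tuple R -> R) : measurable_fun setT g ->
    (forall v, 0 <= g v <= 1) -> exists2 p : R, 0 <= p <= 1 &
    (\int[nu]_v (g v)%:E = p%:E)%E.
  move=> mg g01.
  have i0 : (0 <= \int[nu]_v (g v)%:E)%E.
    by apply: integral_ge0 => v _; rewrite lee_fin; case/andP: (g01 v).
  have i1 : (\int[nu]_v (g v)%:E <= 1)%E.
    apply: (@le_trans _ _ (\int[nu]_v (cst 1 v))%E).
      apply: ge0_le_integral => //.
      - by move=> v _; rewrite lee_fin; case/andP: (g01 v).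
      - exact/measurable_EFinP.
      - by move=> v _; rewrite lee_fin; case/andP: (g01 v).
    by rewrite integral_probability_cst.
  move: i0 i1; case: (\int[nu]_v (g v)%:E)%E => [p|//|//].
  by rewrite !lee_fin => p0 p1; exists p; rewrite ?p0.
have [p0 /andP[p00 p01] E0] := le1 _ mf f01.
have [p1 /andP[p10 p11] E1] := le1 _ mfs (fun v => f01 _).
rewrite E0 E1 -EFinD lee_fin.
(* For r >= 1/4 the claim is trivial, since 4 r is at least 1. *)
have [r4|r4] := lerP (4^-1) r; first lra.
set a := \sum_(i < K) _ in sr.
have a0 : 0 <= a by apply: sumr_ge0 => i _; exact: sqr_ge0.
set c := r^-1.
have c0 : 0 < c by rewrite invr_gt0.
have cr : c * r = 1 by rewrite mulVf// gt_eqF.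
have mfc : measurable_fun setT (fun v => (f v + c)%:E).
  by apply/measurable_EFinP; apply: measurable_funD.
have fc0 v : (0 <= (f v + c)%:E)%E.
  by rewrite lee_fin; case/andP: (f01 v) => h _; rewrite addr_ge0// ltW.
have := tuple_shift_sqr s nuN sd0 mfc fc0; rewrite -/a.
have -> : (\int[nu]_v (f (tuple_shift s v) + c)%:E = (p1 + c)%:E)%E.
  under eq_integral do rewrite EFinD.
  rewrite ge0_integralD//.
  - by rewrite E1 integral_probability_cst.
  - by move=> v _; rewrite lee_fin; case/andP: (f01 (tuple_shift s v)).
  - exact/measurable_EFinP.
  - by move=> v _; rewrite lee_fin ltW.
have h2 : (\int[nu]_v ((f v + c)%:E ^+ 2) <= (p0 * (1 + 2 * c) + c ^+ 2)%:E)%E.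
  have -> : ((p0 * (1 + 2 * c) + c ^+ 2)%:E =
     \int[nu]_v ((f v)%:E * (1 + 2 * c)%:E + (c ^+ 2)%:E))%E.
    have c2 : 0 <= 1 + 2 * c by lra.
    rewrite ge0_integralD//.
    - rewrite ge0_integralZr//.
      + by rewrite E0 integral_probability_cst.
      + exact/measurable_EFinP.
      + by move=> v _; rewrite lee_fin; case/andP: (f01 v).
    - by move=> v _; rewrite -EFinM lee_fin mulr_ge0//; case/andP: (f01 v).
    - by apply/measurable_EFinP; apply: measurable_funM.
    - by move=> v _; rewrite lee_fin sqr_ge0.
  apply: ge0_le_integral => //.
  - by move=> v _; rewrite -EFin_expe lee_fin sqr_ge0.
  - apply: emeasurable_funM; apply/measurable_EFinP; exact: measurable_funD.
  - apply/measurable_EFinP; apply: measurable_funD => //; exact: measurable_funM.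
  - move=> v _; rewrite -EFin_expe -EFinM -EFinD lee_fin.
    by have /andP[fv0 fv1] := f01 v; nra.
have ea0 : (0 <= (expR a)%:E)%E by rewrite lee_fin expR_ge0.
rewrite -EFin_expe => /le_trans/(_ (lee_wpmul2l ea0 h2)).
rewrite -EFinM lee_fin => h.
have ea : expR a <= 1 + 2 * r ^+ 2.
  have a16 : a <= 16^-1 by nra.
  have : expR (- a) >= 1 - a by rewrite -[1 - a]/(1 + - a) expR_ge1Dx.
  rewrite expRN => e1.
  have ep := expR_gt0 a.
  have : (1 - a) * expR a <= 1.
    by rewrite -ler_pdivlMr// mul1r.
  by nra.
have {}h : (p1 + c) ^+ 2 <= (1 + 2 * r ^+ 2) * (p0 * (1 + 2 * c) + c ^+ 2).
  apply: (le_trans h); rewrite ler_wpM2r// addr_ge0 ?sqr_ge0// mulr_ge0//.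
  lra.
have E2 : (1 + 2 * r ^+ 2) * (p0 * (1 + 2 * c) + c ^+ 2) =
   p0 + 2 * c * p0 + c ^+ 2 + 2 * r ^+ 2 * p0 + 4 * r * (c * r) * p0 +
   2 * (c * r) ^+ 2 by ring.
move: h; rewrite E2 cr => h.
have h3 : 2 * c * (p1 - p0) <= p0 + 2 * r ^+ 2 * p0 + 4 * r * p0 + 2 by nra.
have h4 : 2 * c * (p1 - p0) <= 5 by nra.
have -> : p1 = p0 + (p1 - p0) * (c * r) by rewrite cr; ring.
by nra.
Qed.

End tuple_shift_bounds.

Section masked_shift.
Context {R : realType} (K : nat).
Variables (sd : 'I_K -> R) (nu : probability (K.-tuple R) R).
Hypotheses (nuN : normal_law sd nu) (sd0 : forall i, 0 < sd i).
Variable S : pred 'I_K.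

(** The coordinates in [S] are taken from an independent copy, so that a shift
    depending on the others becomes deterministic for the inner integral. *)
Let merge (z : K.-tuple R * K.-tuple R) : K.-tuple R :=
  [tuple if S i then tnth z.2 i else tnth z.1 i | i < K].

Let mmerge : measurable_fun setT merge.
Proof.
apply/measurable_fun_tnthP => i.
rewrite (_ : _ \o _ = fun z => if S i then tnth z.2 i else tnth z.1 i); last first.
  by apply/funext => z /=; rewrite tnth_mktuple.
case: (S i).
  exact: (measurableT_comp (measurable_tnth i) measurable_snd).
exact: (measurableT_comp (measurable_tnth i) measurable_fst).
Qed.

Lemma ge0_integral_normal_law_merge (f : K.-tuple R -> \bar R) :
  measurable_fun setT f -> (forall v, 0 <= f v)%E ->
  (\int[nu]_v f v = \int[nu]_v \int[nu]_v' f (merge (v, v')))%E.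
Proof.
move=> mf f0.
have -> : (\int[nu]_v f v = \int[pushforward (nu \x nu)%E merge]_v f v)%E.
  apply: eq_measure_integral => B mB _.
  apply: (tuple_measure_unique (m2 := pushforward (nu \x nu)%E merge)) => //.
    by apply: le_lt_trans (probability_le1 nu measurableT) _; rewrite ltry.
  move=> A mA.
  pose A1 i := if S i then setT else A i.
  pose A2 i := if S i then A i else setT.
  have mA1 i : measurable (A1 i) by rewrite /A1; case: ifP.
  have mA2 i : measurable (A2 i) by rewrite /A2; case: ifP.
  transitivity ((nu \x nu)%E (tuple_box A1 `*` tuple_box A2)); last first.
    rewrite /pushforward; congr ((nu \x nu)%E _).
    apply/seteqP; split => -[v v'] /=.
      move=> [h h'] i; rewrite tnth_mktuple; have := h i; have := h' i.
      by rewrite /A1 /A2; case: ifP.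
    by move=> h; split=> i; have := h i; rewrite tnth_mktuple /A1 /A2; case: ifP.
  rewrite product_measure1E//; [|exact: measurable_tuple_box..].
  transitivity (\prod_(i < K) normal_prob 0 (sd i) (A i))%E; first exact: nuN.
  transitivity ((\prod_(i < K) normal_prob 0 (sd i) (A1 i)) *
                (\prod_(i < K) normal_prob 0 (sd i) (A2 i)))%E; last first.
    by congr *%E; apply/esym; exact: nuN.
  rewrite -big_split/=; apply: eq_bigr => i _.
  have N1 : normal_prob 0 (sd i) setT = 1%E by exact: probability_setT.
  by rewrite /A1 /A2; case: ifP => _; rewrite N1 ?mul1e ?mule1.
rewrite ge0_integral_pushforward// fubini_tonelli1//=.
exact: measurableT_comp.
Qed.

(** Conditionally on the coordinates off [S] the shift is a constant, and
    [tuple_shift_le] applies with any r whose square exceeds the sum of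
    squares a. The choice r = (lam + a / lam) / 2 does, and has expectation at
    most lam. *)
Lemma masked_shift_le (s : K.-tuple R -> 'I_K -> R) (f : K.-tuple R -> R)
    (lam : R) :
  (forall i, measurable_fun setT (s ^~ i)) ->
  (forall v i, ~~ S i -> s v i = 0) ->
  (forall v v', (forall i, ~~ S i -> tnth v i = tnth v' i) -> s v =1 s v') ->
  measurable_fun setT f -> (forall v, 0 <= f v <= 1) -> 0 < lam ->
  (\int[nu]_v (\sum_(i < K) (s v i / sd i) ^+ 2)%:E <= (lam ^+ 2)%:E)%E ->
  (\int[nu]_v (f (tuple_shift (s v) v))%:E <=
    \int[nu]_v (f v)%:E + (4 * lam)%:E)%E.
Proof.
move=> ms sS sdep mf f01 lam0 Es.
pose a v := \sum_(i < K) (s v i / sd i) ^+ 2.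
have a0 v : 0 <= a v by apply: sumr_ge0 => i _; exact: sqr_ge0.
have ma : measurable_fun setT a.
  apply: measurable_sum => i; apply: measurable_funX.
  by apply: measurable_funM => //; exact: ms.
pose r v := (lam + a v / lam) / 2.
have r0 v : 0 < r v.
  by rewrite divr_gt0// ltr_wpDr// divr_ge0// ltW.
have ar v : a v <= r v ^+ 2.
  have -> : r v ^+ 2 = a v * (lam / lam) + ((lam - a v / lam) / 2) ^+ 2.
    by rewrite /r; field; rewrite gt_eqF.
  by rewrite divff ?gt_eqF// mulr1 lerDl sqr_ge0.
have mr : measurable_fun setT r.
  apply: measurable_funM => //; apply: measurable_funD => //.
  exact: measurable_funM.
have msf : measurable_fun setT (fun v => f (tuple_shift (s v) v)).
  apply: (measurableT_comp mf); apply/measurable_fun_tnthP => i.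
  rewrite (_ : _ \o _ = fun v => tnth v i + s v i); last first.
    by apply/funext => v /=; rewrite tnth_mktuple.
  by apply: measurable_funD => //; exact: measurable_tnth.
have f0 v : 0 <= f v by case/andP: (f01 v).
rewrite (@ge0_integral_normal_law_merge (fun v => (f (tuple_shift (s v) v))%:E)).
- rewrite (@ge0_integral_normal_law_merge (fun v => (f v)%:E)).
  + have mF : measurable_fun setT (fun z => (f (merge z))%:E).
      by apply/measurable_EFinP; apply: (measurableT_comp mf).
    have mF1 : measurable_fun setT (fun v => \int[nu]_v' (f (merge (v, v')))%:E)%E.
      apply: (@measurable_fun_fubini_tonelli_F _ _ _ _ _ nu _ mF).
      by move=> z; rewrite lee_fin.
    have mG : measurable_fun setT
        (fun z => (f (tuple_shift (s (merge z)) (merge z)))%:E).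
      by apply/measurable_EFinP; apply: (measurableT_comp msf).
    have mG1 : measurable_fun setT (fun v =>
        \int[nu]_v' (f (tuple_shift (s (merge (v, v'))) (merge (v, v'))))%:E)%E.
      apply: (@measurable_fun_fubini_tonelli_F _ _ _ _ _ nu _ mG).
      by move=> z; rewrite lee_fin.
    have m4r : measurable_fun setT (fun v => (4 * r v)%:E).
      by apply/measurable_EFinP; apply: measurable_funM.
    apply: (@le_trans _ _ (\int[nu]_v
       (\int[nu]_v' (f (merge (v, v')))%:E + (4 * r v)%:E))%E).
      apply: ge0_le_integral => //.
      * by move=> v _; apply: integral_ge0 => v' _; rewrite lee_fin.
      * exact: emeasurable_funD.
      * move=> v _.
        have mm : measurable_fun setT (fun v' => f (merge (v, v'))).
          apply: (measurableT_comp mf); apply: (measurableT_comp mmerge).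
          exact: measurable_pair1.
        have := @tuple_shift_le R K sd nu (s v) (fun v' => f (merge (v, v')))
           (r v) nuN sd0 mm (fun v' => f01 _) (r0 v) (ar v).
        congr (_ <= _)%E; apply: eq_integral => v' _; congr (f _)%:E.
        have E : s (merge (v, v')) =1 s v.
          by apply: sdep => i /negbTE Si; rewrite tnth_mktuple Si.
        apply: eq_from_tnth => i; rewrite !tnth_mktuple E.
        by case: ifP => // /negbT /(sS v) ->; rewrite addr0.
    rewrite ge0_integralD//.
    * apply: leeD2l.
      rewrite (_ : (fun _ => _) = fun v =>
          (2 * lam)%:E + (2 / lam)%:E * (a v)%:E)%E; last first.
        apply/funext => v; rewrite -EFinM -EFinD; congr (_%:E).
        by rewrite /r; field; rewrite gt_eqF.
      have l2 : 0 <= 2 / lam by rewrite divr_ge0// ltW.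
      have l3 : 0 <= 2 * lam by rewrite mulr_ge0// ltW.
      rewrite ge0_integralD//.
      - rewrite integral_probability_cst ge0_integralZl//.
        + apply: (@le_trans _ _ ((2 * lam)%:E + (2 / lam)%:E * (lam ^+ 2)%:E)%E).
            by apply: leeD2l; apply: lee_wpmul2l; rewrite ?lee_fin.
          rewrite -EFinM -EFinD lee_fin.
          rewrite (_ : 2 / lam * lam ^+ 2 = 2 * lam); first lra.
          by field; rewrite gt_eqF.
        + exact/measurable_EFinP.
        + by move=> v _; rewrite lee_fin.
      - by move=> v _; rewrite -EFinM lee_fin mulr_ge0.
      - by apply/measurable_EFinP; apply: measurable_funM.
    * by move=> v _; apply: integral_ge0 => v' _; rewrite lee_fin.
    * by move=> v _; rewrite lee_fin mulr_ge0// ltW.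
  + exact/measurable_EFinP.
  + by move=> v; rewrite lee_fin.
- exact/measurable_EFinP.
- by move=> v; rewrite lee_fin.
Qed.

End masked_shift.

(** * Lipschitz approximation of Borel sets *)

Lemma cvg0e_lt {R : realType} (u : nat -> \bar R) (eta : R) :
  u @ \oo --> 0%E -> 0 < eta ->
  exists N, forall k, (N <= k)%N -> (u k < eta%:E)%E.
Proof.
move=> /fine_cvgP[[N1 _ h1] h2] eta0.
have [N2 _ h3] := cvgr_lt 0 h2 _ eta0.
exists (maxn N1 N2) => k; rewrite geq_max => /andP[k1 k2].
by rewrite -(fineK (h1 k k1)) lte_fin; exact: h3.
Qed.

Definition lipschitz_test {R : realType} n (f : n.-tuple R -> R) :=
  measurable_fun setT f /\ (forall y, 0 <= f y <= 1) /\
  exists2 c : R, 0 <= c &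
    forall y y', `|f y - f y'| <= c * \sum_(i < n) `|tnth y i - tnth y' i|.

Section lipschitz_approximation.
Context {R : realType} (n : nat).
Variable m : {measure set (n.-tuple R) -> \bar R}.
Hypothesis m_fin : (m setT < +oo)%E.

(** The approximation is exact off a small set; this survives complements and
    unions more easily than closeness in L1. *)
Definition lip_approximable (B : set (n.-tuple R)) :=
  measurable B /\ forall eta : R, 0 < eta ->
    exists f, exists2 E, lipschitz_test f &
      [/\ measurable E, (m E < eta%:E)%E & forall y, ~ E y -> f y = \1_B y].

Let m_fin_num E : measurable E -> (m E < +oo)%E.
Proof.
move=> mE; apply: le_lt_trans m_fin.
by apply: le_measure => //; rewrite inE.
Qed.

Lemma small_cap (E : nat -> set (n.-tuple R)) (eta : R) :
  (forall k, measurable (E k)) -> nonincreasing_seq E ->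
  \bigcap_k E k = set0 -> 0 < eta -> exists k, (m (E k) < eta%:E)%E.
Proof.
move=> mE nE E0 eta0.
have := @nonincreasing_cvg_mu _ _ _ m E (m_fin_num (mE 0%N)) mE.
rewrite E0 measure0 => /(_ measurable0 nE) h.
by have [k /(_ k (leqnn k))] := cvg0e_lt h eta0; exists k.
Qed.

(** A continuous ramp of slope k from x to x + 1/k differs from the indicator
    only on a strip, which decreases to the empty set as k grows. *)
Lemma lip_approximable_ray i (x : R) :
  lip_approximable [set y | x < tnth y i].
Proof.
have mB : measurable [set y : n.-tuple R | x < tnth y i].
  rewrite (_ : [set y | _] = (@tnth n R)^~ i @^-1` `]x, +oo[).
    rewrite -[X in measurable X]setTI.
    by apply: (measurable_tnth i) => //; exact: measurable_itv.
  by apply/seteqP; split=> y /=; rewrite in_itv/= andbT.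
split=> // eta eta0.
pose E k := [set y : n.-tuple R | x < tnth y i < x + k.+1%:R^-1].
have [k Ek] : exists k, (m (E k) < eta%:E)%E.
  apply: small_cap => //.
  - move=> k; rewrite (_ : E k = (@tnth n R)^~ i @^-1` `]x, x + k.+1%:R^-1[).
      rewrite -[X in measurable X]setTI.
      by apply: (measurable_tnth i) => //; exact: measurable_itv.
    by apply/seteqP; split=> y /=; rewrite in_itv/=.
  - move=> k l kl; apply/subsetPset => y; rewrite /E /= => /andP[xy yx].
    rewrite xy (lt_le_trans yx)//.
    by rewrite lerD2l lef_pV2 ?posrE// ler_nat.
  - apply/seteqP; split=> // y h.
    have /andP[xy _] : x < tnth y i < x + 1%:R^-1 by exact: (h 0%N).
    have /ltr_add_invr[k kx] := xy.
    have /andP[_] : x < tnth y i < x + k.+1%:R^-1 by exact: (h k).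
    by rewrite ltNge ltW.
pose K : R := k.+1%:R.
have K0 : 0 < K by rewrite ltr0n.
exists (fun y => Num.min 1 (Num.max 0 (K * (tnth y i - x)))), (E k).
  split; last split=> [y|].
    apply: measurable_minr => //; apply: measurable_maxr => //.
    apply: measurable_funM => //; apply: measurable_funB => //.
    exact: measurable_tnth.
    rewrite le_min ler01/= le_max lexx/= ge_min lexx//.
  exists K; first exact: ltW.
  move=> y y'; apply: (@le_trans _ _ (K * `|tnth y i - tnth y' i|)); last first.
    apply: ler_wpM2l; first exact: ltW.
    by rewrite (bigD1 i)//= lerDl sumr_ge0.
  have -> : K * `|tnth y i - tnth y' i| =
      `|K * (tnth y i - x) - K * (tnth y' i - x)|.
    by rewrite -mulrBr normrM gtr0_norm//; congr (_ * `|_|); ring.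
  move: (K * _) (K * _) => a b.
  rewrite /Num.min /Num.max; case: ifP; case: ifP; case: ifP; case: ifP;
    do ?[move/negbT; rewrite -?leNgt|move=> ?]; rewrite ler_norml; apply/andP;
    have := ler_norm (a - b); have := ler_norm (b - a); rewrite (distrC b);
    split; lra.
split=> //.
- rewrite (_ : E k = (@tnth n R)^~ i @^-1` `]x, x + k.+1%:R^-1[).
    rewrite -[X in measurable X]setTI.
    by apply: (measurable_tnth i) => //; exact: measurable_itv.
  by apply/seteqP; split=> y /=; rewrite in_itv/=.
- move=> y /negP; rewrite negb_and -!leNgt => /orP[yx|yx].
    rewrite indicE memNset/= ?ltNge ?yx//.
    rewrite max_l ?min_r//.
    by rewrite pmulr_rle0// subr_le0.
  have xy : x < tnth y i.
    by apply: lt_le_trans yx; rewrite ltrDl invr_gt0.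
  rewrite indicE mem_set//= min_l// le_max; apply/orP; right.
  rewrite mulrC -ler_pdivrMr// mul1r lerBrDl; exact: yx.
Qed.

Lemma lip_approximableC B : lip_approximable B -> lip_approximable (~` B).
Proof.
move=> [mB h]; split; first exact: measurableC.
move=> eta /h[f [E [mf [f01 [c c0 fc]]] [mE mEe fE]]].
exists (fun y => 1 - f y), E.
  split; first exact: measurable_funB.
  split; first by move=> y; have := f01 y; lra.
  exists c => // y y'; rewrite (_ : 1 - f y - (1 - f y') = f y' - f y); last by ring.
  by rewrite distrC.
split=> // y /fE ->; rewrite !indicE in_setC; by case: (y \in B); rewrite /= ?subr0 ?subrr.
Qed.

Lemma lip_approximableU A B : lip_approximable A -> lip_approximable B ->
  lip_approximable (A `|` B).
Proof.
move=> [mA hA] [mB hB]; split; first exact: measurableU.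
move=> eta eta0; have e2 : 0 < eta / 2 by rewrite divr_gt0.
have [f [E [mf [f01 [c c0 fc]]] [mE mEe fE]]] := hA _ e2.
have [g [F [mg [g01 [d d0 gd]]] [mF mFe gF]]] := hB _ e2.
exists (fun y => Num.max (f y) (g y)), (E `|` F).
  split; first exact: measurable_maxr.
  split.
    move=> y; have := f01 y; have := g01 y.
    by rewrite /Num.max; case: ifP => _ /andP[? ?] /andP[? ?]; apply/andP; split.
  exists (c + d); first exact: addr_ge0.
  move=> y y'; rewrite mulrDl.
  apply: (le_trans _ (lerD (fc y y') (gd y y'))).
  move: (f y) (f y') (g y) (g y') => a a' b b'.
  have := ler_norm (a - a'); have := ler_norm (a' - a); rewrite (distrC a').
  have := ler_norm (b - b'); have := ler_norm (b' - b); rewrite (distrC b').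
  move=> h1 h2 h3 h4; rewrite ler_norml /Num.max; apply/andP.
  have := normr_ge0 (a - a'); have := normr_ge0 (b - b').
  by case: ifP; case: ifP; do ?[move/negbT; rewrite -?leNgt|move=> ?]; split; lra.
split; first exact: measurableU.
  apply: (@le_lt_trans _ _ (m E + m F)%E); first exact: measureU2.
  by rewrite [eta]splitr EFinD lteD.
move=> y /not_orP[/fE -> /gF ->].
rewrite !indicE in_setU; case: (y \in A); case: (y \in B) => /=;
  by rewrite /Num.max ?ltxx ?ltr01 ?ltr10//; case: ifP.
Qed.

Lemma lip_approximable_bigcup (B : nat -> set (n.-tuple R)) :
  (forall k, lip_approximable (B k)) -> lip_approximable (\bigcup_k B k).
Proof.
move=> hB.
have mB k : measurable (B k) by case: (hB k).
have m0 : lip_approximable set0.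
  split=> // eta eta0; exists (fun=> 0), set0.
    split=> //; split; first by move=> y; rewrite lexx ler01.
    by exists 0 => // y y'; rewrite subrr normr0 mul0r.
  by split=> //; rewrite ?measure0 ?lte_fin// => y _; rewrite indic0.
pose BN N := \big[setU/set0]_(k < N) B k.
have hN N : lip_approximable (BN N).
  rewrite /BN; elim: N => [|N IH]; first by rewrite big_ord0.
  by rewrite big_ord_recr/=; exact: lip_approximableU.
split; first exact: bigcupT_measurable.
move=> eta eta0; have e2 : 0 < eta / 2 by rewrite divr_gt0.
pose E N := \bigcup_k B k `\` BN N.
have mE N : measurable (E N).
  by apply: measurableD; [exact: bigcupT_measurable|case: (hN N)].
have [N EN] : exists N, (m (E N) < (eta / 2)%:E)%E.
  apply: small_cap => //.
  - move=> a b ab; apply/subsetPset => y [By nB]; split=> //.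
    apply: contra_not nB; rewrite /BN -!bigcup_mkord => -[k /= ka Bk].
    by exists k => //=; exact: leq_trans ab.
  - apply/seteqP; split=> // y h; have [[k _ Bk] _] := h 0%N I.
    have [_] := h k.+1 I; apply; rewrite /BN -bigcup_mkord.
    by exists k => //=.
have [f [F lf [mF mFe fF]]] := (hN N).2 _ e2.
exists f, (E N `|` F) => //; split; first exact: measurableU.
  apply: (@le_lt_trans _ _ (m (E N) + m F)%E); first exact: measureU2.
  by rewrite [eta]splitr EFinD lteD.
move=> y /not_orP[nE /fF ->]; rewrite !indicE; congr (_%:R); congr nat_of_bool.
apply/idP/idP; rewrite !inE.
  by rewrite /BN -bigcup_mkord => -[k _ Bk]; exists k.
by move=> By; apply: contrapT => nB; apply: nE.
Qed.

(** Approximable sets form a sigma-algebra that contains the rays in each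
    coordinate. *)
Lemma measurable_lip_approximable B : measurable B -> lip_approximable B.
Proof.
have s1 : sigma_algebra setT lip_approximable.
  split.
  - split=> // eta eta0; exists (fun=> 0), set0.
      split=> //; split; first by move=> y; rewrite lexx ler01.
      by exists 0 => // y y'; rewrite subrr normr0 mul0r.
    by split=> //; rewrite ?measure0 ?lte_fin// => y _; rewrite indic0.
  - by move=> A hA; rewrite setTD; exact: lip_approximableC.
  - exact: lip_approximable_bigcup.
move: B; apply: smallest_sub => //.
rewrite -bigcup_seq; apply: bigcup_sub => i _ _ [C mC <-]; rewrite setTI.
have {}mC : (@RGenOInfty.G R).-sigma.-measurable C.
  by rewrite -RGenOInfty.measurableE.
move: C mC.
apply: (@smallest_sub _ _ _ [set C | lip_approximable ((@tnth n R)^~ i @^-1` C)]).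
  split.
  - by rewrite /= preimage_set0; case: s1.
  - by move=> A /= hA; rewrite setTD preimage_setC; exact: lip_approximableC.
  - by move=> F hF /=; rewrite preimage_bigcup; exact: lip_approximable_bigcup.
move=> _ [x ->] /=.
rewrite (_ : _ @^-1` _ = [set y : n.-tuple R | x < tnth y i]).
  exact: lip_approximable_ray.
by apply/seteqP; split=> y /=; rewrite in_itv/= andbT.
Qed.

End lipschitz_approximation.

(** * The variance of a normal variable *)

Section normal_variance.
Context {R : realType}.
Notation mu := (@lebesgue_measure R).
Variables (sd : R) (sd_gt0 : 0 < sd).
Notation pdf := (normal_pdf 0 sd).

Let sd_neq0 : sd != 0. Proof. by rewrite gt_eqF. Qed.

Let is_derive_pdf (x : R) : is_derive x 1 (fun x : R => - sd ^+ 2 * x * pdf x)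
  ((x ^+ 2 - sd ^+ 2) * pdf x).
Proof.
have -> : (fun x : R => - sd ^+ 2 * x * pdf x) =
  (fun x : R => - sd ^+ 2 * x * (normal_peak sd * expR (- x ^+ 2 / (sd ^+ 2 *+ 2)))).
  by apply/funext => y; rewrite normal_pdfE// /normal_fun subr0.
rewrite normal_pdfE// /normal_fun subr0.
apply: is_derive_eq.
rewrite /GRing.scale/=.
set e := expR _; set k := normal_peak _.
by field.
Qed.

Let continuous_pdf : continuous (pdf : R -> R).
Proof. exact: continuous_normal_pdf. Qed.

Let f0 (x : R) := (x ^+ 2 - sd ^+ 2) * pdf x.

Let continuous_sqr_pdf : continuous (fun x : R => x ^+ 2 * pdf x).
Proof.
move=> x; apply: cvgM; last exact: continuous_pdf.
exact: sqr_continuous.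
Qed.

Let compact_integrable (g : R -> R) (k : R) : continuous g ->
  mu.-integrable `[- k, k] (EFin \o g).
Proof.
move=> cg; apply: continuous_compact_integrable; first exact: segment_compact.
exact: continuous_subspaceT.
Qed.

(** The function - sd^2 * x * pdf x is a primitive of (x^2 - sd^2) * pdf x. *)
Let truncated_variance (k : R) : 0 < k ->
  (\int[mu]_(x in `[(- k)%R, k]) (x ^+ 2 * pdf x)%:E =
   (sd ^+ 2)%:E * \int[mu]_(x in `[(- k)%R, k]) (pdf x)%:E -
   (2 * sd ^+ 2 * k * pdf k)%:E)%E.
Proof.
move=> k0.
have cf0 : continuous f0.
  move=> x; apply: cvgM; last exact: continuous_pdf.
  by apply: cvgB; [exact: sqr_continuous|exact: cvg_cst].
have := @continuous_FTC2 R f0 (fun x : R => - sd ^+ 2 * x * pdf x) (- k) k.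
rewrite gtrN// => /(_ isT).
have cF : continuous (fun x : R => - sd ^+ 2 * x * pdf x).
  by move=> x; apply/differentiable_continuous/derivable1_diffP; case: (is_derive_pdf x).
move=> /(_ (continuous_subspaceT cf0)) h.
have {h} := h _ _.
have -> : (\int[mu]_(x in `[(- k)%R, k]) (f0 x)%:E =
  \int[mu]_(x in `[(- k)%R, k]) (x ^+ 2 * pdf x)%:E -
  (sd ^+ 2)%:E * \int[mu]_(x in `[(- k)%R, k]) (pdf x)%:E)%E.
  rewrite -integralZl//; last exact: compact_integrable.
  rewrite -integralB//.
  - apply: eq_integral => x _; rewrite -EFinM -EFinB; congr (_%:E).
    by rewrite /f0; ring.
  - exact: compact_integrable.
  - by apply: integrableZl => //; exact: compact_integrable.
have pk : pdf (- k) = pdf k by rewrite !normal_pdfE// /normal_fun !subr0 sqrrN.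
rewrite pk => h.
have fin1 : (\int[mu]_(x in `[(- k)%R, k]) (x ^+ 2 * pdf x)%:E)%E \is a fin_num.
  by apply: integrable_fin_num => //; exact: compact_integrable.
have fin2 : (\int[mu]_(x in `[(- k)%R, k]) (pdf x)%:E)%E \is a fin_num.
  by apply: integrable_fin_num => //; exact: compact_integrable.
move: h fin1 fin2; case: (\int[mu]_(x in _) _)%E => // a.
case: (\int[mu]_(x in _) _)%E => // b h _ _; move: h.
rewrite -!EFinM -!EFinB => h.
have {}h : a - sd ^+ 2 * b = - sd ^+ 2 * k * pdf k - - sd ^+ 2 * - k * pdf k.
  have : (a - sd ^+ 2 * b)%:E = (- sd ^+ 2 * k * pdf k - - sd ^+ 2 * - k * pdf k)%:E :> \bar R.
    apply: h.
    - split.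
      + by move=> x _; case: (is_derive_pdf x).
      + exact/cvg_at_right_filter/cF.
      + exact/cvg_at_left_filter/cF.
    - by move=> x _; rewrite derive1E; have [_ ->] := is_derive_pdf x.
  by case.
congr (_%:E).
have -> : a = (a - sd ^+ 2 * b) + sd ^+ 2 * b by ring.
by rewrite h; ring.
Qed.

(** The boundary term of the truncated identity tends to 0, since exp(w) >= w
    makes it O(1/k). *)
Lemma normal_second_moment :
  (\int[normal_prob 0 sd]_x (x ^+ 2)%:E = (sd ^+ 2)%:E)%E.
Proof.
rewrite ge0_integral_normal; last 2 first.
- by apply/measurable_EFinP; exact: measurable_funX.
- by move=> x; rewrite lee_fin sqr_ge0.
pose E (k : nat) : set R := `[- k.+1%:R, k.+1%:R]%classic.
have ET : \bigcup_k E k = setT.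
  apply/seteqP; split=> // x _.
  have [k xk] := ltr_add_invr (ltr01 : 0 < 1 :> R).
  exists (Num.truncn `|x|) => //; rewrite /E /= in_itv/= -ler_norml.
  exact/ltW/truncnS_gt.
have ndE : nondecreasing_seq E.
  move=> a b ab; apply/subsetPset => x; rewrite /E /= !in_itv/= -!ler_norml.
  by move=> /le_trans; apply; rewrite ler_nat.
have mE k : measurable (E k) by exact: measurable_itv.
have m1 : measurable_fun setT (fun x : R => (x ^+ 2 * pdf x)%:E).
  apply/measurable_EFinP; apply: measurable_funM; first exact: measurable_funX.
  exact: measurable_normal_pdf.
have m2 : measurable_fun setT (fun x : R => (pdf x)%:E).
  by apply/measurable_EFinP; exact: measurable_normal_pdf.
have c1 : (\int[mu]_(x in E k) (x ^+ 2 * pdf x)%:E @[k --> \oo] -->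
    \int[mu]_(x in \bigcup_k E k) (x ^+ 2 * pdf x)%:E)%E.
  apply: ge0_nondecreasing_set_cvg_integral => //.
  - by move=> k; exact: measurable_funTS m1.
  - by move=> k x _; rewrite lee_fin mulr_ge0 ?sqr_ge0 ?normal_pdf_ge0.
have c2 : (\int[mu]_(x in E k) (pdf x)%:E @[k --> \oo] -->
    \int[mu]_(x in \bigcup_k E k) (pdf x)%:E)%E.
  apply: ge0_nondecreasing_set_cvg_integral => //.
  - by move=> k; exact: measurable_funTS m2.
  - by move=> k x _; rewrite lee_fin normal_pdf_ge0.
rewrite ET in c1 c2.
rewrite integral_normal_pdf in c2.
under eq_integral do rewrite -EFinM.
apply/esym; apply: cvg_unique c1 => //.
rewrite /=; under eq_fun => k do rewrite (truncated_variance (ltr0Sn R k)).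
suff : (((sd ^+ 2)%:E * \int[mu]_(x in E k) (pdf x)%:E -
    (2 * sd ^+ 2 * k.+1%:R * pdf k.+1%:R)%:E)%E @[k --> \oo] -->
    (sd ^+ 2)%:E * 1 - 0)%E by rewrite mule1 sube0.
apply: cvgeB => //; first exact: cvgeZl.
apply: cvg_EFin; first exact: nearW.
pose C := 4 * sd ^+ 4 * normal_peak sd.
apply: (@squeeze_cvgr _ _ _ _ (fun=> 0) (fun k => C * harmonic k)).
- apply: nearW => k; apply/andP; split.
    by rewrite /= mulr_ge0 ?normal_pdf_ge0// mulr_ge0 ?ler0n// mulr_ge0 ?sqr_ge0.
  rewrite /= normal_pdfE// /normal_fun subr0 /harmonic mulNr expRN.
  set t : R := k.+1%:R; have t0 : 0 < t by rewrite ltr0n.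
  set w := t ^+ 2 / _.
  have w0 : 0 < w by rewrite divr_gt0 ?exprn_gt0// pmulrn_rgt0// exprn_gt0.
  have : (expR w)^-1 <= w^-1.
    rewrite lef_pV2 ?posrE ?expR_gt0//.
    by apply: le_trans (expR_ge1Dx w); rewrite lerDr.
  have p0 := normal_peak_ge0 sd.
  move=> /(ler_wpM2l p0)/(ler_wpM2l (ltW t0)).
  move=> /(ler_wpM2l (sqr_ge0 sd)); rewrite -(ler_pM2l (ltr0n R 2)) !mulrA => h.
  apply: (le_trans h); rewrite /C /w le_eqVlt; apply/orP; left; apply/eqP.
  by field; rewrite sd_neq0 gt_eqF.
- exact: cvg_cst.
- by rewrite -[X in _ --> X](mulr0 C); apply: cvgMr; exact: cvg_harmonic.
Qed.

End normal_variance.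

(** * Isometry of the Wiener integral on step functions *)

Section isometry.
Context {R : realType}.

(** The polarised form of |t - s|, the second moment of a Brownian increment:
    the covariance of two increments. *)
Definition increment_cov (q q' : R * R * R) : R :=
  (`|q.1.2 - q'.1.1| + `|q.1.1 - q'.1.2| - `|q.1.2 - q'.1.2| - `|q.1.1 - q'.1.1|) / 2.

Definition step_form (s : seq (R * R * R)) : R :=
  \sum_(q <- s) \sum_(q' <- s) q.2 * q'.2 * increment_cov q q'.

Definition within01 (s : seq (R * R * R)) : Prop :=
  forall q, q \in s -> q.1.1 \in `[0, 1] /\ q.1.2 \in `[0, 1].

Lemma subdivided01_within01 s : subdivided01 s -> within01 s.
Proof.
move=> /allP h q /h /and3P[q0 q12 q1]; rewrite !in_itv/= q0 q1 andbT.
by rewrite (le_trans q12 q1) (le_trans q0 q12).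
Qed.

(** Only the second moments of increments enter, so the same identity holds
    for a Brownian motion over its probability space and for the indicators of
    ]0, t] over Lebesgue measure. The isometry between step functions and
    their integrals follows by comparing the two. *)
Section abstract_isometry.
Context d (T : measurableType d) (m : {measure set T -> \bar R}) (V : R -> T -> R).
Hypothesis mV : forall t, measurable_fun setT (V t).
Hypothesis dV : forall s t, s \in `[0, 1] -> t \in `[0, 1] ->
  (\int[m]_w ((V t w - V s w) ^+ 2)%:E = `|t - s|%:E)%E.

Let mdV s t : measurable_fun setT (fun w => (V t w - V s w) ^+ 2).
Proof. by apply: measurable_funX; exact: measurable_funB. Qed.

Let idV s t : s \in `[0, 1] -> t \in `[0, 1] ->
  m.-integrable setT (fun w => ((V t w - V s w) ^+ 2)%:E).
Proof.
move=> s1 t1; apply/integrableP; split; first exact/measurable_EFinP.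
under eq_integral do rewrite /= ger0_norm ?sqr_ge0//.
by rewrite dV// ltry.
Qed.

(** A product of two increments is a combination of four squares of
    increments. *)
Lemma step_isometry s : within01 s ->
  (\int[m]_w ((\sum_(q <- s) q.2 * (V q.1.2 w - V q.1.1 w)) ^+ 2)%:E =
   (step_form s)%:E)%E.
Proof.
move=> s01.
pose D (u v : R) w := ((V u w - V v w) ^+ 2)%:E.
pose k (q q' : R * R * R) : R := q.2 * q'.2 / 2.
pose F q q' w := ((k q q')%:E * D q.1.2 q'.1.1 w + (k q q')%:E * D q.1.1 q'.1.2 w
   + ((- k q q')%:E * D q.1.2 q'.1.2 w + (- k q q')%:E * D q.1.1 q'.1.1 w))%E.
have iF q q' : q \in s -> q' \in s -> m.-integrable setT (F q q').
  move=> /s01[q1 q2] /s01[q'1 q'2].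
  by apply: integrableD => //; apply: integrableD => //;
    apply: integrableZl => //; exact: idV.
have EF q q' : q \in s -> q' \in s ->
    (\int[m]_w F q q' w = (q.2 * q'.2 * increment_cov q q')%:E)%E.
  move=> /s01[q1 q2] /s01[q'1 q'2].
  have iZ c u v : u \in `[0, 1] -> v \in `[0, 1] ->
      m.-integrable setT (fun w => c%:E * D u v w)%E.
    by move=> u1 v1; apply: integrableZl => //; exact: idV.
  have EZ c u v : u \in `[0, 1] -> v \in `[0, 1] ->
      (\int[m]_w (c%:E * D u v w) = (c * `|u - v|)%:E)%E.
    by move=> u1 v1; rewrite integralZl//; [rewrite dV|exact: idV].
  rewrite integralD//; [|by apply: integrableD => //; exact: iZ..].
  rewrite integralD//; [|exact: iZ..].
  rewrite integralD//; [|exact: iZ..].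
  rewrite !EZ// -!EFinD; congr (_%:E).
  by rewrite /k /increment_cov; field.
pose G q q' w := if (q \in s) && (q' \in s) then F q q' w else 0%E.
have iG q q' : m.-integrable setT (G q q').
  have [qs|nqs] := boolP ((q \in s) && (q' \in s)).
    rewrite (_ : G q q' = F q q'); last by apply/funext => w; rewrite /G qs.
    by case/andP: qs => qs q's; exact: iF.
  rewrite (_ : G q q' = cst 0%E); first exact: integrable0.
  by apply/funext => w; rewrite /G (negbTE nqs).
transitivity (\int[m]_w (\sum_(q <- s) \sum_(q' <- s) G q q' w))%E.
  apply: eq_integral => w _.
  rewrite expr2 mulr_suml -sumEFin; apply: eq_big_seq => q qs.
  rewrite mulr_sumr -sumEFin; apply: eq_big_seq => q' q's.
  by rewrite /G qs q's/= /F /D /k -!EFinM -!EFinD; congr (_%:E); field.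
rewrite integral_sum//; last by move=> q; exact: integrable_sum.
rewrite /step_form -sumEFin; apply: eq_big_seq => q qs.
rewrite integral_sum// -sumEFin; apply: eq_big_seq => q' q's.
by rewrite /G qs q's/= EF.
Qed.

End abstract_isometry.

Lemma indic_oc (a b x : R) : \1_(`]a, b]) x = ((a < x <= b)%R : bool)%:R :> R.
Proof.
rewrite indicE; congr (_%:R); congr nat_of_bool.
by apply/idP/idP; rewrite inE/= in_itv/=.
Qed.

Lemma lebesgue_indicator_increment (s t : R) : s \in `[0, 1] -> t \in `[0, 1] ->
  (\int[lebesgue_measure]_x
     ((\1_(`]0%R, t]) x - \1_(`]0%R, s]) x : R) ^+ 2)%:E = `|t - s|%:E)%E.
Proof.
wlog st : s t / s <= t.
  move=> h s1 t1; have [st|/ltW ts] := leP s t; first exact: h.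
  rewrite distrC -h//; apply: eq_integral => x _; congr (_%:E); ring.
rewrite !in_itv/= => /andP[s0 s1] /andP[t0 t1].
rewrite ger0_norm ?subr_ge0//.
transitivity (\int[lebesgue_measure]_x (\1_(`]s, t]) x : R)%:E)%E.
  apply: eq_integral => x _; congr (_%:E).
  rewrite !indic_oc.
  have [xs|sx] := leP x s; rewrite /= ?(le_trans xs st) ?andbT ?andbF.
    by rewrite subrr expr0n.
  rewrite (le_lt_trans s0 sx)/= subr0.
  by case: (x <= t); rewrite ?expr1n ?expr0n.
rewrite integral_indic// setIT; apply: (etrans (lebesgue_measure_itv _)); rewrite /=.
rewrite lte_fin; case: ltP => [_|ts]; first by rewrite EFinB.
by congr (_%:E); lra.
Qed.

Lemma step_fun_isometry s : subdivided01 s ->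
  (\int[lebesgue_measure]_x ((step_fun s x : R) ^+ 2)%:E = (step_form s)%:E)%E.
Proof.
move=> s01; pose V (t x : R) : R := \1_(`]0, t]) x.
have mV t : measurable_fun setT (V t).
  by apply: measurable_indic; exact: measurable_itv.
rewrite -(@step_isometry _ (measurableTypeR R) lebesgue_measure V mV).
- apply: eq_integral => x _; congr ((_ ^+ 2)%:E).
  rewrite /step_fun; apply: eq_big_seq => q qs; congr (_ * _).
  have /and3P[q0 q12 q1] := allP s01 _ qs.
  rewrite /V !indic_oc.
  have [xs|sx] := leP x q.1.1; rewrite /= ?(le_trans xs q12) ?andbT ?andbF ?subrr//.
  by rewrite (le_lt_trans q0 sx)/= subr0.
- by move=> u t u1 t1; exact: lebesgue_indicator_increment.
- exact: subdivided01_within01.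
Qed.

Lemma measurable_step_fun s : measurable_fun setT (step_fun s : R -> R).
Proof.
rewrite /step_fun; apply: measurable_sum => q; exact: measurable_funM.
Qed.

Lemma poweR2 (x : \bar R) : (0 <= x -> x `^ 2 = x ^+ 2)%E.
Proof.
case: x => [x|_|//]; last by rewrite poweRyr// expe2 mulyy.
by rewrite lee_fin => x0; rewrite poweR_EFin -EFin_expe powR_mulrn.
Qed.

Lemma Lnorm2_sqr d (T : measurableType d) (m : {measure set T -> \bar R})
    (f : T -> R) :
  (Lnorm m 2%:E (EFin \o f) ^+ 2 = \int[m]_x ((f x) ^+ 2)%:E)%E.
Proof.
rewrite -poweR2 ?Lnorm_ge0// powR_Lnorm//.
apply: eq_integral => x _; rewrite poweR2//; congr (_%:E).
by rewrite -(real_normK (num_real (f x))) expr2.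
Qed.

Lemma L2norm_sqr (f : R -> R) :
  (L2norm f ^+ 2 = \int[lebesgue_measure]_(x in `[0%R, 1%R]) ((f x) ^+ 2)%:E)%E.
Proof.
rewrite /L2norm Lnorm2_sqr [RHS]integral_mkcond; apply: eq_integral => x _.
by rewrite !patchE; case: ifP => //; rewrite expr0n.
Qed.

End isometry.

Section brownian_isometry.
Context {R : realType} {d : measure_display} {T : measurableType d}.
Variables (P : probability T R) (W : R -> {RV P >-> R}).
Hypothesis bmW : brownian_motion W.

Lemma brownian_increment_sqr s t : s \in `[0, 1] -> t \in `[0, 1] ->
  (\int[P]_w ((W t w - W s w) ^+ 2)%:E = `|t - s|%:E)%E.
Proof.
wlog st : s t / s <= t.
  move=> h s1 t1; have [st|/ltW ts] := leP s t; first exact: h.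
  rewrite distrC -h//; apply: eq_integral => x _; congr (_%:E); ring.
rewrite !in_itv/= => /andP[s0 s1] /andP[t0 t1].
rewrite ger0_norm ?subr_ge0//.
move: st; rewrite le_eqVlt => /predU1P[->|st].
  by under eq_integral do rewrite subrr expr0n; rewrite integral0 subrr.
case: bmW => _ _ gW _.
have sd : 0 < Num.sqrt (t - s) by rewrite sqrtr_gt0 subr_gt0.
have msq : measurable_fun setT (fun x : R => (x ^+ 2)%:E).
  by apply/measurable_EFinP; exact: measurable_funX.
have mD : measurable_fun setT (W t \- W s) by exact: measurable_funB.
transitivity (\int[pushforward P ((W t \- W s)%R : _ -> measurableTypeR R)]_x
    (x ^+ 2)%:E)%E.
  rewrite ge0_integral_pushforward//.
  by move=> y _; rewrite lee_fin sqr_ge0.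
rewrite -[in RHS](sqr_sqrtr (_ : 0 <= t - s)) ?subr_ge0 ?(ltW st)//.
rewrite -(normal_second_moment sd).
apply: eq_measure_integral.
by move=> A mA _; exact: gW.
Qed.

Lemma step_integral_isometry s : within01 s ->
  (\int[P]_w ((step_integral W s w) ^+ 2)%:E = (step_form s)%:E)%E.
Proof.
apply: (@step_isometry _ _ _ P (fun t => W t : T -> R)) => //.
exact: brownian_increment_sqr.
Qed.

Lemma measurable_step_integral s : measurable_fun setT (step_integral W s).
Proof.
rewrite /step_integral; apply: measurable_sum => q; apply: measurable_funM => //.
exact: measurable_funB.
Qed.

End brownian_isometry.

(** * Riemann sums *)

Section riemann.
Context {R : realType}.
Notation mu := (@lebesgue_measure R).

Lemma uniformly_continuous01 (f : R -> R) (e : R) :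
  {within `[0, 1], continuous f} -> 0 < e ->
  exists N, forall k, (N <= k)%N -> forall x y, x \in `[0, 1] -> y \in `[0, 1] ->
    `|x - y| <= k.+1%:R^-1 -> `|f x - f y| <= e.
Proof.
move=> cf e0; have e2 : 0 < e / 2 by rewrite divr_gt0.
pose Q (k : nat) (x : R) := x \in `[0, 1] -> forall y, y \in `[0, 1] ->
  `|x - y| <= k.+1%:R^-1 -> `|f x - f y| <= e.
have /compact_near_coveringP/(_ _ (\oo : set_system nat) Q) := @segment_compact R 0 1.
have F : Filter (\oo : set_system nat) by exact: _.
case.
- move=> x /= x01.
  have /cvgrPdist_lt/(_ _ e2) : f @ within `[0, 1]%classic (nbhs x) --> f x.
    by have /subspace_continuousP := cf; apply.
  rewrite /= nearE /within/= => -[r /= r0 hr].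
  have r2 : 0 < r / 2 by rewrite divr_gt0.
  have [k0 _ hk0] := near_infty_natSinv_lt (PosNum r2).
  near=> x' k => /= x'01 y y01 x'y.
  have xx' : `|x - x'| < r / 2 by near: x'; exact: (nbhsx_ballx x (PosNum r2)%:num).
  have kr : k.+1%:R^-1 < r / 2 by apply: hk0; near: k; exact: nbhs_infty_ge.
  have xy : `|x - y| < r.
    have -> : x - y = (x - x') + (x' - y) by ring.
    rewrite [r]splitr (le_lt_trans (ler_normD _ _))// ltrD//.
    exact: le_lt_trans kr.
  have h1 : `|f x - f x'| < e / 2.
    by apply: hr => //=; rewrite /ball/= (lt_trans xx')//; lra.
  have h2 : `|f x - f y| < e / 2 by exact: hr.
  have -> : f x' - f y = (f x - f y) - (f x - f x') by ring.
  by rewrite [e]splitr (le_trans (ler_normB _ _))// lerD// ltW.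
- move=> N _ h; exists N => k Nk x y x01 y01 xy.
  exact: (h k Nk x).
Unshelve. all: by end_near.
Qed.

Lemma itv01_ratio (N j : nat) : (0 < N)%N -> (j <= N)%N -> (j%:R / N%:R : R) \in `[0, 1].
Proof.
move=> N0 jN; rewrite in_itv/= divr_ge0//= ler_pdivrMr ?ltr0n// mul1r ler_nat.
exact: jN.
Qed.

(** Summed over the cells of the grid: on each of them the function stays
    within e of its value at the right end. *)
Lemma riemann_sum_bound (f : R -> R) (e : R) (N : nat) :
  {within `[0, 1], continuous f} -> (0 < N)%N -> 0 <= e ->
  (forall x y, x \in `[0, 1] -> y \in `[0, 1] ->
    `|x - y| <= N%:R^-1 -> `|f x - f y| <= e) ->
  forall K, (K <= N)%N ->
  `| (\int[mu]_(s in `[0%R, (K%:R / N%:R)%R]) f s)%R -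
     \sum_(0 <= k < K) N%:R^-1 * f (k.+1%:R / N%:R) | <= e * K%:R / N%:R.
Proof.
move=> cf N0 e0 hf; have N0' : 0 < N%:R :> R by rewrite ltr0n.
have intf a b : 0 <= a -> b <= 1 -> mu.-integrable `[a, b] (EFin \o f).
  move=> a0 b1; apply: continuous_compact_integrable.
    exact: segment_compact.
  apply: continuous_subspaceW cf => x /=; rewrite !in_itv/= => /andP[ax xb].
  by rewrite (le_trans a0 ax) (le_trans xb b1).
elim=> [_|K IH KN].
  rewrite mul0r set_itv1 Rintegral_set1 big_geq// subrr normr0.
  by rewrite mulr0 mul0r.
pose t : R := K%:R / N%:R; set t' : R := K.+1%:R / N%:R.
have /andP[t0 t1] : 0 <= t <= 1 by have := itv01_ratio N0 (ltnW KN); rewrite in_itv.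
have /andP[t'0 t'1] : 0 <= t' <= 1 by have := itv01_ratio N0 KN; rewrite in_itv.
have t't : t' = t + N%:R^-1 by rewrite /t' /t -natr1 mulrDl mul1r.
have tt' : t <= t' by rewrite t't lerDl invr_ge0 ltW.
have E : (\int[mu]_(s in `[0%R, t']) f s)%R =
    (\int[mu]_(s in `[0%R, t]) f s)%R + (\int[mu]_(s in `]t, t']) f s)%R.
  have := @Rintegral_itvB R f (BLeft 0) (BRight t') t (intf _ _ (lexx 0) t'1).
  by rewrite !bnd_simp => /(_ t0 tt') <-; rewrite addrC subrK.
have i1 : mu.-integrable `]t, t'] (EFin \o f).
  apply: integrableS (intf t t' t0 t'1) => //.
  by apply: subset_itvr; rewrite bnd_simp.
have mt : (fine (mu `]t, t']) = N%:R^-1)%R.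
  rewrite lebesgue_measure_itv/= lte_fin t't ltrDl invr_gt0 N0' -EFinB/=; ring.
have h : `| (\int[mu]_(s in `]t, t']) f s)%R - N%:R^-1 * f t' | <= e / N%:R.
  have -> : N%:R^-1 * f t' = (\int[mu]_(s in `]t, t']) (cst (f t') s))%R.
    rewrite Rintegral_cst//; first by rewrite mulrC [in RHS]mt.
  have i2 : mu.-integrable `]t, t'] (EFin \o cst (f t')).
    apply: integrableS (_ : mu.-integrable `[t, t'] _) => //.
      by apply: subset_itvr; rewrite bnd_simp.
    apply: continuous_compact_integrable; first exact: segment_compact.
    by apply: continuous_subspaceT => x; exact: cvg_cst.
  have i3 : mu.-integrable `]t, t'] (EFin \o (fun s => f s - cst (f t') s)).
    have := integrableB _ i1 i2 => /(_ (measurable_itv _)).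
    by apply: eq_integrable => //= s _; rewrite EFinB.
  rewrite -RintegralB//.
  apply: (le_trans (le_normr_Rintegral _ i3)) => //.
  have -> : e / N%:R = (\int[mu]_(s in `]t, t']) (cst e s))%R.
    by rewrite Rintegral_cst// [in RHS]mt.
  apply: le_Rintegral => //.
  - exact: (integrable_norm i3).
  - apply: integrableS (_ : mu.-integrable `[t, t'] _) => //.
      by apply: subset_itvr; rewrite bnd_simp.
    apply: continuous_compact_integrable; first exact: segment_compact.
    by apply: continuous_subspaceT => x; exact: cvg_cst.
  - move=> s /=; rewrite in_itv/= => /andP[ts st'].
    apply: hf; rewrite ?in_itv/=.
    + by rewrite (le_trans st' t'1) andbT (le_trans t0)// ltW.
    + by rewrite t'0 t'1.
    + rewrite distrC ger0_norm ?subr_ge0// t't; move: ts st'; rewrite t't; lra.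
rewrite big_nat_recr//= E.
have -> : forall a b c dd : R, a + b - (c + dd) = (a - c) + (b - dd).
  by move=> *; ring.
apply: (le_trans (ler_normD _ _)).
apply: (le_trans (lerD (IH (ltnW KN)) h)).
by rewrite -natr1 mulrDr mulr1 mulrDl.
Qed.

End riemann.

(** * Wiener integrals against step functions *)

(** The weight c is free so that a perturbation of small L2 norm costs little;
    this is used to prove that balls for a seminorm are open. *)
Lemma integral_sqrD_young (R : realType) d (T : measurableType d) (m : {measure set T -> \bar R})
    (D : set T) (u v : T -> R) (c : R) : 0 < c -> measurable D ->
  measurable_fun D u -> measurable_fun D v ->
  (\int[m]_(x in D) ((u x + v x) ^+ 2)%:E <=
   (1 + c)%:E * \int[m]_(x in D) ((u x) ^+ 2)%:E +
   (1 + c^-1)%:E * \int[m]_(x in D) ((v x) ^+ 2)%:E)%E.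
Proof.
move=> c0 mD mu' mv.
have sq (f : T -> R) : measurable_fun D f -> measurable_fun D (fun x => ((f x) ^+ 2)%:E).
  by move=> mf; apply/measurable_EFinP; exact: measurable_funX.
have sq0 (f : T -> R) x : (0 <= ((f x) ^+ 2)%:E)%E by rewrite lee_fin sqr_ge0.
have a0 : 0 <= 1 + c by rewrite addr_ge0// ltW.
have b0 : 0 <= 1 + c^-1 by rewrite addr_ge0// invr_ge0 ltW.
have msq (a : R) (f : T -> R) : measurable_fun D f ->
    measurable_fun D (fun x => a%:E * ((f x) ^+ 2)%:E)%E.
  by move=> mf; apply: emeasurable_funM => //; exact: sq.
have msq0 (a : R) (f : T -> R) x : 0 <= a -> (0 <= a%:E * ((f x) ^+ 2)%:E)%E.
  by move=> ?; rewrite mule_ge0.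
rewrite -!ge0_integralZl//; [|exact: sq|exact: sq].
rewrite -ge0_integralD//; [|by move=> x _; exact: msq0|exact: msq|by move=> x _; exact: msq0|exact: msq].
apply: ge0_le_integral => //.
- by move=> x _; rewrite lee_fin sqr_ge0.
- by apply: sq; exact: measurable_funD.
- by apply: emeasurable_funD; exact: msq.
move=> x _; rewrite -!EFinM -EFinD lee_fin.
have -> : (1 + c) * u x ^+ 2 + (1 + c^-1) * v x ^+ 2 =
    (u x + v x) ^+ 2 + c^-1 * (c * u x - v x) ^+ 2 by field; rewrite gt_eqF.
by rewrite lerDl mulr_ge0 ?sqr_ge0// invr_ge0 ltW.
Qed.

Section square_integrals.
Local Open Scope ereal_scope.
Context {R : realType} d (T : measurableType d) (m : {measure set T -> \bar R}).

Lemma integral_sqrD_le (D : set T) (u v : T -> R) : measurable D ->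
  measurable_fun D u -> measurable_fun D v ->
  \int[m]_(x in D) ((u x + v x) ^+ 2)%:E <=
  2%:E * \int[m]_(x in D) ((u x) ^+ 2)%:E + 2%:E * \int[m]_(x in D) ((v x) ^+ 2)%:E.
Proof.
move=> mD mu mv; have := integral_sqrD_young m ltr01 mD mu mv.
by rewrite invr1 (_ : 1 + 1 = 2)%R.
Qed.

End square_integrals.

Section wiener_approximation.
Context {R : realType} {d : measure_display} {T : measurableType d}.
Variables (P : probability T R) (W : R -> {RV P >-> R}).
Hypothesis bmW : brownian_motion W.
Notation mu := (@lebesgue_measure R).

Let negate (s : seq (R * R * R)) := [seq (q.1, - q.2) | q <- s].

Let step_integralB s g w :
  step_integral W (s ++ negate g) w = step_integral W s w - step_integral W g w.
Proof.
rewrite /step_integral big_cat big_map/= -sumrN; congr (_ + _).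
by apply: eq_bigr => q _; rewrite mulNr.
Qed.

Let step_funB s g (x : R) :
  step_fun (s ++ negate g) x = step_fun s x - step_fun g x.
Proof.
rewrite /step_fun big_cat big_map/= -sumrN; congr (_ + _).
by apply: eq_bigr => q _; rewrite mulNr.
Qed.

Let subdivided01B (s g : seq (R * R * R)) :
  subdivided01 s -> subdivided01 g -> subdivided01 (s ++ negate g).
Proof.
move=> hs hg; rewrite /subdivided01 all_cat; apply/andP; split=> //.
by rewrite all_map.
Qed.

Let step_fun_out s (x : R) : subdivided01 s -> x \notin `[0, 1] -> step_fun s x = 0.
Proof.
move=> /allP s01 x01; rewrite /step_fun big_seq big1// => q /s01/and3P[q0 q12 q1].
rewrite indic_oc; have [/andP[qx xq]|_] := boolP (q.1.1 < x <= q.1.2); last exact: mulr0.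
by move: x01; rewrite in_itv/= (le_trans q0 (ltW qx)) (le_trans xq q1).
Qed.

(** The constant 4 comes from using (u + v)^2 <= 2 u^2 + 2 v^2 twice, on each
    side of the isometry; it leaves the defining sequence of step functions
    arbitrary. *)
Lemma wiener_integral_approx (f : R -> R) (Z : {RV P >-> R}) g :
  is_wiener_integral W f Z -> measurable_fun setT f -> subdivided01 g ->
  (\int[P]_w ((Z w - step_integral W g w) ^+ 2)%:E <=
   4%:E * \int[mu]_(x in `[0%R, 1%R]) ((f x - step_fun g x) ^+ 2)%:E)%E.
Proof.
move=> [s [s01 sf sZ]] mf g01.
apply/lee_addgt0Pr => e e0.
have e6 : 0 < e / 6 by rewrite divr_gt0.
pose r := Num.sqrt (e / 6).
have r0 : 0 < r by rewrite sqrtr_gt0.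
have [N1 h1] := cvg0e_lt sf r0.
have [N2 h2] := cvg0e_lt sZ r0.
pose k := maxn N1 N2.
have sqr_lt (x : \bar R) : (0 <= x -> x < r%:E -> x ^+ 2 <= (e / 6)%:E)%E.
  case: x => [x| |//].
    rewrite lee_fin lte_fin => x0 xr; rewrite -EFin_expe lee_fin.
    have -> : e / 6 = r ^+ 2 by rewrite sqr_sqrtr// ltW.
    by rewrite ler_sqr ?nnegrE ?(ltW xr)// ltW.
  by move=> _; rewrite ltNge leey.
have h3 : (\int[mu]_(x in `[0%R, 1%R]) ((step_fun (s k) x - f x) ^+ 2)%:E <= (e / 6)%:E)%E.
  rewrite -(L2norm_sqr (step_fun (s k) \- f)); apply: sqr_lt; first exact: Lnorm_ge0.
  by apply: h1; exact: leq_maxl.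
have h4 : (\int[P]_w ((step_integral W (s k) w - Z w) ^+ 2)%:E <= (e / 6)%:E)%E.
  rewrite -(Lnorm2_sqr P (fun w => step_integral W (s k) w - Z w)).
  apply: sqr_lt; first exact: Lnorm_ge0.
  by apply: h2; exact: leq_maxr.
have msk := measurable_step_integral W (s k).
have mg := measurable_step_integral W g.
have mfk := measurable_step_fun (s k).
have mfg := measurable_step_fun g.
have h5 : (\int[P]_w ((Z w - step_integral W g w) ^+ 2)%:E <=
  2%:E * \int[P]_w ((step_integral W (s k) w - Z w) ^+ 2)%:E +
  2%:E * \int[P]_w ((step_integral W (s k) w - step_integral W g w) ^+ 2)%:E)%E.
  have -> : (\int[P]_w ((step_integral W (s k) w - Z w) ^+ 2)%:E =
    \int[P]_w ((Z w - step_integral W (s k) w) ^+ 2)%:E)%E.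
    by apply: eq_integral => w _; congr (_%:E); ring.
  have -> : (\int[P]_w ((Z w - step_integral W g w) ^+ 2)%:E =
    \int[P]_w (((Z w - step_integral W (s k) w) +
     (step_integral W (s k) w - step_integral W g w)) ^+ 2)%:E)%E.
    by apply: eq_integral => w _; congr (_%:E); ring.
  by apply: integral_sqrD_le => //; exact: measurable_funB.
have h6 : (\int[P]_w ((step_integral W (s k) w - step_integral W g w) ^+ 2)%:E =
  \int[mu]_(x in `[0%R, 1%R]) ((step_fun (s k) x - step_fun g x) ^+ 2)%:E)%E.
  have sg01 := subdivided01B (s01 k) g01.
  transitivity (\int[P]_w ((step_integral W (s k ++ negate g) w) ^+ 2)%:E)%E.
    by apply: eq_integral => w _; rewrite step_integralB.
  rewrite (step_integral_isometry bmW); last exact: subdivided01_within01.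
  rewrite -step_fun_isometry// [RHS]integral_mkcond; apply: eq_integral => x _.
  rewrite patchE; case: ifPn => [_|]; first by rewrite step_funB.
  rewrite notin_setE/= => /negP x01.
  by rewrite (step_fun_out sg01)// expr0n.
have h7 : (\int[mu]_(x in `[0%R, 1%R]) ((step_fun (s k) x - step_fun g x) ^+ 2)%:E <=
  2%:E * \int[mu]_(x in `[0%R, 1%R]) ((step_fun (s k) x - f x) ^+ 2)%:E +
  2%:E * \int[mu]_(x in `[0%R, 1%R]) ((f x - step_fun g x) ^+ 2)%:E)%E.
  have -> : (\int[mu]_(x in `[0%R, 1%R]) ((step_fun (s k) x - step_fun g x) ^+ 2)%:E =
   \int[mu]_(x in `[0%R, 1%R]) (((step_fun (s k) x - f x) + (f x - step_fun g x)) ^+ 2)%:E)%E.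
    by apply: eq_integral => w _; congr (_%:E); ring.
  apply: integral_sqrD_le => //; apply: measurable_funTS; exact: measurable_funB.
set A := (\int[mu]_(x in _) ((f x - _) ^+ 2)%:E)%E in h7 *.
have A0 : (0 <= A)%E by apply: integral_ge0 => x _; rewrite lee_fin sqr_ge0.
apply: (le_trans h5); rewrite h6.
set B := (\int[P]_w _)%E in h4 *.
set B' := (\int[mu]_(x in _) ((_ - step_fun g _) ^+ 2)%:E)%E in h7 *.
have h8 : (B' <= 2%:E * (e / 6)%:E + 2%:E * A)%E.
  apply: (le_trans h7); apply: leeD => //.
  by apply: lee_wpmul2l.
apply: (@le_trans _ _ (2%:E * (e / 6)%:E + 2%:E * (2%:E * (e / 6)%:E + 2%:E * A))%E).
  by apply: leeD; apply: lee_wpmul2l.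
case: A A0 {h7 h8} => [a|_|//]; last by rewrite !gt0_muley// !addye ?leey.
rewrite lee_fin => a0; rewrite -?(EFinM, EFinD) lee_fin.
by lra.
Qed.

End wiener_approximation.

(** * The signal on a grid *)

Section grid.
Context {R : realType}.
Notation mu := (@lebesgue_measure R).

Definition grid_steps (sigma : R -> R) (N k : nat) : seq (R * R * R) :=
  [seq ((j%:R / N%:R, j.+1%:R / N%:R), sigma (j%:R / N%:R)) | j <- iota 0 k].

Lemma subdivided01_grid sigma N k : (0 < N)%N -> (k <= N)%N ->
  subdivided01 (grid_steps sigma N k).
Proof.
move=> N0 kN; apply/allP => q /mapP[j]; rewrite mem_iota add0n /= => jk ->/=.
have N0' : 0 < N%:R :> R by rewrite ltr0n.
rewrite divr_ge0//= ler_pM2r ?invr_gt0// ler_nat leqnSn/=.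
by rewrite ler_pdivrMr// mul1r ler_nat (leq_trans jk).
Qed.

Lemma step_fun_grid sigma N k (x : R) j : (0 < N)%N ->
  j%:R / N%:R < x <= j.+1%:R / N%:R ->
  step_fun (grid_steps sigma N k) x = if (j < k)%N then sigma (j%:R / N%:R) else 0.
Proof.
move=> N0 /andP[jx xj].
have N0' : 0 < N%:R :> R by rewrite ltr0n.
have E i : (i%:R / N%:R < x <= i.+1%:R / N%:R) = (i == j).
  apply/idP/eqP => [/andP[ix xi]|->]; last by rewrite jx xj.
  have h1 := lt_le_trans ix xj; have h2 := lt_le_trans jx xi.
  move: h1 h2; rewrite !ltr_pM2r ?invr_gt0// !ltr_nat !ltnS => h1 h2.
  by apply/eqP; rewrite eqn_leq h1 h2.
rewrite /step_fun big_map -{1}(subn0 k) -/(index_iota 0 k).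
under eq_bigr do rewrite indic_oc /= E.
case: ifP => jk.
  rewrite big_mkord (bigD1 (Ordinal jk))//= eqxx mulr1 big1 ?addr0// => i ij.
  by rewrite (_ : (i == j :> nat) = false) ?mulr0//; apply: contra_neqF ij => /eqP ?; apply/val_inj.
rewrite big_nat big1// => i /andP[_ ik].
rewrite (_ : i == j = false) ?mulr0//; apply/eqP => ij.
by rewrite -ij ik in jk.
Qed.

Lemma grid_cell (N : nat) (x : R) : (0 < N)%N -> 0 < x ->
  exists j : nat, j%:R / N%:R < x <= j.+1%:R / N%:R.
Proof.
move=> N0 x0; have N0' : 0 < N%:R :> R by rewrite ltr0n.
have xN : 0 <= x * N%:R by rewrite mulr_ge0// ltW.
have /andP[h1 h2] := truncn_itv xN.
set m := Num.truncn _ in h1 h2.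
have [E|ne] := eqVneq (m%:R : R) (x * N%:R).
  case: m E h1 h2 => [E|m E _ _].
    by move: (mulr_gt0 x0 N0'); rewrite -E ltxx.
  exists m; rewrite ltr_pdivrMr// ler_pdivlMr// -E ltr_nat ltnSn.
  exact: lexx.
by exists m; rewrite ltr_pdivrMr// ler_pdivlMr// (ltW h2) andbT lt_neqAle ne.
Qed.

(** The endpoint 0 belongs to no half-open cell, hence the passage to ]0, 1].
    *)
Lemma grid_steps_L2 (sigma : R -> R) N k (c : R) : (0 < N)%N -> (k <= N)%N -> 0 <= c ->
  (forall x y, x \in `[0, 1] -> y \in `[0, 1] ->
    `|sigma x - sigma y| <= c * `|x - y|) ->
  measurable_fun setT sigma ->
  (\int[mu]_(x in `[0%R, 1%R])
     (((sigma \_ `[0%R, (k%:R / N%:R)%R]) x - step_fun (grid_steps sigma N k) x) ^+ 2)%:E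
   <= ((c / N%:R) ^+ 2)%:E)%E.
Proof.
move=> N0 kN c0 sl ms; have N0' : 0 < N%:R :> R by rewrite ltr0n.
have mres : measurable_fun setT (sigma \_ `[0%R, (k%:R / N%:R)%R]).
  apply/(measurable_restrictT _ _).1 => //; exact: measurable_funTS.
have mF : measurable_fun setT (fun x : R =>
   (((sigma \_ `[0%R, (k%:R / N%:R)%R]) x - step_fun (grid_steps sigma N k) x) ^+ 2)%:E).
  apply/measurable_EFinP; apply: measurable_funX; apply: measurable_funB => //.
  exact: measurable_step_fun.
rewrite -integral_itv_obnd_cbnd; last exact: measurable_funTS mF.
apply: (@le_trans _ _ (\int[mu]_(x in `]0%R, 1%R]) (cst ((c / N%:R) ^+ 2)%:E x))%E).
  apply: ge0_le_integral => //.
  - by move=> x _; rewrite lee_fin sqr_ge0.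
  - exact: measurable_funTS mF.
  - move=> x /=; rewrite in_itv/= => /andP[x0 x1].
    rewrite lee_fin -[leLHS]real_normK ?num_real// ler_sqr ?nnegrE//; last first.
      by rewrite divr_ge0.
    have [j /andP[jx xj]] := grid_cell N0 x0.
    rewrite (step_fun_grid _ _ N0 (introT andP (conj jx xj))).
    rewrite patchE; case: ifPn.
      rewrite inE/= in_itv/= => /andP[_ xk].
      have jk : (j < k)%N.
        by have := lt_le_trans jx xk; rewrite ltr_pM2r ?invr_gt0// ltr_nat.
      rewrite jk; apply: (le_trans (sl _ _ _ _)).
      + by rewrite in_itv/= x1 ltW.
      + by apply: itv01_ratio => //; exact: leq_trans (ltnW jk) kN.
      + apply: ler_wpM2l => //; rewrite gtr0_norm ?subr_gt0//.
        move: xj; rewrite -natr1 mulrDl mul1r; lra.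
    rewrite notin_setE/= in_itv/= (ltW x0)/= => /negP; rewrite -ltNge => kx.
    have kj : (k <= j)%N.
      by have := lt_le_trans kx xj; rewrite ltr_pM2r ?invr_gt0// ltr_nat ltnS.
    rewrite ltnNge kj/= (_ : point = 0)// subrr normr0.
    exact: divr_ge0.
rewrite integral_cst//=; set I := mu _.
have -> : I = 1%E by rewrite /I lebesgue_measure_itv/= lte01 oppr0 adde0.
by rewrite mule1.
Qed.

(** A discrete time integral of the partial sums of a is a weighted sum of a.
    *)
Lemma riemann_double_sum (N K : nat) (a : nat -> R) :
  \sum_(0 <= k < K) N%:R^-1 * \sum_(0 <= j < k.+1) a j =
  \sum_(0 <= j < K) (K - j)%N%:R / N%:R * a j.
Proof.
elim: K => [|K IH]; first by rewrite !big_geq.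
rewrite big_nat_recr//= IH [RHS]big_nat_recr//= subSnn big_nat_recr//= mulrDr mul1r.
rewrite addrA; congr (_ + _).
rewrite mulr_sumr -big_split/=; apply: eq_big_nat => j /andP[_ jK].
by rewrite subSn ?(ltnW jK)// -natr1; ring.
Qed.

End grid.

Section discretisation.
Context {R : realType} {d : measure_display} {T : measurableType d}.
Variables (P : probability T R) (W : R -> {RV P >-> R}).
Hypothesis bmW : brownian_motion W.
Variables (sigma : R -> R) (X : R -> {RV P >-> R}).
Hypothesis procX : is_integral_process W sigma X.
Variable c : R.
Hypotheses (c_ge0 : 0 <= c) (sigma_lip : forall x y, x \in `[0, 1] -> y \in `[0, 1] ->
    `|sigma x - sigma y| <= c * `|x - y|).
Hypothesis sigma_meas : measurable_fun setT sigma.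

Definition grid_increment (N j : nat) (w : T) : R :=
  W (j.+1%:R / N%:R) w - W (j%:R / N%:R) w.

Lemma measurable_grid_increment N j : measurable_fun setT (grid_increment N j).
Proof. exact: measurable_funB. Qed.

Lemma step_integral_grid N k w :
  step_integral W (grid_steps sigma N k) w =
  \sum_(0 <= j < k) sigma (j%:R / N%:R) * grid_increment N j w.
Proof. by rewrite /step_integral big_map -{1}(subn0 k). Qed.

Lemma process_grid_L2 N k : (0 < N)%N -> (k <= N)%N ->
  (\int[P]_w ((X (k%:R / N%:R) w -
      \sum_(0 <= j < k) sigma (j%:R / N%:R) * grid_increment N j w) ^+ 2)%:E <=
   ((2 * c / N%:R) ^+ 2)%:E)%E.
Proof.
move=> N0 kN.
have wX := procX.1 _ (itv01_ratio N0 kN).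
have mres : measurable_fun setT (sigma \_ `[0%R, (k%:R / N%:R)%R]).
  apply/(measurable_restrictT _ _).1 => //; exact: measurable_funTS.
have := wiener_integral_approx bmW wX mres (subdivided01_grid sigma N0 kN).
under eq_integral do rewrite step_integral_grid.
move=> /le_trans; apply.
have := grid_steps_L2 N0 kN c_ge0 sigma_lip sigma_meas.
move=> /(lee_wpmul2l (_ : 0 <= 4%:E)%E) => /(_ _)/le_trans; apply => //.
rewrite -EFinM lee_fin le_eqVlt; apply/orP; left; apply/eqP.
by field; rewrite pnatr_eq0 -lt0n.
Qed.

(** The first absolute moment is bounded through |v| <= (a + v^2 / a) / 2. *)
Lemma integral_norm_le (v : T -> R) (a : R) : 0 < a -> measurable_fun setT v ->
  (\int[P]_w ((v w) ^+ 2)%:E <= (a ^+ 2)%:E)%E -> (\int[P]_w `|v w|%:E <= a%:E)%E.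
Proof.
move=> a0 mv h.
have mv2 : measurable_fun setT (fun w => ((v w) ^+ 2)%:E).
  by apply/measurable_EFinP; exact: measurable_funX.
have a2 : 0 <= a / 2 by rewrite divr_ge0// ltW.
have ia : 0 <= (2 * a)^-1 by rewrite invr_ge0 mulr_ge0// ltW.
apply: (@le_trans _ _ (\int[P]_w ((a / 2)%:E + ((2 * a)^-1)%:E * ((v w) ^+ 2)%:E))%E).
  apply: ge0_le_integral => //.
  - by apply/measurable_EFinP; exact: measurableT_comp.
  - by apply: emeasurable_funD => //; exact: emeasurable_funM.
  - move=> w _; rewrite -EFinM -EFinD lee_fin.
    rewrite -(real_normK (num_real (v w))).
    have -> : a / 2 + (2 * a)^-1 * `|v w| ^+ 2 =
        `|v w| + (`|v w| - a) ^+ 2 / (2 * a).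
      by field; rewrite gt_eqF.
    by rewrite lerDl divr_ge0 ?sqr_ge0// mulr_ge0// ltW.
rewrite ge0_integralD//.
- rewrite integral_probability_cst ge0_integralZl//.
  + apply: (@le_trans _ _ ((a / 2)%:E + ((2 * a)^-1)%:E * (a ^+ 2)%:E)%E).
      by apply: leeD2l; exact: lee_wpmul2l.
    rewrite -EFinM -EFinD lee_fin le_eqVlt; apply/orP; left; apply/eqP.
    by field; rewrite gt_eqF.
  + by move=> w _; rewrite lee_fin sqr_ge0.
- by move=> w _; rewrite -EFinM lee_fin mulr_ge0// sqr_ge0.
- exact: emeasurable_funM.
Qed.

(** Riemann sum of mesh 1/N for the integral of X over [0, K/N]. *)
Definition riemann_sum (N K : nat) (w : T) : R :=
  \sum_(0 <= k < K) N%:R^-1 * X (k.+1%:R / N%:R) w.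

(** The same sum when X is itself replaced by the discrete integral of sigma
    with respect to the grid increments. *)
Definition grid_signal (N K : nat) (w : T) : R :=
  \sum_(0 <= j < K) (K - j)%N%:R / N%:R *
     (sigma (j%:R / N%:R) * grid_increment N j w).

Lemma measurable_riemann_sum N K : measurable_fun setT (riemann_sum N K).
Proof. by apply: measurable_sum => k; exact: measurable_funM. Qed.

Lemma measurable_grid_signal N K : measurable_fun setT (grid_signal N K).
Proof.
apply: measurable_sum => k; apply: measurable_funM => //.
by apply: measurable_funM => //; exact: measurable_grid_increment.
Qed.

Lemma riemann_sum_grid_signal N K : (0 < N)%N -> (K <= N)%N ->
  (\int[P]_w `|riemann_sum N K w - grid_signal N K w|%:E <=
    (2 * (c + 1) / N%:R)%:E)%E.
Proof.
move=> N0 KN; have N0' : 0 < N%:R :> R by rewrite ltr0n.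
pose V k w := X (k.+1%:R / N%:R) w -
  \sum_(0 <= j < k.+1) sigma (j%:R / N%:R) * grid_increment N j w.
have mV k : measurable_fun setT (V k).
  apply: measurable_funB => //; apply: measurable_sum => j.
  by apply: measurable_funM => //; exact: measurable_grid_increment.
pose a := 2 * (c + 1) / N%:R.
have a0 : 0 < a by rewrite divr_gt0// mulr_gt0// ltr_wpDl.
have EV k : (k < K)%N -> (\int[P]_w `|V k w|%:E <= a%:E)%E.
  move=> kK; apply: integral_norm_le => //.
  apply: (le_trans (process_grid_L2 N0 (leq_trans kK KN))).
  rewrite lee_fin ler_sqr ?nnegrE; last 2 first.
  - by rewrite divr_ge0// mulr_ge0.
  - exact: ltW.
  by rewrite /a ler_pM2r ?invr_gt0// ler_pM2l// lerDl.
have mVn k : measurable_fun setT (fun w => `|V k w|%:E).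
  by apply/measurable_EFinP; apply: measurableT_comp.
apply: (@le_trans _ _ (\int[P]_w (\sum_(0 <= k < K) (N%:R^-1)%:E * `|V k w|%:E))%E).
  apply: ge0_le_integral => //.
  - apply/measurable_EFinP; apply: measurableT_comp => //; apply: measurable_funB.
      exact: measurable_riemann_sum.
    exact: measurable_grid_signal.
  - by apply: emeasurable_sum => k; exact: emeasurable_funM.
  - move=> w _; under eq_bigr do rewrite -EFinM; rewrite sumEFin lee_fin.
    rewrite /riemann_sum /grid_signal -riemann_double_sum -sumrB.
    apply: (le_trans (ler_norm_sum _ _ _)); apply: ler_sum => k _.
    by rewrite -mulrBr normrM ger0_norm// invr_ge0 ltW.
rewrite ge0_integral_sum//; last first.
  by move=> k; exact: emeasurable_funM.
apply: (@le_trans _ _ (\sum_(0 <= k < K) (N%:R^-1)%:E * a%:E)%E).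
  rewrite !big_nat; apply: lee_sum => k /andP[_ kK].
  rewrite ge0_integralZl//.
  by apply: lee_wpmul2l; [rewrite lee_fin invr_ge0 ltW|exact: EV].
under eq_bigr do rewrite -EFinM.
rewrite sumEFin lee_fin sumr_const_nat subn0 -[leRHS]mul1r -mulrnAl ler_pM2r//.
by rewrite -mulr_natl ler_pdivrMr// mul1r ler_nat.
Qed.

End discretisation.

(** * Convergence of the grid model *)

Section observation_limit.
Context {R : realType} {d : measure_display} {T : measurableType d}.
Variables (P : probability T R) (W : R -> {RV P >-> R}).
Hypothesis bmW : brownian_motion W.
Variables (sigma : R -> R) (X : R -> {RV P >-> R}).
Hypothesis procX : is_integral_process W sigma X.
Variable c : R.
Hypotheses (c_ge0 : 0 <= c) (sigma_lip : forall x y, x \in `[0, 1] -> y \in `[0, 1] ->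
    `|sigma x - sigma y| <= c * `|x - y|).
Hypothesis sigma_meas : measurable_fun setT sigma.
Variables (eps : forall n : nat, 'I_n -> {RV P >-> R}) (tau : R) (n : nat).
Hypothesis n_gt0 : (0 < n)%N.

Definition noisy (V : 'I_n -> T -> R) (w : T) : n.-tuple R :=
  [tuple V i w + tau * eps i w | i < n].

(** The mesh divides 1/n, so that the sampling times are on the grid. *)
Definition grid_observations (M : nat) : T -> n.-tuple R :=
  noisy (fun i => grid_signal W sigma (n * M) (M * i.+1)).

Let riemann_observations (M : nat) : T -> n.-tuple R :=
  noisy (fun i => riemann_sum X (n * M) (M * i.+1)).

Lemma measurable_noisy (V : 'I_n -> T -> R) :
  (forall i, measurable_fun setT (V i)) -> measurable_fun setT (noisy V).
Proof.
move=> mV; apply/measurable_fun_tnthP => i.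
rewrite (_ : _ \o _ = fun w => V i w + tau * eps i w); last first.
  by apply/funext => w /=; rewrite tnth_mktuple.
by apply: measurable_funD => //; exact: measurable_funM.
Qed.

Let signal (i : 'I_n) (w : T) : R :=
  (\int[lebesgue_measure]_(s in `[0%R, (i.+1%:R / n%:R)%R]) X s w)%R.

Let riemann_sum_cvg (i : 'I_n) w :
  riemann_sum X (n * M) (M * i.+1) w @[M --> \oo] --> signal i w.
Proof.
apply/cvgrPdist_le => e e0.
have [N0 h] := uniformly_continuous01 (procX.2 w) e0.
exists N0.+1 => // M /= NM.
have M0 : (0 < M)%N by exact: leq_trans NM.
have nM0 : (0 < n * M)%N by rewrite muln_gt0 n_gt0.
have KN : (M * i.+1 <= n * M)%N by rewrite mulnC leq_mul2r ltn_ord orbT.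
suff hf : forall x y : R, x \in `[0, 1] -> y \in `[0, 1] ->
    `|x - y| <= (n * M)%:R^-1 -> `|X x w - X y w| <= e.
  have := @riemann_sum_bound R (fun s => X s w) e (n * M) (procX.2 w) nM0 (ltW e0) hf _ KN.
  have E : ((M * i.+1)%:R / (n * M)%:R : R) = i.+1%:R / n%:R.
    by rewrite !natrM; field; rewrite !pnatr_eq0 -!lt0n n_gt0 M0.
  rewrite E => /le_trans; apply; rewrite -mulrA E; apply: ler_piMr; first exact: ltW.
  by rewrite ler_pdivrMr ?ltr0n// mul1r ler_nat ltn_ord.
move=> x y x01 y01 xy; apply: (h (n * M).-1 _ x y) => //.
  by rewrite -ltnS prednK// (leq_trans NM)// leq_pmull.
by rewrite prednK.
Qed.

Let measurable_signal i : measurable_fun setT (signal i).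
Proof.
apply/measurable_EFinP.
apply: (emeasurable_fun_cvg (fun M w => (riemann_sum X (n * M) (M * i.+1) w)%:E)).
- by move=> M; apply/measurable_EFinP; exact: measurable_riemann_sum.
- move=> w _; apply: cvg_EFin; first exact: nearW.
  exact: riemann_sum_cvg.
Qed.

Lemma measurable_observations :
  measurable_fun setT (observations tau X eps n).
Proof. exact: (measurable_noisy measurable_signal). Qed.

Lemma measurable_grid_observations M : measurable_fun setT (grid_observations M).
Proof. by apply: measurable_noisy => i; exact: measurable_grid_signal. Qed.

Let measurable_riemann_observations M : measurable_fun setT (riemann_observations M).
Proof. by apply: measurable_noisy => i; exact: measurable_riemann_sum. Qed.

Variable f : n.-tuple R -> R.
Hypothesis f_test : lipschitz_test f.

Let mf : measurable_fun setT f. Proof. by case: f_test. Qed.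
Let f01 y : 0 <= f y <= 1. Proof. by case: f_test => _ []. Qed.

Let test_cvg w : f (riemann_observations M w) @[M --> \oo] -->
  f (observations tau X eps n w).
Proof.
have [_ [_ [L L0 hL]]] := f_test.
apply/cvgrPdist_le => e e0.
pose r := e / (n%:R * (L + 1)).
have r0 : 0 < r by rewrite divr_gt0// mulr_gt0 ?ltr0n// ltr_wpDl.
have hi (i : 'I_n) : \forall M \near \oo,
   `|signal i w - riemann_sum X (n * M) (M * i.+1) w| <= r.
  by have /cvgrPdist_le/(_ _ r0) := @riemann_sum_cvg i w.
have : \forall M \near \oo, forall i : 'I_n,
   `|signal i w - riemann_sum X (n * M) (M * i.+1) w| <= r.
  exact: filter_forall.
apply: filterS => M hM.
apply: (le_trans (hL _ _)).
apply: (@le_trans _ _ (L * \sum_(i < n) r)).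
  apply: ler_wpM2l => //; apply: ler_sum => i _.
  rewrite !tnth_mktuple (_ : _ - _ = signal i w - riemann_sum X (n * M) (M * i.+1) w).
    exact: hM.
  by rewrite /signal; ring.
rewrite sumr_const card_ord -mulr_natl /r.
have -> : L * (n%:R * (e / (n%:R * (L + 1)))) = e * (L / (L + 1)).
  by field; rewrite pnatr_eq0 -lt0n n_gt0 gt_eqF// ltr_wpDl.
apply: ler_piMr; first exact: ltW.
by rewrite ler_pdivrMr ?ltr_wpDl// mul1r lerDl.
Qed.

Let E (Y : T -> n.-tuple R) : \bar R := (\int[P]_w (f (Y w))%:E)%E.

Let E_fin Y : measurable_fun setT Y -> exists2 p : R, 0 <= p <= 1 & E Y = p%:E.
Proof.
move=> mY.
have mfY : measurable_fun setT (fun w => (f (Y w))%:E).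
  by apply/measurable_EFinP; apply: (measurableT_comp mf).
have i0 : (0 <= E Y)%E.
  by apply: integral_ge0 => w _; rewrite lee_fin; case/andP: (f01 (Y w)).
have i1 : (E Y <= 1)%E.
  rewrite -[leRHS](integral_probability_cst P 1%E).
  apply: ge0_le_integral => // w _; rewrite lee_fin.
    by case/andP: (f01 (Y w)).
  by case/andP: (f01 (Y w)).
move: i0 i1; case: (E Y) => [p|//|//].
by rewrite !lee_fin => p0 p1; exists p => //; rewrite p0.
Qed.

(** The Riemann sums converge path by path, which gives the limit of the
    expectations by dominated convergence; their distance to the grid signal
    is small in mean. *)
Lemma test_discretisation (eta : R) : 0 < eta ->
  exists M0, forall M, (M0 <= M)%N ->
    (E (observations tau X eps n) <= E (grid_observations M) + eta%:E)%E /\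
    (E (grid_observations M) <= E (observations tau X eps n) + eta%:E)%E.
Proof.
move=> eta0; have e2 : 0 < eta / 2 by rewrite divr_gt0.
have [_ [_ [L L0 hL]]] := f_test.
have mfY (Y : T -> n.-tuple R) : measurable_fun setT Y ->
    measurable_fun setT (fun w => (f (Y w))%:E).
  by move=> mY; apply/measurable_EFinP; apply: (measurableT_comp mf).
have cvE : E (riemann_observations M) @[M --> \oo] --> E (observations tau X eps n).
  have [] := @dominated_convergence _ T R P setT measurableT
    (fun M w => (f (riemann_observations M w))%:E)
    (fun w => (f (observations tau X eps n w))%:E) (cst 1%E) => //.
  - by move=> M; exact: mfY.
  - by apply: mfY; exact: measurable_observations.
  - by apply: aeW => w _; apply: cvg_EFin; [exact: nearW|exact: test_cvg].
  - by apply: finite_measure_integrable_cst.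
  - apply: aeW => w M _; rewrite /= lee_fin ger0_norm; first by case/andP: (f01 (riemann_observations M w)).
    by case/andP: (f01 (riemann_observations M w)).
have [p p01 Ep] := E_fin measurable_observations.
have [N1 hN1] : exists N1, forall M, (N1 <= M)%N ->
   `|p - fine (E (riemann_observations M))| <= eta / 2.
  move: cvE; rewrite Ep => /fine_cvgP[_ /cvgrPdist_le/(_ _ e2)[N1 _ h]].
  by exists N1 => M /h.
have [N2 hN2] : exists N2, forall M, (N2 <= M)%N -> (0 < M)%N /\
    L * (2 * (c + 1)) / M%:R <= eta / 2.
  pose x := L * (2 * (c + 1)) / (eta / 2).
  exists (Num.truncn x).+1 => M hM.
  have M0 : (0 < M)%N by exact: leq_trans hM.
  have xM : x <= M%:R.
    by apply: (le_trans (ltW (truncnS_gt x))); rewrite ler_nat.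
  split=> //; rewrite ler_pdivrMr ?ltr0n// [leRHS]mulrC.
  by rewrite -ler_pdivrMr.
exists (maxn N1 N2) => M; rewrite geq_max => /andP[/hN1 h1 /hN2[M0 h2]].
have nM0 : (0 < n * M)%N by rewrite muln_gt0 n_gt0.
have [p1 p101 Ep1] := E_fin (@measurable_riemann_observations M).
have [p2 p201 Ep2] := E_fin (@measurable_grid_observations M).
pose Dif w := L * \sum_(i < n) `|riemann_sum X (n * M) (M * i.+1) w -
     grid_signal W sigma (n * M) (M * i.+1) w|.
have mdif i : measurable_fun setT (fun w => `|riemann_sum X (n * M) (M * i.+1) w -
     grid_signal W sigma (n * M) (M * i.+1) w|).
  apply: measurableT_comp => //; apply: measurable_funB.
    exact: measurable_riemann_sum.
  exact: measurable_grid_signal.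
have mDif : measurable_fun setT (fun w => (Dif w)%:E).
  apply/measurable_EFinP; apply: measurable_funM => //.
  by apply: measurable_sum => i; exact: mdif.
have Dif0 w : 0 <= Dif w by rewrite mulr_ge0// sumr_ge0.
have iD : (\int[P]_w (Dif w)%:E <= (eta / 2)%:E)%E.
  under eq_integral do rewrite /Dif EFinM -sumEFin.
  rewrite ge0_integralZl//; last 2 first.
  - by apply: emeasurable_sum => i; apply/measurable_EFinP; exact: mdif.
  - by move=> w _; apply: sume_ge0 => i _; rewrite lee_fin.
  rewrite ge0_integral_sum//; last first.
    by move=> i; apply/measurable_EFinP; exact: mdif.
  apply: (@le_trans _ _ (L%:E * (\sum_(i < n) (2 * (c + 1) / (n * M)%:R)%:E))%E).
    apply: lee_wpmul2l => //; apply: lee_sum => i _.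
    apply: (riemann_sum_grid_signal bmW procX c_ge0 sigma_lip sigma_meas) => //.
    by rewrite mulnC leq_mul2r ltn_ord orbT.
  rewrite sumEFin -EFinM lee_fin sumr_const card_ord.
  apply: le_trans h2; rewrite le_eqVlt; apply/orP; left; apply/eqP.
  rewrite -mulr_natl natrM; field.
  by rewrite !pnatr_eq0 -!lt0n n_gt0 M0.
have close Y Y' : measurable_fun setT Y -> measurable_fun setT Y' ->
    (forall w, f (Y w) <= f (Y' w) + Dif w) -> (E Y <= E Y' + (eta / 2)%:E)%E.
  move=> mY mY' h.
  have f0 (V : T -> n.-tuple R) w : (0 <= (f (V w))%:E)%E.
    by rewrite lee_fin; case/andP: (f01 (V w)).
  apply: (@le_trans _ _ (\int[P]_w ((f (Y' w))%:E + (Dif w)%:E))%E).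
    apply: ge0_le_integral => //; [exact: mfY| |].
      by apply: emeasurable_funD => //; exact: mfY.
    by move=> w _; rewrite -EFinD lee_fin.
  rewrite ge0_integralD//;
    [exact: leeD2l|exact: mfY|by move=> w _; rewrite lee_fin].
have RG w : `|f (riemann_observations M w) - f (grid_observations M w)| <= Dif w.
  apply: (le_trans (hL _ _)); rewrite /Dif le_eqVlt; apply/orP; left; apply/eqP.
  congr (_ * _); apply: eq_bigr => i _; congr (`|_|).
  by rewrite !tnth_mktuple; ring.
have := close _ _ (@measurable_riemann_observations M) (@measurable_grid_observations M).
have := close _ _ (@measurable_grid_observations M) (@measurable_riemann_observations M).
rewrite Ep Ep1 Ep2 -!EFinD !lee_fin => c1 c2.
have {}c1 : p2 <= p1 + eta / 2.
  by apply: c1 => w; move: (RG w); rewrite ler_norml => /andP[]; lra.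
have {}c2 : p1 <= p2 + eta / 2.
  by apply: c2 => w; move: (RG w); rewrite ler_norml => /andP[]; lra.
by move: h1; rewrite Ep1 /= ler_norml => /andP[]; split; lra.
Qed.

End observation_limit.

(** * Moment matching inside a block *)

Section block_algebra.
Context {R : realType} (k : nat).
Hypothesis k_gt0 : (0 < k)%N.

(** A half block starting at H consists of two quarters of length k, whose
    mean positions are H + (k - 1) / 2 and the same plus k. The weights u on
    the second quarter and 1/k - u on the first represent a unit mass at P +
    i: they have total mass 1, and mean P + i. *)
Definition moment_weight (H P : nat) (snd : bool) (i : nat) : R :=
  let u := ((P + i)%:R - H%:R - (k.-1)%:R / 2) / k%:R ^+ 2 in
  if snd then u else k%:R^-1 - u.

Let k0 : 0 < k%:R :> R. Proof. by rewrite ltr0n. Qed.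

Lemma sum_affine (A : R) (H : nat) :
  \sum_(0 <= i < k) (A - (H + i)%:R) = k%:R * (A - H%:R - (k.-1)%:R / 2).
Proof.
have E m : \sum_(0 <= i < m) (A - (H + i)%:R) =
    m%:R * (A - H%:R) - m%:R * (m%:R - 1) / 2.
  elim: m => [|m IH]; first by rewrite big_geq// !mul0r subrr.
  by rewrite big_nat_recr//= IH natrD -natr1; field.
have -> : (k.-1)%:R = k%:R - 1 :> R by rewrite -subn1 natrB.
by rewrite E; field.
Qed.

Lemma affine_moment_weight (A : R) (H P i : nat) :
  moment_weight H P false i * \sum_(0 <= i' < k) (A - (H + i')%:R) +
  moment_weight H P true i * \sum_(0 <= i' < k) (A - (H + k + i')%:R) =
  A - (P + i)%:R.
Proof.
rewrite !sum_affine /moment_weight natrD; field.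
by rewrite gt_eqF.
Qed.

Lemma big_nat_addn (F : nat -> R) (m p : nat) :
  \sum_(0 <= i < m + p) F i =
  \sum_(0 <= i < m) F i + \sum_(0 <= i < p) F (m + i)%N.
Proof.
rewrite (@big_cat_nat _ _ _ m 0 (m + p))//= ?leq_addr//; congr (_ + _).
rewrite -[X in \sum_(X <= _ < _) _]add0n big_addn addKn.
by apply: eq_bigr => i _; rewrite addnC.
Qed.

(** Against an affine function, a mass on the half block at P is equivalent to
    its image on the half block at H. *)
Lemma half_match (A : R) (H P : nat) (F : nat -> R) :
  \sum_(0 <= i < 2 * k)
    (\sum_(0 <= i' < 2 * k) moment_weight H P (k <= i)%N i' * F i') *
       (A - (H + i)%:R) =
  \sum_(0 <= i' < 2 * k) F i' * (A - (P + i')%:R).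
Proof.
rewrite mul2n -addnn big_nat_addn.
have E1 : \sum_(0 <= i < k) (\sum_(0 <= i' < k + k)
    moment_weight H P (k <= i)%N i' * F i') * (A - (H + i)%:R) =
   \sum_(0 <= i' < k + k) F i' *
     (moment_weight H P false i' * \sum_(0 <= i < k) (A - (H + i)%:R)).
  transitivity (\sum_(0 <= i < k) (\sum_(0 <= i' < k + k)
    F i' * (moment_weight H P false i' * (A - (H + i)%:R)))).
    apply: eq_big_nat => i /andP[_ ik]; rewrite mulr_suml; apply: eq_bigr => i' _.
    by rewrite leqNgt ik/=; ring.
  rewrite exchange_big/=; apply: eq_bigr => i' _.
  by rewrite mulr_sumr mulr_sumr.
have E2 : \sum_(0 <= i < k) (\sum_(0 <= i' < k + k)
    moment_weight H P (k <= k + i)%N i' * F i') * (A - (H + (k + i))%:R) =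
   \sum_(0 <= i' < k + k) F i' *
     (moment_weight H P true i' * \sum_(0 <= i < k) (A - (H + k + i)%:R)).
  transitivity (\sum_(0 <= i < k) (\sum_(0 <= i' < k + k)
    F i' * (moment_weight H P true i' * (A - (H + k + i)%:R)))).
    apply: eq_big_nat => i /andP[_ ik]; rewrite mulr_suml; apply: eq_bigr => i' _.
    by rewrite leq_addr addnA; ring.
  rewrite exchange_big/=; apply: eq_bigr => i' _.
  by rewrite mulr_sumr mulr_sumr.
rewrite E1 E2 -big_split/=; apply: eq_bigr => i' _.
by rewrite -mulrDr affine_moment_weight.
Qed.

(** The two half blocks are adjacent, so that the extrapolation only
    multiplies by 4 the weights 1/k. *)
Lemma moment_weight_le (h P : nat) (snd : bool) (i : nat) : (i < 2 * k)%N ->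
  (P = h + 2 * k)%N \/ (h = P + 2 * k)%N ->
  (moment_weight h P snd i) ^+ 2 <= 16 / k%:R ^+ 2.
Proof.
move=> ik hP.
have k1 : (k.-1)%:R = k%:R - 1 :> R by rewrite -subn1 natrB.
have kk : 1 <= k%:R :> R by rewrite ler1n.
have ik' : i%:R <= 2 * k%:R - 1 :> R.
  by rewrite lerBrDr natr1 -natrM ler_nat.
have i0 : 0 <= i%:R :> R by rewrite ler0n.
pose u : R := (P + i)%:R - h%:R - (k.-1)%:R / 2.
have hu : -3 * k%:R <= u <= 4 * k%:R.
  have hE : P%:R = h%:R + 2 * k%:R :> R \/ h%:R = P%:R + 2 * k%:R :> R.
    by case: hP => E; [left|right]; rewrite E natrD natrM.
  rewrite /u k1 natrD; apply/andP; move: hE => [E|E].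
    by split; lra.
  by split; lra.
pose m : R := if snd then u else k%:R - u.
have -> : moment_weight h P snd i = m / k%:R ^+ 2.
  rewrite /moment_weight /m -/u; case: {m} snd => //.
  by field; rewrite gt_eqF.
have hm : - 4 * k%:R <= m <= 4 * k%:R.
  by move/andP: hu => [hu1 hu2]; rewrite /m; apply/andP; case: {m} snd; split; lra.
rewrite expr_div_n -exprM ler_pdivrMr ?exprn_gt0//.
have -> : 16 / k%:R ^+ 2 * k%:R ^+ (2 * 2) = (4 * k%:R) ^+ 2 :> R.
  by field; rewrite gt_eqF.
by nra.
Qed.

(** Half blocks have length 2 k and are numbered from 0: blocks are pairs of
    consecutive half blocks, the second one being odd. *)
Definition half_odd (j : nat) : bool := odd (j %/ (2 * k)).
Definition half_start (j : nat) : nat := j %/ (2 * k) * (2 * k).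
Definition partner_start (j : nat) : nat :=
  (if half_odd j then (j %/ (2 * k)).-1 else (j %/ (2 * k)).+1) * (2 * k).

(** The displacement at j that lets the amplitude [a] transport to the half
    block of j the contribution of [d * y] in the partner half block. *)
Definition kick (a d y : nat -> R) (j : nat) : R :=
  (a j)^-1 * \sum_(0 <= i < 2 * k)
    moment_weight (half_start j) (partner_start j) (odd (j %/ k)) i *
      (d (partner_start j + i)%N * y (partner_start j + i)%N).

Lemma half_indexE c i : (i < 2 * k)%N ->
  [/\ (c * (2 * k) + i) %/ (2 * k) = c,
      half_odd (c * (2 * k) + i) = odd c,
      half_start (c * (2 * k) + i) = c * (2 * k),
      partner_start (c * (2 * k) + i) = (if odd c then c.-1 else c.+1) * (2 * k) &
      odd ((c * (2 * k) + i) %/ k) = (k <= i)]%N.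
Proof.
move=> ik; have E : ((c * (2 * k) + i) %/ (2 * k) = c)%N.
  by rewrite divnMDl ?muln_gt0// divn_small// addn0.
split=> //; rewrite /half_odd /half_start /partner_start /half_odd ?E//.
rewrite mulnA divnMDl// oddD mulnC mul2n odd_double addFb.
have [ki|ki] := leqP k i; last by rewrite divn_small.
have -> : (i = k + (i - k))%N by rewrite subnKC.
rewrite divnDl ?dvdnn// divnn k_gt0 divn_small// ltn_subLR//.
by rewrite addnn -mul2n.
Qed.

Lemma kick_match (a d y : nat -> R) (A : R) (c : nat) :
  (forall i, (i < 2 * k)%N -> a (c * (2 * k) + i)%N != 0) ->
  let P := ((if odd c then c.-1 else c.+1) * (2 * k))%N in
  \sum_(0 <= i < 2 * k) a (c * (2 * k) + i)%N * kick a d y (c * (2 * k) + i)%N *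
     (A - (c * (2 * k) + i)%:R) =
  \sum_(0 <= i < 2 * k) d (P + i)%N * y (P + i)%N * (A - (P + i)%:R).
Proof.
move=> a0 P.
rewrite -(half_match A (c * (2 * k)) P (fun i => d (P + i)%N * y (P + i)%N)).
apply: eq_big_nat => i /andP[_ ik]; congr (_ * _).
have [_ _ E1 E2 E3] := half_indexE c ik.
by rewrite /kick E1 E2 E3 mulrA divff ?a0// mul1r.
Qed.

(** The second halves are moved first; then the first halves are moved,
    according to the new values in the second ones. *)
Definition move_odd (s1 d x : nat -> R) (j : nat) : R :=
  if half_odd j then kick s1 d x j else 0.
Definition move_even (s0 d y : nat -> R) (j : nat) : R :=
  if half_odd j then 0 else kick s0 d y j.

Lemma block_sum_split (F : nat -> R) r :
  \sum_(0 <= i < 4 * k) F (r * (4 * k) + i)%N =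
  \sum_(0 <= i < 2 * k) F (r.*2 * (2 * k) + i)%N +
  \sum_(0 <= i < 2 * k) F (r.*2.+1 * (2 * k) + i)%N.
Proof.
have -> : (4 * k = 2 * k + 2 * k)%N by lia.
rewrite big_nat_addn.
congr (_ + _); apply: eq_bigr => i _; congr (F _); lia.
Qed.

(** Write e and o for the contributions of the first and second halves to an
    affine moment, and d = s1 - s0. After the first move, o(s1 y) = o(s1 x) +
    e(d x); after the second one, e(s0 z) = e(s0 x) + o(d y). So e(s0 z) +
    o(s0 z) = e(s0 x) + o(s1 y) = e(s0 x) + e(d x) + o(s1 x) = e(s1 x) + o(s1
    x). *)
Lemma block_match (s0 s1 x : nat -> R) (A : R) (r : nat) :
  (forall i, (i < 4 * k)%N -> s0 (r * (4 * k) + i)%N != 0) ->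
  (forall i, (i < 4 * k)%N -> s1 (r * (4 * k) + i)%N != 0) ->
  let d j := s1 j - s0 j in
  let y j := x j + move_odd s1 d x j in
  let z j := y j + move_even s0 d y j in
  \sum_(0 <= i < 4 * k) (s0 (r * (4 * k) + i)%N * z (r * (4 * k) + i)%N -
     s1 (r * (4 * k) + i)%N * x (r * (4 * k) + i)%N) *
     (A - (r * (4 * k) + i)%:R) = 0.
Proof.
move=> s00 s10 d y z.
rewrite (block_sum_split (fun j => (s0 j * z j - s1 j * x j) * (A - j%:R))).
have ne0 i : (i < 2 * k)%N -> s0 (r.*2 * (2 * k) + i)%N != 0.
  move=> ik; have -> : (r.*2 * (2 * k) + i = r * (4 * k) + i)%N by lia.
  by apply: s00; lia.
have ne1 i : (i < 2 * k)%N -> s1 (r.*2.+1 * (2 * k) + i)%N != 0.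
  move=> ik; have -> : (r.*2.+1 * (2 * k) + i = r * (4 * k) + (2 * k + i))%N by lia.
  by apply: s10; lia.
have M1 := @kick_match s1 d x A r.*2.+1 ne1.
have M0 := @kick_match s0 d y A r.*2 ne0.
rewrite /= odd_double /= in M0 M1.
have -> : \sum_(0 <= i < 2 * k) (s0 (r.*2 * (2 * k) + i)%N * z (r.*2 * (2 * k) + i)%N -
    s1 (r.*2 * (2 * k) + i)%N * x (r.*2 * (2 * k) + i)%N) *
    (A - (r.*2 * (2 * k) + i)%:R) =
  - \sum_(0 <= i < 2 * k) d (r.*2 * (2 * k) + i)%N * x (r.*2 * (2 * k) + i)%N *
      (A - (r.*2 * (2 * k) + i)%:R) +
  \sum_(0 <= i < 2 * k) s0 (r.*2 * (2 * k) + i)%N * kick s0 d y (r.*2 * (2 * k) + i)%N *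
      (A - (r.*2 * (2 * k) + i)%:R).
  rewrite -sumrN -big_split/=; apply: eq_big_nat => i /andP[_ ik].
  have [_ E _ _ _] := half_indexE r.*2 ik.
  by rewrite /z /y /move_odd /move_even E odd_double /d; ring.
rewrite M0.
have -> : \sum_(0 <= i < 2 * k) (s0 (r.*2.+1 * (2 * k) + i)%N * z (r.*2.+1 * (2 * k) + i)%N -
    s1 (r.*2.+1 * (2 * k) + i)%N * x (r.*2.+1 * (2 * k) + i)%N) *
    (A - (r.*2.+1 * (2 * k) + i)%:R) =
  - \sum_(0 <= i < 2 * k) d (r.*2.+1 * (2 * k) + i)%N * y (r.*2.+1 * (2 * k) + i)%N *
      (A - (r.*2.+1 * (2 * k) + i)%:R) +
  \sum_(0 <= i < 2 * k) s1 (r.*2.+1 * (2 * k) + i)%N * kick s1 d x (r.*2.+1 * (2 * k) + i)%N *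
      (A - (r.*2.+1 * (2 * k) + i)%:R).
  rewrite -sumrN -big_split/=; apply: eq_big_nat => i /andP[_ ik].
  have [_ E _ _ _] := half_indexE r.*2.+1 ik.
  by rewrite /z /y /move_odd /move_even E /= odd_double /= /d; ring.
by rewrite M1; ring.
Qed.

End block_algebra.

(** * Second moments of the moves *)

Section second_moment_bounds.
Context {R : realType} d (T : measurableType d) (nu : probability T R).

(** Measurability is part of the bound since the shifts have to be measurable
    too. *)
Definition second_moment_le (phi : T -> R) (B : R) : Prop :=
  measurable_fun setT phi /\ (\int[nu]_v ((phi v) ^+ 2)%:E <= B%:E)%E.

Lemma second_moment_leW phi A B : second_moment_le phi A -> A <= B ->
  second_moment_le phi B.
Proof. by move=> [m h] AB; split=> //; apply: le_trans h _; rewrite lee_fin. Qed.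

Lemma eq_second_moment_le phi psi B : phi =1 psi ->
  second_moment_le phi B -> second_moment_le psi B.
Proof. by move=> /funext ->. Qed.

Let mE (phi : T -> R) : measurable_fun setT phi -> measurable_fun setT (fun v : T => ((phi v) ^+ 2)%:E).
Proof. by move=> m; apply/measurable_EFinP; exact: measurable_funX. Qed.

Lemma second_moment_leD phi psi A B : second_moment_le phi A ->
  second_moment_le psi B ->
  second_moment_le (fun v => phi v + psi v) (2 * A + 2 * B).
Proof.
move=> [mphi hphi] [mpsi hpsi]; split; first exact: measurable_funD.
apply: (le_trans (integral_sqrD_le _ _ _ _)) => //.
have -> : (2 * A + 2 * B)%:E = (2%:E * A%:E + 2%:E * B%:E)%E by [].
by apply: leeD; exact: lee_wpmul2l.
Qed.

Lemma second_moment_leZ (c : R) phi A : second_moment_le phi A ->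
  second_moment_le (fun v => c * phi v) (c ^+ 2 * A).
Proof.
move=> [mphi hphi]; split; first exact: measurable_funM.
rewrite (_ : (fun v => _) = (fun v => (c ^+ 2)%:E * ((phi v) ^+ 2)%:E)%E); last first.
  by apply/funext => v; rewrite -EFinM exprMn.
rewrite ge0_integralZl//; last 3 first.
- exact: mE.
- by move=> v _; rewrite lee_fin sqr_ge0.
- by rewrite lee_fin sqr_ge0.
have -> : (c ^+ 2 * A)%:E = ((c ^+ 2)%:E * A%:E)%E by [].
by apply: lee_wpmul2l => //; rewrite lee_fin sqr_ge0.
Qed.

Lemma integral_sum_sqr_le (I : Type) (s : seq I) (Q : pred I) (phi : I -> T -> R) (B : I -> R) :
  (forall i, Q i -> second_moment_le (phi i) (B i)) ->
  (\int[nu]_v (\sum_(i <- s | Q i) (phi i v) ^+ 2)%:E <= (\sum_(i <- s | Q i) B i)%:E)%E.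
Proof.
move=> h.
elim: s => [|i s IH].
  by under eq_integral do rewrite big_nil; rewrite integral0 big_nil.
rewrite big_cons; under eq_integral do rewrite big_cons.
case: ifP => // Qi.
have mS : measurable_fun setT (fun v => (\sum_(i <- s | Q i) (phi i v) ^+ 2)%:E).
  apply/measurable_EFinP; elim: s {IH} => [|j s IHs].
    by rewrite (_ : (fun _ => _) = cst 0)//; apply/funext => v; rewrite big_nil.
  have [Qj|Qj] := boolP (Q j).
    rewrite (_ : (fun _ => _) = fun v => (phi j v) ^+ 2 +
        \sum_(i <- s | Q i) (phi i v) ^+ 2); last first.
      by apply/funext => v; rewrite big_cons Qj.
    by apply: measurable_funD => //; apply: measurable_funX; case: (h j Qj).
  rewrite (_ : (fun _ => _) = fun v => \sum_(i <- s | Q i) (phi i v) ^+ 2)//.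
  by apply/funext => v; rewrite big_cons (negbTE Qj).
have [mi hi] := h i Qi.
under eq_integral do rewrite EFinD.
rewrite ge0_integralD//; last 3 first.
- by move=> v _; rewrite lee_fin sqr_ge0.
- exact: mE.
- by move=> v _; rewrite lee_fin; apply: sumr_ge0 => j _; exact: sqr_ge0.
by rewrite EFinD; exact: leeD.
Qed.

Lemma cauchy_schwarz_sum (m : nat) (alpha z : nat -> R) :
  (\sum_(0 <= i < m) alpha i * z i) ^+ 2 <=
  (\sum_(0 <= i < m) alpha i ^+ 2) * (\sum_(0 <= i < m) z i ^+ 2).
Proof.
elim: m => [|m IH]; first by rewrite !big_geq// expr0n mul0r.
rewrite !big_nat_recr//=.
set A := \sum_(0 <= i < m) alpha i ^+ 2 in IH *.
set Z := \sum_(0 <= i < m) z i ^+ 2 in IH *.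
set S := \sum_(0 <= i < m) alpha i * z i in IH *.
have A0 : 0 <= A by apply: sumr_ge0 => i _; exact: sqr_ge0.
have Z0 : 0 <= Z by apply: sumr_ge0 => i _; exact: sqr_ge0.
move: (alpha m) (z m) => u v.
have [A00|A1] := eqVneq A 0.
  move: IH; rewrite A00 mul0r => IH.
  have S0 : S = 0 by apply/eqP; rewrite -sqrf_eq0 eq_le IH sqr_ge0.
  by rewrite S0 !add0r exprMn ler_wpM2l ?sqr_ge0// lerDr.
have {}A1 : 0 < A by rewrite lt_neqAle eq_sym A1.
have h : 2 * S * (u * v) <= A * v ^+ 2 + u ^+ 2 * Z.
  have : 2 * S * (u * v) * A <= (A * v ^+ 2 + u ^+ 2 * Z) * A.
    have := sqr_ge0 (A * v - S * u); have := sqr_ge0 u; nra.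
  by rewrite ler_pM2r.
by nra.
Qed.

Lemma second_moment_le_sum (m : nat) (alpha : nat -> R) (phi : nat -> T -> R) (B : nat -> R) :
  (forall i, (i < m)%N -> second_moment_le (phi i) (B i)) ->
  second_moment_le (fun v => \sum_(0 <= i < m) alpha i * phi i v)
    ((\sum_(0 <= i < m) alpha i ^+ 2) * (\sum_(0 <= i < m) B i)).
Proof.
move=> h.
pose phi' i := if (i < m)%N then phi i else cst 0.
have h' i : (i < m)%N -> second_moment_le (phi' i) (B i).
  by move=> im; rewrite /phi' im; exact: h.
have mphi' i : measurable_fun setT (phi' i).
  by rewrite /phi'; case: ifP => // im; case: (h i im).
have E v : \sum_(0 <= i < m) alpha i * phi i v = \sum_(0 <= i < m) alpha i * phi' i v.
  by apply: eq_big_nat => i /andP[_ im]; rewrite /phi' im.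
apply: (eq_second_moment_le (fun v => esym (E v))).
split; first by apply: measurable_sum => i; exact: measurable_funM.
set A := \sum_(0 <= i < m) alpha i ^+ 2.
have A0 : 0 <= A by apply: sumr_ge0 => i _; exact: sqr_ge0.
have mS : measurable_fun setT (fun v => (\sum_(0 <= i < m) (phi' i v) ^+ 2)%:E).
  by apply/measurable_EFinP; apply: measurable_sum => i; exact: measurable_funX.
apply: (@le_trans _ _ (\int[nu]_v (A%:E * (\sum_(0 <= i < m) (phi' i v) ^+ 2)%:E))%E).
  apply: ge0_le_integral => //.
  - by move=> v _; rewrite lee_fin sqr_ge0.
  - by apply: mE; apply: measurable_sum => i; exact: measurable_funM.
  - exact: emeasurable_funM.
  - move=> v _; rewrite -EFinM lee_fin.
    exact: (cauchy_schwarz_sum m alpha (fun i => phi' i v)).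
rewrite ge0_integralZl//; last first.
  by move=> v _; rewrite lee_fin; apply: sumr_ge0 => j _; exact: sqr_ge0.
rewrite EFinM; apply: lee_wpmul2l => //.
under eq_integral do rewrite big_nat.
by rewrite big_nat; apply: integral_sum_sqr_le => i /andP[_ im]; exact: h'.
Qed.

End second_moment_bounds.

Lemma sum_nat_cst {R : pzRingType} (m : nat) (c : R) : \sum_(0 <= i < m) c = m%:R * c.
Proof. by rewrite sumr_const_nat subn0 mulr_natl. Qed.

(** The variables x_j are uncorrelated with variance 1/N, which [lin] states
    for windows of indices; D r bounds |s1 - s0| on block r. *)
Section block_bounds.
Context {R : realType} dd (T : measurableType dd) (nu : probability T R).
Variables (k nb : nat) (x : nat -> T -> R).
Hypothesis k_gt0 : (0 < k)%N.
Let N := (nb * (4 * k))%N.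
Hypothesis lin : forall (P m : nat) (c : nat -> R), (P + m <= N)%N ->
  second_moment_le nu (fun v => \sum_(0 <= i < m) c i * x (P + i)%N v)
    ((\sum_(0 <= i < m) c i ^+ 2) / N%:R).
Variables (s0 s1 : nat -> R) (a b delta : R) (D : nat -> R).
Hypotheses (a_gt0 : 0 < a).
Hypothesis s0_ab : forall j, (j < N)%N -> a <= s0 j <= b.
Hypothesis s1_ab : forall j, (j < N)%N -> a <= s1 j <= b.
Let d j := s1 j - s0 j.
Hypothesis dD : forall j, (j < N)%N -> `|d j| <= D (j %/ (4 * k)).
Hypotheses (D_ge0 : forall r, 0 <= D r) (D_le : forall r, D r <= delta).
Hypothesis delta_a : 64 * delta ^+ 2 <= a ^+ 2.

Let k0 : 0 < k%:R :> R. Proof. by rewrite ltr0n. Qed.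

Let half_block c i : (i < 2 * k)%N -> ((c * (2 * k) + i) %/ (4 * k) = c./2)%N.
Proof.
move=> ik.
have -> : (c * (2 * k) + i = c./2 * (4 * k) + (odd c * (2 * k) + i))%N.
  rewrite -{1}(odd_double_half c); lia.
rewrite divnMDl ?muln_gt0// divn_small ?addn0//.
by case: (odd c); lia.
Qed.

Let half_lt c i : (c < nb.*2)%N -> (i < 2 * k)%N -> (c * (2 * k) + i < N)%N.
Proof.
move=> cn ik; rewrite /N.
have : (c * (2 * k) + 2 * k <= nb * (4 * k))%N.
  have -> : (nb * (4 * k) = nb.*2 * (2 * k))%N by lia.
  by rewrite -mulSnr leq_mul2r cn orbT.
lia.
Qed.

Let partner c := if odd c then c.-1 else c.+1.

Let partner_lt c : (c < nb.*2)%N -> (partner c < nb.*2)%N.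
Proof. by rewrite /partner => h; case: ifP => o; lia. Qed.

Let partner_half c : (partner c)./2 = c./2.
Proof. by rewrite /partner; case: ifP => o; lia. Qed.

Let N_gt0 c : (c < nb.*2)%N -> 0 < N%:R :> R.
Proof. by move=> h; rewrite ltr0n /N muln_gt0; lia. Qed.

Let kick_coef (s : nat -> R) c i0 i :=
  (s (c * (2 * k) + i0)%N)^-1 * (moment_weight k (c * (2 * k)) (partner c * (2 * k))
     (k <= i0)%N i * d (partner c * (2 * k) + i)%N).

Let kickE s c i0 (y : nat -> R) : (i0 < 2 * k)%N ->
  kick k s d y (c * (2 * k) + i0)%N =
  \sum_(0 <= i < 2 * k) kick_coef s c i0 i * y (partner c * (2 * k) + i)%N.
Proof.
move=> ik; have [_ _ E1 E2 E3] := half_indexE k_gt0 c ik.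
rewrite /kick E1 E2 E3 mulr_sumr; apply: eq_bigr => i _.
by rewrite /kick_coef /partner !mulrA.
Qed.

(** The 2 k coefficients are at most 4 / k times D / a. *)
Let kick_coef_sqr s c i0 : (c < nb.*2)%N -> (i0 < 2 * k)%N ->
  (forall j, (j < N)%N -> a <= s j <= b) ->
  \sum_(0 <= i < 2 * k) kick_coef s c i0 i ^+ 2 <=
    32 * D c./2 ^+ 2 / (a ^+ 2 * k%:R).
Proof.
move=> cn ik sab.
apply: (@le_trans _ _ (\sum_(0 <= i < 2 * k)
   (a ^- 2 * (16 / k%:R ^+ 2 * D c./2 ^+ 2)))); last first.
  rewrite sum_nat_cst (natrM _ 2 k) le_eqVlt; apply/orP; left.
  by apply/eqP; field; rewrite !gt_eqF.
rewrite !big_nat; apply: ler_sum => i /andP[_ ik'].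
have /andP[sa _] := sab _ (half_lt cn ik).
rewrite /kick_coef !exprMn exprVn; apply: ler_pM.
- by rewrite invr_ge0 sqr_ge0.
- by rewrite mulr_ge0// sqr_ge0.
- rewrite lef_pV2 ?posrE ?exprn_gt0//; last exact: lt_le_trans sa.
  by rewrite ler_sqr ?nnegrE ?(ltW a_gt0)// (le_trans (ltW a_gt0)).
apply: ler_pM; rewrite ?sqr_ge0//.
  apply: moment_weight_le => //; rewrite /partner; case: ifP => o.
    by right; have : (0 < c)%N by [case: (c) o]; case: (c) => // c' _; lia.
  by left; lia.
have h := dD (half_lt (partner_lt cn) ik').
rewrite half_block// partner_half in h.
by rewrite -[leLHS]real_normK ?num_real// ler_sqr ?nnegrE.
Qed.

Let B1 r := 32 * D r ^+ 2 / (a ^+ 2 * k%:R) / N%:R.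

Let B1_ge0 r : 0 <= B1 r.
Proof.
rewrite /B1 !mulr_ge0 ?invr_ge0 ?ler0n ?sqr_ge0//.
by rewrite mulr_ge0 ?sqr_ge0.
Qed.

Lemma kick_second_moment s c i0 : (c < nb.*2)%N -> (i0 < 2 * k)%N ->
  (forall j, (j < N)%N -> a <= s j <= b) ->
  second_moment_le nu (fun v => kick k s d (x^~ v) (c * (2 * k) + i0)%N) (B1 c./2).
Proof.
move=> cn ik sab.
apply: (eq_second_moment_le (fun v => esym (kickE s c (x^~ v) ik))).
apply: (second_moment_leW (lin _ _)).
  have -> : (partner c * (2 * k) + 2 * k = (partner c).+1 * (2 * k))%N by lia.
  have -> : N = (nb.*2 * (2 * k))%N by rewrite /N; lia.
  by rewrite leq_mul2r partner_lt ?orbT.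
by rewrite ler_pM2r ?invr_gt0 ?(N_gt0 cn)//; exact: kick_coef_sqr.
Qed.

Lemma move_odd_second_moment c i0 : (c < nb.*2)%N -> (i0 < 2 * k)%N ->
  second_moment_le nu (fun v => move_odd k s1 d (x^~ v) (c * (2 * k) + i0)%N) (B1 c./2).
Proof.
move=> cn ik; have [_ E _ _ _] := half_indexE k_gt0 c ik.
have [oc|oc] := boolP (odd c).
  apply: (eq_second_moment_le (phi := fun v => kick k s1 d (x^~ v) (c * (2 * k) + i0)%N)).
    by move=> v; rewrite /move_odd E oc.
  exact: kick_second_moment.
apply: (eq_second_moment_le (phi := cst 0)).
  by move=> v; rewrite /move_odd E (negbTE oc).
split; first exact: measurable_cst.
by under eq_integral do rewrite expr0n; rewrite integral0 lee_fin.
Qed.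

Lemma move_even_second_moment c i0 : (c < nb.*2)%N -> (i0 < 2 * k)%N ->
  second_moment_le nu (fun v => move_even k s0 d (x^~ v) (c * (2 * k) + i0)%N) (B1 c./2).
Proof.
move=> cn ik; have [_ E _ _ _] := half_indexE k_gt0 c ik.
have [oc|oc] := boolP (odd c); last first.
  apply: (eq_second_moment_le (phi := fun v => kick k s0 d (x^~ v) (c * (2 * k) + i0)%N)).
    by move=> v; rewrite /move_even E (negbTE oc).
  exact: kick_second_moment.
apply: (eq_second_moment_le (phi := cst 0)).
  by move=> v; rewrite /move_even E oc.
split; first exact: measurable_cst.
by under eq_integral do rewrite expr0n; rewrite integral0 lee_fin.
Qed.

Let y (v : T) j := x j v + move_odd k s1 d (x^~ v) j.
Let g (v : T) j := move_odd k s1 d (x^~ v) j + move_even k s0 d (y v) j.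

(** In a first half, the displacement depends on already moved increments. The
    correction is a linear function of the first displacements, and the
    smallness of delta / a keeps it below them. *)
Lemma move_second_moment c i0 : (c < nb.*2)%N -> (i0 < 2 * k)%N ->
  second_moment_le nu (fun v => g v (c * (2 * k) + i0)%N) (4 * B1 c./2).
Proof.
move=> cn ik; have [_ E _ _ _] := half_indexE k_gt0 c ik.
have [oc|oc] := boolP (odd c).
  have Eg v : move_odd k s1 d (x^~ v) (c * (2 * k) + i0)%N = g v (c * (2 * k) + i0)%N.
    by rewrite /g /move_even E oc addr0.
  apply: (eq_second_moment_le Eg); apply: second_moment_leW (move_odd_second_moment cn ik) _.
  by have := B1_ge0 c./2; lra.
have Eg v : kick k s0 d (x^~ v) (c * (2 * k) + i0)%N +
    \sum_(0 <= i < 2 * k) kick_coef s0 c i0 i *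
       move_odd k s1 d (x^~ v) (partner c * (2 * k) + i)%N = g v (c * (2 * k) + i0)%N.
  rewrite /g {2}/move_odd /move_even E (negbTE oc) add0r !kickE// -big_split/=.
  by apply: eq_bigr => i _; rewrite -mulrDr.
apply: (eq_second_moment_le Eg).
have h2 := @second_moment_le_sum _ _ _ nu (2 * k) (kick_coef s0 c i0)
  (fun i v => move_odd k s1 d (x^~ v) (partner c * (2 * k) + i)%N)
  (fun=> B1 c./2).
apply: second_moment_leW (second_moment_leD (kick_second_moment cn ik s0_ab) (h2 _)) _.
  move=> i ik'; rewrite -(partner_half c).
  by apply: move_odd_second_moment => //; exact: partner_lt.
rewrite sum_nat_cst (natrM _ 2 k).
have h3 := kick_coef_sqr cn ik s0_ab.
set S := \sum_(_ <= _ < _) _ in h3 *.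
have D2 : D c./2 ^+ 2 <= delta ^+ 2.
  by rewrite ler_sqr ?nnegrE// (le_trans (D_ge0 c./2)).
have h4 : S * (2 * k%:R) <= 1.
  apply: (@le_trans _ _ (32 * D c./2 ^+ 2 / (a ^+ 2 * k%:R) * (2 * k%:R))).
    by rewrite ler_wpM2r// mulr_ge0// ltW.
  have -> : 32 * D c./2 ^+ 2 / (a ^+ 2 * k%:R) * (2 * k%:R) = 64 * D c./2 ^+ 2 / a ^+ 2.
    by field; rewrite !gt_eqF.
  rewrite ler_pdivrMr ?exprn_gt0// mul1r; apply: le_trans delta_a.
  by rewrite ler_pM2l.
have := B1_ge0 c./2; nra.
Qed.

(** An observation made rho steps after the beginning of block r weighs its
    increments by at most 4 k / N; the sum has at most 4 k terms of variance
    of order D^2 / N from the difference of the volatilities, and the moves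
    contribute the same order. *)
Lemma residual_second_moment r rho : (r < nb)%N -> (rho <= 4 * k)%N ->
  second_moment_le nu (fun v => \sum_(0 <= i < rho) (rho - i)%N%:R / N%:R *
     (s0 (r * (4 * k) + i)%N * (x (r * (4 * k) + i)%N v + g v (r * (4 * k) + i)%N) -
      s1 (r * (4 * k) + i)%N * x (r * (4 * k) + i)%N v))
    (128 * (1 + 512 * b ^+ 2 / a ^+ 2) * D r ^+ 2 * (k%:R / N%:R) ^+ 3).
Proof.
move=> rn rk.
have N0 : 0 < N%:R :> R by rewrite ltr0n /N muln_gt0; lia.
have rlt i : (i < 4 * k)%N -> (r * (4 * k) + i < N)%N.
  move=> ik; have : (r * (4 * k) + 4 * k <= N)%N by rewrite -mulSnr leq_mul2r rn orbT.
  lia.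
have E v : \sum_(0 <= i < rho) (- ((rho - i)%N%:R / N%:R) * d (r * (4 * k) + i)%N) *
       x (r * (4 * k) + i)%N v +
    \sum_(0 <= i < rho) ((rho - i)%N%:R / N%:R * s0 (r * (4 * k) + i)%N) *
       g v (r * (4 * k) + i)%N =
  \sum_(0 <= i < rho) (rho - i)%N%:R / N%:R *
     (s0 (r * (4 * k) + i)%N * (x (r * (4 * k) + i)%N v + g v (r * (4 * k) + i)%N) -
      s1 (r * (4 * k) + i)%N * x (r * (4 * k) + i)%N v).
  by rewrite -big_split/=; apply: eq_bigr => i _; rewrite /d; ring.
apply: (eq_second_moment_le E).
have w2 i : ((rho - i)%N%:R / N%:R) ^+ 2 <= (4 * k%:R / N%:R) ^+ 2 :> R.
  rewrite ler_sqr ?nnegrE; last 2 first.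
  - by rewrite divr_ge0.
  - by rewrite divr_ge0// mulr_ge0// ltW.
  by rewrite ler_pM2r ?invr_gt0// -natrM ler_nat; lia.
have wk : 0 <= (4 * k%:R / N%:R) ^+ 2 :> R by exact: sqr_ge0.
have hx := @lin (r * (4 * k))%N rho
  (fun i => - ((rho - i)%N%:R / N%:R) * d (r * (4 * k) + i)%N) _.
have hg := @second_moment_le_sum _ _ _ nu rho
   (fun i => (rho - i)%N%:R / N%:R * s0 (r * (4 * k) + i)%N)
   (fun i v => g v (r * (4 * k) + i)%N) (fun=> 4 * B1 r).
apply: second_moment_leW (second_moment_leD (hx _) (hg _)) _.
- apply: (@leq_trans (r * (4 * k) + 4 * k)); first by rewrite leq_add2l.
  by rewrite -mulSnr leq_mul2r rn orbT.
- move=> i ir; have i4 : (i < 4 * k)%N by exact: leq_trans rk.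
  have [i2|i2] := ltnP i (2 * k).
    have -> : (r * (4 * k) + i = r.*2 * (2 * k) + i)%N by lia.
    rewrite -{2}(doubleK r); apply: move_second_moment => //; lia.
  have -> : (r * (4 * k) + i = r.*2.+1 * (2 * k) + (i - 2 * k))%N by lia.
  have -> : B1 r = B1 (r.*2.+1)./2 by congr B1; lia.
  by apply: move_second_moment; lia.
have sx : \sum_(0 <= i < rho) (- ((rho - i)%N%:R / N%:R) * d (r * (4 * k) + i)%N) ^+ 2 <=
    (4 * k%:R) * ((4 * k%:R / N%:R) ^+ 2 * D r ^+ 2).
  apply: (@le_trans _ _ (\sum_(0 <= i < rho) ((4 * k%:R / N%:R) ^+ 2 * D r ^+ 2))).
    rewrite !big_nat; apply: ler_sum => i /andP[_ ir].
    rewrite exprMn sqrrN; apply: ler_pM; rewrite ?sqr_ge0//.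
    have i4 : (i < 4 * k)%N by exact: leq_trans rk.
    have := dD (rlt i i4); rewrite divnMDl ?muln_gt0// divn_small// addn0 => h.
    by rewrite -[leLHS]real_normK ?num_real// ler_sqr ?nnegrE.
  rewrite sum_nat_cst; apply: ler_wpM2r; first by apply: mulr_ge0; exact: sqr_ge0.
  by rewrite -natrM ler_nat.
have sg : \sum_(0 <= i < rho) ((rho - i)%N%:R / N%:R * s0 (r * (4 * k) + i)%N) ^+ 2 <=
    (4 * k%:R) * ((4 * k%:R / N%:R) ^+ 2 * b ^+ 2).
  apply: (@le_trans _ _ (\sum_(0 <= i < rho) ((4 * k%:R / N%:R) ^+ 2 * b ^+ 2))).
    rewrite !big_nat; apply: ler_sum => i /andP[_ ir].
    rewrite exprMn; apply: ler_pM; rewrite ?sqr_ge0//.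
    have i4 : (i < 4 * k)%N by exact: leq_trans rk.
    have /andP[h1 h2] := s0_ab (rlt i i4).
    have h3 := le_trans (ltW a_gt0) h1.
    by rewrite ler_sqr ?nnegrE// (le_trans h3).
  rewrite sum_nat_cst; apply: ler_wpM2r; first by apply: mulr_ge0; exact: sqr_ge0.
  by rewrite -natrM ler_nat.
have sB : \sum_(0 <= i < rho) 4 * B1 r <= (4 * k%:R) * (4 * B1 r).
  rewrite sum_nat_cst ler_wpM2r//.
    by rewrite mulr_ge0.
  by rewrite -natrM ler_nat.
apply: (@le_trans _ _ (2 * ((4 * k%:R) * ((4 * k%:R / N%:R) ^+ 2 * D r ^+ 2) / N%:R) +
   2 * ((4 * k%:R) * ((4 * k%:R / N%:R) ^+ 2 * b ^+ 2) * ((4 * k%:R) * (4 * B1 r))))).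
  apply: lerD.
    by rewrite ler_pM2l// ler_pM2r ?invr_gt0.
  rewrite ler_pM2l//; apply: ler_pM => //.
    by apply: sumr_ge0 => i _; exact: sqr_ge0.
  by apply: sumr_ge0 => i _; rewrite mulr_ge0.
rewrite /B1 le_eqVlt; apply/orP; left; apply/eqP; field.
by rewrite !gt_eqF.
Qed.

End block_bounds.

(** * Three shifts from one volatility to another *)

Lemma ltn_block c i w B : (c < B -> i < w -> c * w + i < B * w)%N.
Proof.
move=> cB iw; apply: (@leq_trans (c.+1 * w)); first by rewrite mulSnr ltn_add2l.
by rewrite leq_mul2r cB orbT.
Qed.

Lemma partner_lt_double c nb :
  (c < nb.*2 -> (if odd c then c.-1 else c.+1) < nb.*2)%N.
Proof. by move=> h; case: ifP => o; lia. Qed.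

Lemma odd_partner c : odd (if odd c then c.-1 else c.+1) = ~~ odd c.
Proof. by case: ifP => o; lia. Qed.

Lemma double_half_block nb k : (nb.*2 * (2 * k) = nb * (4 * k))%N.
Proof. by lia. Qed.

Lemma half_half_block j k : (j %/ (4 * k) = (j %/ (2 * k))./2)%N.
Proof. by rewrite -divn2 -divnMA; congr (_ %/ _)%N; lia. Qed.

Lemma noise_constant_ge0 (R : realType) (a b : R) :
  0 <= 128 * (1 + 512 * b ^+ 2 / a ^+ 2).
Proof.
have q0 : 0 <= b ^+ 2 / a ^+ 2 by rewrite divr_ge0 ?sqr_ge0.
rewrite -mulrA; move: (b ^+ 2 / _) q0 => y y0; lra.
Qed.

(** The grid has nb blocks of 4 k = 4 n m steps, and observation i is made
    after M * (i + 1) steps. The vector v consists of the N grid increments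
    followed by the n noise variables, and D r bounds |s1 - s0| on block r. *)
Section shift_chain.
Context {R : realType} (n m nb : nat).
Hypotheses (n_gt0 : (0 < n)%N) (m_gt0 : (0 < m)%N).
Let k := (n * m)%N.
Let N := (nb * (4 * k))%N.
Let M := (4 * nb * m)%N.
Let k_gt0 : (0 < k)%N. Proof. by rewrite muln_gt0 n_gt0. Qed.
Let NM : N = (n * M)%N. Proof. by rewrite /N /M /k; lia. Qed.
Variables (rt : R) (rt_gt0 : 0 < rt) (rt_sqr : rt ^+ 2 = N%:R^-1).
Let sd (i : 'I_(N + n)) : R := if fintype.split i is inl _ then rt else 1.
Variable nu : probability ((N + n).-tuple R) R.
Hypothesis nuN : normal_law sd nu.

Definition entry K (j : nat) (v : K.-tuple R) : R := nth 0 v j.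
Let x : nat -> (N + n).-tuple R -> R := @entry (N + n).

Lemma measurable_entry K j : measurable_fun setT (@entry K j).
Proof.
have [jK|jK] := ltnP j K.
  rewrite (_ : entry j = (@tnth _ R)^~ (Ordinal jK)); first exact: measurable_tnth.
  by apply/funext => v; rewrite (tnth_nth 0).
rewrite (_ : entry j = cst 0); first exact: measurable_cst.
by apply/funext => v; rewrite /entry nth_default// size_tuple.
Qed.

Hypothesis lin : forall (P l : nat) (c : nat -> R), (P + l <= N)%N ->
  second_moment_le nu (fun v => \sum_(0 <= i < l) c i * x (P + i)%N v)
    ((\sum_(0 <= i < l) c i ^+ 2) / N%:R).
Variables (s0 s1 : nat -> R) (a b delta tau : R) (D : nat -> R).
Hypotheses (a_gt0 : 0 < a) (tau_gt0 : 0 < tau).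
Hypothesis s0_ab : forall j, (j < N)%N -> a <= s0 j <= b.
Hypothesis s1_ab : forall j, (j < N)%N -> a <= s1 j <= b.
Let d j := s1 j - s0 j.
Hypothesis dD : forall j, (j < N)%N -> `|d j| <= D (j %/ (4 * k)).
Hypotheses (D_ge0 : forall r, 0 <= D r) (D_le : forall r, D r <= delta).
Hypothesis delta_a : 64 * delta ^+ 2 <= a ^+ 2.
Variable lam : R.
Hypothesis lam_gt0 : 0 < lam.
Hypothesis cost_move : 128 / a ^+ 2 * \sum_(0 <= r < nb) D r ^+ 2 <= lam ^+ 2.
Hypothesis cost_noise : 128 * (1 + 512 * b ^+ 2 / a ^+ 2) * (k%:R / N%:R) ^+ 3 / tau ^+ 2 *
   \sum_(i < n) D ((M * i.+1) %/ (4 * k)) ^+ 2 <= lam ^+ 2.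

Let xs (v : (N + n).-tuple R) : nat -> R := x^~ v.

Definition signal_of (y : nat -> R) (s : nat -> R) (i : nat) : R :=
  \sum_(0 <= j < M * i.+1) (M * i.+1 - j)%N%:R / N%:R * (s j * y j).

Let obs (y : (N + n).-tuple R -> nat -> R) (s : nat -> R) v : n.-tuple R :=
  [tuple signal_of (y v) s i + tau * tnth v (rshift N i) | i < n].

(** [z] is the result of both moves; [yB] undergoes only the one of the first
    halves. *)
Let yA v j := xs v j + move_odd k s1 d (xs v) j.
Let yB v j := xs v j + move_even k s0 d (xs v) j.
Let z v j := yA v j + move_even k s0 d (yA v) j.

Let mx j : measurable_fun setT (fun v => xs v j).
Proof. exact: measurable_entry. Qed.

Let mkick s y j : (forall j, measurable_fun setT (fun v => y v j)) ->
  measurable_fun setT (fun v : (N + n).-tuple R => kick k s d (y v) j).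
Proof.
move=> my; apply: measurable_funM => //; apply: measurable_sum => i.
by apply: measurable_funM => //; apply: measurable_funM.
Qed.

Let mmove_odd y j : (forall j, measurable_fun setT (fun v => y v j)) ->
  measurable_fun setT (fun v : (N + n).-tuple R => move_odd k s1 d (y v) j).
Proof. by move=> my; rewrite /move_odd; case: (half_odd k j) => //; exact: mkick. Qed.

Let mmove_even y j : (forall j, measurable_fun setT (fun v => y v j)) ->
  measurable_fun setT (fun v : (N + n).-tuple R => move_even k s0 d (y v) j).
Proof. by move=> my; rewrite /move_even; case: (half_odd k j) => //; exact: mkick. Qed.

Let msignal y s i : (forall j, measurable_fun setT (fun v => y v j)) ->
  measurable_fun setT (fun v : (N + n).-tuple R => signal_of (y v) s i).
Proof.
move=> my; apply: measurable_sum => j; apply: measurable_funM => //.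
exact: measurable_funM.
Qed.

Let myA j : measurable_fun setT (fun v => yA v j).
Proof. by apply: measurable_funD => //; exact: mmove_odd. Qed.
Let myB j : measurable_fun setT (fun v => yB v j).
Proof. by apply: measurable_funD => //; exact: mmove_even. Qed.
Let mz j : measurable_fun setT (fun v => z v j).
Proof. by apply: measurable_funD => //; exact: mmove_even. Qed.

Let mobs y s : (forall j, measurable_fun setT (fun v => y v j)) ->
  measurable_fun setT (obs y s).
Proof.
move=> my; apply/measurable_fun_tnthP => i.
rewrite (_ : _ \o _ = fun v => signal_of (y v) s i + tau * tnth v (rshift N i)); last first.
  by apply/funext => v /=; rewrite tnth_mktuple.
apply: measurable_funD; first exact: msignal.
by apply: measurable_funM => //; exact: measurable_tnth.
Qed.

Let xs_shift (s : 'I_(N + n) -> R) v (j : nat) (jN : (j < N)%N) :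
  xs (tuple_shift s v) j = xs v j + s (lshift n (Ordinal jN)).
Proof.
have jNn : (j < N + n)%N by exact: ltn_addr.
rewrite /xs /x /entry -[j]/(nat_of_ord (Ordinal jNn)) -!tnth_nth tnth_mktuple.
by congr (_ + s _); exact/val_inj.
Qed.

Let Kle (i : 'I_n) : (M * i.+1 <= N)%N.
Proof. by rewrite NM mulnC leq_mul2r ltn_ord orbT. Qed.

Let signal_ext y y' s (i : 'I_n) : (forall j, (j < N)%N -> y j = y' j) ->
  signal_of y s i = signal_of y' s i.
Proof.
move=> h; apply: eq_big_nat => j /andP[_ jK]; rewrite h//.
exact: leq_trans (Kle i).
Qed.

Let kick_ext s y y' j : (j < N)%N ->
  (forall l, (l < N)%N -> half_odd k l = ~~ half_odd k j -> y l = y' l) ->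
  kick k s d y j = kick k s d y' j.
Proof.
move=> jN h; rewrite /kick; congr (_ * _).
apply: eq_big_nat => i /andP[_ ik]; congr (_ * (_ * _)).
have k2 : (0 < 2 * k)%N by rewrite muln_gt0.
pose c := (j %/ (2 * k))%N.
have cn : (c < nb.*2)%N by rewrite ltn_divLR// double_half_block.
rewrite /partner_start -/c /half_odd -/c.
have c'n := partner_lt_double cn; have oc := odd_partner c.
set c' := (if odd c then _ else _) in c'n oc *.
have [_ E _ _ _] := half_indexE k_gt0 c' ik.
apply: h; first by rewrite /N -double_half_block; exact: ltn_block.
by rewrite E oc.
Qed.

(** The coordinates that a shift moves: some of the increments, or the noise.
    *)
Let on_x (pr : nat -> bool) : pred 'I_(N + n) :=
  fun i => if fintype.split i is inl j then pr j else false.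
Let on_e : pred 'I_(N + n) := fun i => if fintype.split i is inr _ then true else false.

Let shx (mv : nat -> R) (i : 'I_(N + n)) : R := if fintype.split i is inl j then mv j else 0.
Let she (mv : 'I_n -> R) (i : 'I_(N + n)) : R := if fintype.split i is inr j then mv j else 0.

Let split_l (j : 'I_N) : fintype.split (lshift n j) = inl j.
Proof. exact: (unsplitK (inl j)). Qed.
Let split_r (j : 'I_n) : fintype.split (rshift N j) = inr j.
Proof. exact: (unsplitK (inr j)). Qed.

Let sum_block_index (phi : nat -> R) :
  \sum_(j < N) phi (j %/ (4 * k))%N = (4 * k)%:R * \sum_(0 <= r < nb) phi r.
Proof.
rewrite -(big_mkord xpredT (fun j => phi (j %/ (4 * k))%N)) /N.
have k4 : (0 < 4 * k)%N by rewrite muln_gt0.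
elim: nb => [|c IH]; first by rewrite mul0n !big_geq// mulr0.
rewrite mulSnr big_nat_addn IH big_nat_recr//= mulrDr; congr (_ + _).
rewrite -sum_nat_cst; apply: eq_big_nat => i /andP[_ i4].
by rewrite divnMDl// (divn_small i4) addn0.
Qed.

Let N_gt0 : (0 < nb)%N -> 0 < N%:R :> R.
Proof. by move=> nb0; rewrite ltr0n /N muln_gt0 nb0 muln_gt0. Qed.

(** Relative to the variance 1/N, each of the 2 k coordinates of a half block
    has a squared displacement of order D^2 / k, so that a block costs a
    multiple of D^2. *)
Let cost_x (mv : (N + n).-tuple R -> nat -> R) : (0 < nb)%N ->
  (forall c i0, (c < nb.*2)%N -> (i0 < 2 * k)%N ->
    second_moment_le nu (fun v => mv v (c * (2 * k) + i0)%N)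
       (32 * D c./2 ^+ 2 / (a ^+ 2 * k%:R) / N%:R)) ->
  (\int[nu]_v (\sum_(i < N + n) (shx (mv v) i / sd i) ^+ 2)%:E <= (lam ^+ 2)%:E)%E.
Proof.
move=> nb0 h.
apply: (@le_trans _ _ (\int[nu]_v (\sum_(j < N) (rt^-1 * mv v j) ^+ 2)%:E)%E).
  rewrite le_eqVlt; apply/orP; left; apply/eqP.
  apply: eq_integral => v _; congr (_%:E).
  rewrite big_split_ord/= [X in _ + X]big1 ?addr0; last first.
    by move=> j _; rewrite /shx split_r mul0r expr0n.
  by apply: eq_bigr => j _; rewrite /shx /sd split_l mulrC.
have k2 : (0 < 2 * k)%N by rewrite muln_gt0.
pose B (j : nat) := rt^-1 ^+ 2 * (32 * D (j %/ (4 * k)) ^+ 2 / (a ^+ 2 * k%:R) / N%:R).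
apply: le_trans (_ : (\sum_(j < N) B j)%:E <= _)%E.
  apply: integral_sum_sqr_le => j _; apply: second_moment_leZ.
  have E : (nat_of_ord j = j %/ (2 * k) * (2 * k) + j %% (2 * k))%N by exact: divn_eq.
  rewrite half_half_block {1}E; apply: h; last by rewrite ltn_mod.
  by rewrite ltn_divLR// double_half_block.
rewrite lee_fin; apply: le_trans cost_move.
rewrite /B (sum_block_index (fun r => rt^-1 ^+ 2 * (32 * D r ^+ 2 / (a ^+ 2 * k%:R) / N%:R))).
rewrite exprVn rt_sqr invrK mulr_sumr [leRHS]mulr_sumr le_eqVlt; apply/orP; left; apply/eqP.
apply: eq_bigr => r _; rewrite (natrM _ 4 k); field.
by rewrite !gt_eqF ?N_gt0 ?ltr0n.
Qed.

Variable f : n.-tuple R -> R.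
Hypotheses (mf : measurable_fun setT f) (f01 : forall y, 0 <= f y <= 1).

Let E (y : (N + n).-tuple R -> nat -> R) s : \bar R := (\int[nu]_v (f (obs y s v))%:E)%E.

Let sd_gt0 i : 0 < sd i.
Proof. by rewrite /sd; case: (fintype.split i). Qed.

Let obs_tuple_shx y s (mv : nat -> R) v :
  obs y s (tuple_shift (shx mv) v) =
  [tuple signal_of (y (tuple_shift (shx mv) v)) s i + tau * tnth v (rshift N i) | i < n].
Proof.
apply: eq_from_tnth => i; rewrite !tnth_mktuple /shx split_r addr0.
by [].
Qed.

Let xs_shx (mv : nat -> R) v j : (j < N)%N ->
  xs (tuple_shift (shx mv) v) j = xs v j + mv j.
Proof. by move=> jN; rewrite (xs_shift _ _ jN) /shx split_l. Qed.

Let tnth_l (v : (N + n).-tuple R) (j : nat) (jN : (j < N)%N) :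
  tnth v (lshift n (Ordinal jN)) = xs v j.
Proof. by rewrite (tnth_nth 0). Qed.

(** The shift of the first halves is determined by the second halves, which
    stay in place. *)
Let step_even : (0 < nb)%N -> (E yB s0 <= E xs s0 + (4 * lam)%:E)%E.
Proof.
move=> nb0.
have := @masked_shift_le R _ sd nu nuN sd_gt0 (on_x (fun j => ~~ half_odd k j))
  (fun v => shx (move_even k s0 d (xs v))) (fun v => f (obs xs s0 v)) lam.
have -> : (\int[nu]_v (f (obs xs s0 (tuple_shift (shx (move_even k s0 d (xs v))) v)))%:E =
    E yB s0)%E.
  apply: eq_integral => v _; rewrite obs_tuple_shx; congr ((f _)%:E).
  apply: eq_from_tnth => i; rewrite !tnth_mktuple; congr (_ + _).
  by apply: signal_ext => j jN; rewrite xs_shx.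
apply => //.
- move=> i; rewrite /shx; case: (fintype.split i) => // j; exact: mmove_even.
- move=> v i; rewrite /on_x /shx; case: (fintype.split i) => // j /negPn o.
  by rewrite /move_even o.
- move=> v v' h i; rewrite /shx; case: (fintype.split i) => // j; rewrite /move_even.
  case: ifP => // o; apply: kick_ext => // l lN; rewrite o /= => ol.
  rewrite -!tnth_l; apply: h.
  by rewrite /on_x split_l/= ol.
- by apply: (measurableT_comp mf); exact: mobs.
- apply: cost_x => // c i0 cn i0k.
  exact: (move_even_second_moment k_gt0 lin a_gt0 s0_ab dD D_ge0 delta_a cn i0k).
Qed.

(** Applied to the test that already contains the move of the first halves:
    shifting the second halves in it produces [z]. *)
Let step_odd : (0 < nb)%N -> (E z s0 <= E yB s0 + (4 * lam)%:E)%E.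
Proof.
move=> nb0.
have := @masked_shift_le R _ sd nu nuN sd_gt0 (on_x (half_odd k))
  (fun v => shx (move_odd k s1 d (xs v))) (fun v => f (obs yB s0 v)) lam.
have -> : (\int[nu]_v (f (obs yB s0 (tuple_shift (shx (move_odd k s1 d (xs v))) v)))%:E =
    E z s0)%E.
  apply: eq_integral => v _; rewrite obs_tuple_shx; congr ((f _)%:E).
  apply: eq_from_tnth => i; rewrite !tnth_mktuple; congr (_ + _).
  apply: signal_ext => j jN; rewrite /yB /z xs_shx//; congr (_ + _).
  rewrite /move_even; case: ifP => // _; apply: kick_ext => // l lN _.
  by rewrite xs_shx.
apply => //.
- move=> i; rewrite /shx; case: (fintype.split i) => // j; exact: mmove_odd.
- move=> v i; rewrite /on_x /shx; case: (fintype.split i) => // j /negbTE o.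
  by rewrite /move_odd o.
- move=> v v' h i; rewrite /shx; case: (fintype.split i) => // j; rewrite /move_odd.
  case: ifP => // o; apply: kick_ext => // l lN; rewrite o /= => ol.
  rewrite -!tnth_l; apply: h.
  by rewrite /on_x split_l/= ol.
- by apply: (measurableT_comp mf); exact: mobs.
- apply: cost_x => // c i0 cn i0k.
  exact: (move_odd_second_moment k_gt0 lin a_gt0 s1_ab dD D_ge0 delta_a cn i0k).
Qed.

(** The complete blocks cancel by [block_match], as the weight of an increment
    is affine up to the observation time. *)
Let signal_residual v (i : 'I_n) : let K := (M * i.+1)%N in
  signal_of (z v) s0 i - signal_of (xs v) s1 i =
  \sum_(0 <= l < K %% (4 * k)) (K %% (4 * k) - l)%N%:R / N%:R *
     (s0 (K %/ (4 * k) * (4 * k) + l)%N * z v (K %/ (4 * k) * (4 * k) + l)%N -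
      s1 (K %/ (4 * k) * (4 * k) + l)%N * xs v (K %/ (4 * k) * (4 * k) + l)%N).
Proof.
move=> K.
rewrite /signal_of -/K -sumrB.
under eq_bigr do rewrite -mulrBr.
have KN : (K <= N)%N by exact: Kle.
set r := (K %/ (4 * k))%N; set rho := (K %% (4 * k))%N.
have EK : K = (r * (4 * k) + rho)%N by exact: divn_eq.
rewrite {1}EK big_nat_addn [X in X + _](_ : _ = 0) ?add0r; last first.
  have : (r * (4 * k) <= K)%N by rewrite EK leq_addr.
  elim: r {EK} => [|r IH] rK; first by rewrite mul0n big_geq.
  have rK' : (r * (4 * k) + 4 * k <= K)%N by rewrite -mulSnr.
  have jK i0 : (i0 < 4 * k)%N -> (r * (4 * k) + i0 < K)%N.
    by move=> i04; apply: leq_trans rK'; rewrite ltn_add2l.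
  rewrite mulSnr big_nat_addn IH ?add0r; last exact: leq_trans (leq_addr _ _) rK'.
  have jN i0 : (i0 < 4 * k)%N -> (r * (4 * k) + i0 < N)%N.
    by move=> i04; exact: leq_trans (jK _ i04) KN.
  have := @block_match R k k_gt0 s0 s1 (xs v) K%:R r _ _.
  rewrite /= -/d => H.
  have {}H := H _ _.
  transitivity (N%:R^-1 * \sum_(0 <= i0 < 4 * k)
     (s0 (r * (4 * k) + i0)%N * z v (r * (4 * k) + i0)%N -
      s1 (r * (4 * k) + i0)%N * xs v (r * (4 * k) + i0)%N) *
      (K%:R - (r * (4 * k) + i0)%:R)).
    rewrite mulr_sumr; apply: eq_big_nat => i0 /andP[_ i04].
    rewrite natrB; last exact/ltnW/jK.
    by ring.
  rewrite H ?mulr0// => i0 i04; rewrite gt_eqF//.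
    by have /andP[h _] := s0_ab (jN _ i04); exact: lt_le_trans h.
  by have /andP[h _] := s1_ab (jN _ i04); exact: lt_le_trans h.
by apply: eq_bigr => l _; rewrite {1}EK subnDl.
Qed.

(** The noise compensates the residual, which is a function of the increments.
    *)
Let step_noise : (0 < nb)%N -> (E xs s1 <= E z s0 + (4 * lam)%:E)%E.
Proof.
move=> nb0.
pose mv v (i : 'I_n) := - tau^-1 * (signal_of (z v) s0 i - signal_of (xs v) s1 i).
have := @masked_shift_le R _ sd nu nuN sd_gt0 on_e
  (fun v => she (mv v)) (fun v => f (obs z s0 v)) lam.
have xs_she u v j : (j < N)%N -> xs (tuple_shift (she u) v) j = xs v j.
  by move=> jN; rewrite (xs_shift _ _ jN) /she split_l addr0.
have yA_she u v j : (j < N)%N -> yA (tuple_shift (she u) v) j = yA v j.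
  move=> jN; rewrite /yA xs_she//; congr (_ + _); rewrite /move_odd.
  by case: ifP => // _; apply: kick_ext => // l lN _; exact: xs_she.
have z_she u v j : (j < N)%N -> z (tuple_shift (she u) v) j = z v j.
  move=> jN; rewrite /z yA_she//; congr (_ + _); rewrite /move_even.
  by case: ifP => // _; apply: kick_ext => // l lN _; exact: yA_she.
have -> : (\int[nu]_v (f (obs z s0 (tuple_shift (she (mv v)) v)))%:E = E xs s1)%E.
  apply: eq_integral => v _; congr ((f _)%:E).
  apply: eq_from_tnth => i; rewrite !tnth_mktuple.
  rewrite (signal_ext (y' := z v)); last by move=> j jN; exact: z_she.
  rewrite /she split_r /mv; field; by rewrite gt_eqF.
apply => //.
- move=> i; rewrite /she; case: (fintype.split i) => // j; rewrite /mv.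
  by apply: measurable_funM => //; apply: measurable_funB; exact: msignal.
- by move=> v i; rewrite /on_e /she; case: (fintype.split i).
- move=> v v' h i; rewrite /she; case: (fintype.split i) => // j; rewrite /mv.
  have xv l : (l < N)%N -> xs v l = xs v' l.
    by move=> lN; rewrite -!tnth_l; apply: h; rewrite /on_e split_l.
  have yv l : (l < N)%N -> yA v l = yA v' l.
    move=> lN; rewrite /yA xv//; congr (_ + _); rewrite /move_odd.
    by case: ifP => // _; apply: kick_ext => // l' lN' _; exact: xv.
  have zv l : (l < N)%N -> z v l = z v' l.
    move=> lN; rewrite /z yv//; congr (_ + _); rewrite /move_even.
    by case: ifP => // _; apply: kick_ext => // l' lN' _; exact: yv.
  by rewrite (signal_ext _ _ zv) (signal_ext _ _ xv).
- by apply: (measurableT_comp mf); exact: mobs.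
apply: (@le_trans _ _ (\int[nu]_v (\sum_(i < n) (mv v i) ^+ 2)%:E)%E).
  rewrite le_eqVlt; apply/orP; left; apply/eqP.
  apply: eq_integral => v _; congr (_%:E).
  rewrite big_split_ord/= [X in X + _]big1 ?add0r; last first.
    by move=> j _; rewrite /she split_l mul0r expr0n.
  by apply: eq_bigr => j _; rewrite /she /sd split_r divr1.
pose C := 128 * (1 + 512 * b ^+ 2 / a ^+ 2).
have C0 : 0 <= C by exact: noise_constant_ge0.
pose B (i : 'I_n) := (- tau^-1) ^+ 2 *
  (C * D ((M * i.+1) %/ (4 * k)) ^+ 2 * (k%:R / N%:R) ^+ 3).
apply: le_trans (_ : (\sum_(i < n) B i)%:E <= _)%E.
  apply: integral_sum_sqr_le => i _; apply: second_moment_leZ.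
  apply: (eq_second_moment_le (fun v => esym (signal_residual v i))).
  set K := (M * i.+1)%N.
  have [rn|nr] := ltnP (K %/ (4 * k)) nb.
    have := @residual_second_moment R _ _ nu k nb x k_gt0 lin s0 s1 a b delta D
      a_gt0 s0_ab s1_ab dD D_ge0 D_le delta_a (K %/ (4 * k)) (K %% (4 * k)) rn.
    move=> h; rewrite /C; apply: (eq_second_moment_le _ (h _)); last first.
      by apply/ltnW; rewrite ltn_mod muln_gt0.
    move=> v; apply: eq_bigr => l _.
    by rewrite /z /yA addrA.
  have -> : (K %% (4 * k) = 0)%N.
    have h1 := Kle i; rewrite -/K in h1.
    have h2 : (nb * (4 * k) <= K)%N by rewrite -leq_divRL// muln_gt0.
    have -> : K = (nb * (4 * k))%N by apply/eqP; rewrite eqn_leq h1 h2.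
    by rewrite modnMl.
  apply: (eq_second_moment_le (phi := cst 0)).
    by move=> v; rewrite big_geq.
  split; first exact: measurable_cst.
  under eq_integral do rewrite expr0n.
  rewrite integral0 lee_fin; apply: mulr_ge0; last exact/exprn_ge0/divr_ge0.
  by apply: mulr_ge0 C0 _; exact: sqr_ge0.
rewrite lee_fin; apply: le_trans cost_noise; rewrite /B mulr_sumr.
rewrite le_eqVlt; apply/orP; left; apply/eqP; apply: eq_bigr => i _.
by rewrite /C sqrrN exprVn; ring.
Qed.

(** From s1 with the original increments to s0 with the moved ones, and back
    to the original increments one move at a time. *)
Lemma shift_chain : (0 < nb)%N -> (E xs s1 <= E xs s0 + (12 * lam)%:E)%E.
Proof.
move=> nb0.
apply: (le_trans (step_noise nb0)).
have h : (E z s0 <= E xs s0 + (8 * lam)%:E)%E.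
  apply: (le_trans (step_odd nb0)).
  have -> : (8 * lam)%:E = ((4 * lam)%:E + (4 * lam)%:E)%E :> \bar R.
    by rewrite -EFinD; congr (_%:E); ring.
  by rewrite addeA; apply: leeD2r; exact: step_even.
have -> : (12 * lam)%:E = ((8 * lam)%:E + (4 * lam)%:E)%E :> \bar R.
  by rewrite -EFinD; congr (_%:E); ring.
by rewrite addeA; exact: leeD2r.
Qed.

End shift_chain.

(** * Joint law of the grid increments and the noise *)

(** Distinct cells of the grid are disjoint, so that their covariances vanish.
    *)
Lemma step_form_grid (R : realType) (N Q l : nat) (c : nat -> R) : (0 < N)%N ->
  step_form [seq ((Q + i)%N%:R / N%:R, (Q + i).+1%:R / N%:R, c i) | i <- index_iota 0 l] =
  (\sum_(0 <= i < l) c i ^+ 2) / N%:R.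
Proof.
move=> N0; have N0' : 0 < N%:R :> R by rewrite ltr0n.
rewrite /step_form big_map mulr_suml; apply: eq_big_seq => i il.
rewrite big_map (bigD1_seq i) ?iota_uniq//= big1 ?addr0.
  rewrite /increment_cov/= -natr1; set p := (Q + i)%:R.
  have -> : (p + 1) / N%:R - p / N%:R = N%:R^-1 by field; rewrite gt_eqF.
  have -> : p / N%:R - (p + 1) / N%:R = - N%:R^-1 by field; rewrite gt_eqF.
  rewrite !subrr normr0 !subr0 normrN gtr0_norm ?invr_gt0//.
  by field; rewrite gt_eqF.
move=> j ji; rewrite /increment_cov/=.
suff -> : `|(Q + i).+1%:R / N%:R - (Q + j)%N%:R / N%:R| +
   `|(Q + i)%N%:R / N%:R - (Q + j).+1%:R / N%:R| =
   `|(Q + i).+1%:R / N%:R - (Q + j).+1%:R / N%:R| +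
   `|(Q + i)%N%:R / N%:R - (Q + j)%N%:R / N%:R| :> R.
  by rewrite -addrA -opprD subrr mul0r mulr0.
rewrite -!mulrBl !normrM -!mulrDl; congr (_ * _).
rewrite -!natr1 !natrD.
have [h|h|h] := ltngtP i j; last by rewrite h eqxx in ji.
  have h' : i%:R + 1 <= j%:R :> R by rewrite natr1 ler_nat.
  rewrite !ler0_norm; lra.
have h' : j%:R + 1 <= i%:R :> R by rewrite natr1 ler_nat.
rewrite !ger0_norm; lra.
Qed.

Section grid_law.
Context {R : realType} d (T : measurableType d) (P : probability T R).
Variables (W : R -> {RV P >-> R}) (eps : forall n : nat, 'I_n -> {RV P >-> R}).

Definition grid_noise N n (w : T) : (N + n).-tuple R :=
  [tuple match fintype.split i with
         | inl j => grid_increment W N j w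
         | inr j => eps j w
         end | i < N + n].

Lemma measurable_grid_noise N n : measurable_fun setT (grid_noise N n).
Proof.
apply/measurable_fun_tnthP => i.
rewrite (_ : _ \o _ = fun w => match fintype.split i with
         | inl j => grid_increment W N j w | inr j => eps j w end); last first.
  by apply/funext => w /=; rewrite tnth_mktuple.
case: (fintype.split i) => j; first exact: measurable_grid_increment.
exact: measurable_funP.
Qed.

(** The events generated by a process are the measurable sets of a type, for
    which the closure properties of measurable functions are available. *)
Lemma generated_byP (I : Type) (D : set I) (Z : I -> T -> R) :
  generated_by D Z =
  @measurable _ (g_sigma_algebraType (\bigcup_(i in D) preimage_set_system setT (Z i) measurable)).
Proof. by []. Qed.

Lemma measurable_generated (I : Type) (D : set I) (Z : I -> T -> R) i : D i ->
  @measurable_fun _ _ (g_sigma_algebraType (\bigcup_(i in D) preimage_set_system setT (Z i) measurable)) _ setT (Z i).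
Proof.
move=> Di _ A mA; apply: sub_sigma_algebra; exists i => //.
by exists A.
Qed.

Hypothesis noise : noise_model W eps.

Let grid_time (N j : nat) : R := j%:R / N%:R.

Let grid_time01 N j : (0 < N)%N -> (j <= N)%N -> grid_time N j \in `[0, 1].
Proof. exact: itv01_ratio. Qed.

Let grid_event N (A : 'I_N -> set R) :=
  \bigcap_(i in [set: 'I_N]) ((W (grid_time N i.+1) \- W (grid_time N i)) @^-1` A i).

Let grid_event_generated N (A : 'I_N -> set R) : (0 < N)%N ->
  (forall i, measurable (A i)) -> generated_by `[0, 1] W (grid_event A).
Proof.
move=> N0 mA; rewrite generated_byP.
apply: fin_bigcap_measurable; first exact: finite_finset.
move=> i _; rewrite -[X in measurable X]setTI.
by apply: measurable_funB => //; apply: measurable_generated; apply: grid_time01 => //; exact/ltnW.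
Qed.

Let grid_event_prob N (A : 'I_N -> set R) : (0 < N)%N ->
  (forall i, measurable (A i)) ->
  P (grid_event A) = (\prod_(i < N) normal_prob 0 (Num.sqrt N%:R^-1) (A i))%E.
Proof.
move=> N0 mA; have N0' : 0 < N%:R :> R by rewrite ltr0n.
case: noise => -[_ indep law _] _.
have t01 i : (i <= N)%N -> grid_time N i \in `[0, 1] by exact: grid_time01.
rewrite /grid_event (indep N (grid_time N) t01)//; last first.
  by move=> i iN; rewrite ler_pM2r ?invr_gt0// ler_nat.
apply: eq_bigr => i _.
have dt : grid_time N i.+1 - grid_time N i = N%:R^-1.
  by rewrite /grid_time -mulrBl -natr1 addrAC subrr add0r mul1r.
have := t01 i (ltnW (ltn_ord i)); have := t01 i.+1 (ltn_ord i).
rewrite !in_itv/= => /andP[_ h1] /andP[h0 _].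
have := @law _ _ h0 _ h1 (A i) (mA i); rewrite dt; apply.
by rewrite -subr_gt0 dt invr_gt0.
Qed.

(** A box is the intersection of an event generated by W and one generated by
    the noise, and each of them factorises over its coordinates. *)
Lemma grid_noise_law N n : (0 < N)%N ->
  normal_law (fun i : 'I_(N + n) => if fintype.split i is inl _ then Num.sqrt N%:R^-1 else 1)
    (distribution P (mk_mfun (@measurable_grid_noise N n))).
Proof.
move=> N0 A mA.
rewrite big_split_ord/=.
under eq_bigr => j _ do rewrite (unsplitK (inl j)).
under [X in (_ * X)%E]eq_bigr => j _ do rewrite (unsplitK (inr j)).
have [_ /(_ n)[indep law ind]] := noise.
pose B := \bigcap_(i in [set: 'I_n]) (eps i @^-1` A (rshift N i)).
have -> : distribution P (mk_mfun (@measurable_grid_noise N n)) (tuple_box A) =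
    P (grid_event (fun i => A (lshift n i)) `&` B).
  congr (P _); apply/seteqP; split => w /=.
    move=> h; split => i _ /=.
      have := h (lshift n i); rewrite tnth_mktuple (unsplitK (inl i)); exact.
    by have := h (rshift N i); rewrite tnth_mktuple (unsplitK (inr i)).
  move=> [h1 h2] i; rewrite tnth_mktuple.
  rewrite -[i in A i]splitK; case: (fintype.split i) => j /=.
    exact: h1.
  exact: h2.
rewrite ind; last 2 first.
- exact: grid_event_generated.
- rewrite generated_byP; apply: fin_bigcap_measurable; first exact: finite_finset.
  move=> i _; rewrite -[X in measurable X]setTI.
  by apply: measurable_generated.
rewrite grid_event_prob//; congr (_ * _)%E.
rewrite /B indep//; apply: eq_bigr => i _.
exact: (law i _ (mA _)).
Qed.

(** A combination of grid increments is the integral of a step function. *)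
Lemma grid_noise_linear N n Q l (c : nat -> R) : (0 < N)%N -> (Q + l <= N)%N ->
  second_moment_le (distribution P (mk_mfun (@measurable_grid_noise N n)))
    (fun v => \sum_(0 <= i < l) c i * entry (Q + i) v)
    ((\sum_(0 <= i < l) c i ^+ 2) / N%:R).
Proof.
move=> N0 QlN; set phi := fun v => _.
have mphi : measurable_fun setT phi.
  apply: measurable_sum => i; apply: measurable_funM => //; exact: measurable_entry.
split => //.
rewrite ge0_integral_distribution//; last first.
- by move=> v; rewrite lee_fin sqr_ge0.
- by apply/measurable_EFinP; exact: measurable_funX.
pose s : seq (R * R * R) := [seq ((Q + i)%N%:R / N%:R, (Q + i).+1%:R / N%:R, c i) | i <- index_iota 0 l].
have [bmW _] := noise.
have s01 : within01 s.
  move=> q /mapP[i]; rewrite mem_index_iota => /andP[_ il] ->/=.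
  by split; apply: grid_time01 => //; lia.
rewrite -(step_form_grid Q l c N0) -(step_integral_isometry bmW s01).
rewrite le_eqVlt; apply/orP; left; apply/eqP; apply: eq_integral => w _.
congr ((_ ^+ 2)%:E); rewrite /step_integral big_map; apply: eq_big_nat => i /andP[_ il].
congr (_ * _).
have QN : (Q + i < N)%N by lia.
rewrite /entry -[(Q + i)%N]/(nat_of_ord (lshift n (Ordinal QN))) -tnth_nth tnth_mktuple.
by rewrite (unsplitK (inl _)).
Qed.

End grid_law.

(** * Two volatilities that differ on one cell *)

Lemma sum_indicator_le (R : realType) (n c L : nat) (S : pred nat) (y : R) : 0 <= y ->
  (forall i, (i < n)%N -> S i -> (c <= i < c + L)%N) ->
  \sum_(0 <= i < n) (if S i then y else 0) <= L%:R * y.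
Proof.
move=> y0 h; rewrite -big_mkcond/= big_const_seq iter_addr_0 -[leLHS]mulr_natl.
rewrite ler_wpM2r// ler_nat -size_filter -[leqRHS](size_iota c L).
apply: uniq_leq_size; first by rewrite filter_uniq// iota_uniq.
move=> i; rewrite mem_filter mem_index_iota mem_iota => /andP[Si /andP[_ ni]].
exact: h.
Qed.

Lemma sampling_in_cell (n p k0 i : nat) : (0 < n)%N -> (0 < p)%N ->
  ((p * i.+1) %/ n = k0)%N ->
  (((n * k0) %/ p).-1 <= i < ((n * k0) %/ p).-1 + (n %/ p + 2))%N.
Proof.
move=> n0 p0 E.
have h1 : (k0 * n <= p * i.+1)%N by rewrite -leq_divRL// E.
have h2 : (p * i.+1 < k0.+1 * n)%N by rewrite -ltn_divLR// E.
have h3 : ((n * k0) %/ p <= i.+1)%N.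
  by rewrite -[leqRHS](mulKn _ p0) leq_div2r// mulnC.
have h4 : (i.+1 < (n * k0) %/ p + (n %/ p + 2))%N.
  rewrite -(ltn_pmul2l p0); apply: (leq_trans h2).
  have a1 := ltn_ceil (n * k0) p0; have b1 := ltn_ceil n p0.
  move: a1 b1; set A := (_ %/ _)%N; set B := (n %/ p)%N => a1 b1.
  have -> : (p * (A + (B + 2)) = A.+1 * p + B.+1 * p)%N by lia.
  by rewrite mulSn addnC mulnC; exact/ltnW/(leq_add a1)/ltnW.
lia.
Qed.

Lemma cell_samples_le (n p : nat) (R : realType) : (0 < p)%N -> (p <= n)%N ->
  (n %/ p + 2)%N%:R <= 3 * (n%:R / p%:R) :> R.
Proof.
move=> p0 pn; have p0' : 0 < p%:R :> R by rewrite ltr0n.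
rewrite mulrA ler_pdivlMr// -!natrM ler_nat.
have := divn_eq n p; set B := (n %/ p)%N => h.
rewrite mulnDl; lia.
Qed.

Lemma grid_size n p q m : (n * (4 * (p * q) * m) = p * q * (4 * (n * m)))%N.
Proof. by lia. Qed.

Lemma grid_cell_size c n p q m :
  (c * (p * q * (4 * (n * m))) = p * (c * (4 * (n * m) * q)))%N.
Proof. by lia. Qed.

(** A test that is the indicator of A off E measures A up to the probability
    of E. *)
Lemma test_set_le {R : realType} d (T : measurableType d) (P : probability T R)
    n (Y : T -> n.-tuple R) (A E : set (n.-tuple R)) (f : n.-tuple R -> R) :
  measurable_fun setT Y -> measurable A -> measurable E ->
  measurable_fun setT f -> (forall y : n.-tuple R, 0 <= f y <= 1) ->
  (forall y, ~ E y -> f y = \1_A y) ->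
  (P (Y @^-1` A) <= \int[P]_w (f (Y w))%:E + P (Y @^-1` E))%E /\
  (\int[P]_w (f (Y w))%:E <= P (Y @^-1` A) + P (Y @^-1` E))%E.
Proof.
move=> mY mA mE mf f01 fA.
have mpre B : measurable B -> measurable (Y @^-1` B).
  by move=> mB; rewrite -[X in measurable X]setTI; exact: mY.
have PE B : measurable B -> P (Y @^-1` B) = (\int[P]_w (\1_B (Y w))%:E)%E.
  by move=> mB; rewrite -[X in P X]setIT -integral_indic//; exact: mpre.
have mi B : measurable B -> measurable_fun setT (fun w => (\1_B (Y w) : R)%:E).
  move=> mB; apply/measurable_EFinP; apply: measurableT_comp mY.
  exact: measurable_indic.
have mfY : measurable_fun setT (fun w => (f (Y w))%:E).
  by apply/measurable_EFinP; exact: measurableT_comp mY.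
have f0 y : 0 <= f y by case/andP: (f01 y).
have i0 B y : (0 <= (\1_B y : R)%:E)%E by rewrite lee_fin indicE ler0n.
rewrite !PE//; split.
  rewrite -ge0_integralD//; [|by move=> w _; rewrite lee_fin|exact: mi].
  apply: ge0_le_integral => //.
  - exact: mi.
  - by apply: emeasurable_funD => //; exact: mi.
  move=> w _; rewrite -EFinD lee_fin.
  have [Ew|nEw] := pselect (E (Y w)).
    rewrite [X in _ <= _ + X]indicE mem_set// [leLHS]indicE.
    have := f0 (Y w); case: (_ \in A) => /= h; lra.
  by rewrite fA// lerDl -lee_fin.
rewrite -ge0_integralD//; [|exact: mi|exact: mi].
apply: ge0_le_integral => //.
- by move=> w _; rewrite lee_fin.
- by apply: emeasurable_funD; exact: mi.
move=> w _; rewrite -EFinD lee_fin.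
have [Ew|nEw] := pselect (E (Y w)).
  rewrite [X in _ <= _ + X]indicE mem_set//.
  have /andP[_ f1] := f01 (Y w); apply: (le_trans f1).
  by rewrite lerDr -lee_fin.
by rewrite fA// lerDl -lee_fin.
Qed.

(** p cells of q blocks each. The blocks of the cell k0 are those with r / q =
    k0, and only they contribute to the costs. *)
Section two_point.
Context {R : realType} d (T : measurableType d) (P : probability T R).
Variables (W : R -> {RV P >-> R}) (eps : forall n : nat, 'I_n -> {RV P >-> R}).
Hypothesis noise : noise_model W eps.
Variables (sigma0 sigma1 : R -> R) (a b delta tau : R) (n p q k0 : nat).
Hypotheses (a_gt0 : 0 < a) (tau_gt0 : 0 < tau) (delta_ge0 : 0 <= delta).
Hypotheses (n_gt0 : (0 < n)%N) (p_gt0 : (0 < p)%N) (q_gt0 : (0 < q)%N).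
Hypotheses (pn : (p <= n)%N) (n_le : (n <= (p * q) ^ 4)%N).
Hypothesis sigma0_ab : forall x, x \in `[0, 1] -> a <= sigma0 x <= b.
Hypothesis sigma1_ab : forall x, x \in `[0, 1] -> a <= sigma1 x <= b.
Hypothesis sigma_close : forall x, x \in `[0, 1] -> `|sigma1 x - sigma0 x| <= delta.
Hypothesis sigma_eq : forall x, 0 <= x < 1 ->
  ~~ (k0%:R <= p%:R * x < k0%:R + 1) -> sigma1 x = sigma0 x.
Variable lam : R.
Hypotheses (lam_gt0 : 0 < lam) (lam_le1 : lam <= 1).
Hypothesis close : (128 / a ^+ 2 + 6 * (1 + 512 * b ^+ 2 / a ^+ 2) / tau ^+ 2) *
  (delta ^+ 2 * q%:R) <= lam ^+ 2.

Let D (r : nat) := if (r %/ q == k0)%N then delta else 0.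

Let sum_blocks : \sum_(0 <= r < p * q) D r ^+ 2 <= q%:R * delta ^+ 2.
Proof.
have -> : \sum_(0 <= r < p * q) D r ^+ 2 =
    \sum_(0 <= r < p * q) (if (r %/ q == k0)%N then delta ^+ 2 else 0).
  by apply: eq_bigr => r _; rewrite /D; case: ifP => //; rewrite expr0n.
apply: (@sum_indicator_le _ _ (k0 * q)); first exact: sqr_ge0.
move=> r _ /eqP <-; have := divn_eq r q; have := ltn_pmod r q_gt0; lia.
Qed.

Let sum_samples m : (0 < m)%N ->
  \sum_(i < n) D ((4 * (p * q) * m * i.+1) %/ (4 * (n * m))) ^+ 2 <=
  3 * (n%:R / p%:R) * delta ^+ 2.
Proof.
move=> m0.
have -> : \sum_(i < n) D ((4 * (p * q) * m * i.+1) %/ (4 * (n * m))) ^+ 2 =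
    \sum_(0 <= i < n) (if ((p * i.+1) %/ n == k0)%N then delta ^+ 2 else 0).
  rewrite big_mkord; apply: eq_bigr => i _; rewrite /D.
  have -> : ((4 * (p * q) * m * i.+1) %/ (4 * (n * m)) %/ q = (p * i.+1) %/ n)%N.
    rewrite -divnMA.
    have -> : (4 * (p * q) * m * i.+1 = p * i.+1 * (4 * m * q))%N by lia.
    have -> : (4 * (n * m) * q = n * (4 * m * q))%N by lia.
    by rewrite divnMr// !muln_gt0 m0 q_gt0.
  by case: ifP => //; rewrite expr0n.
apply: (@le_trans _ _ ((n %/ p + 2)%N%:R * delta ^+ 2)).
  apply: sum_indicator_le; first exact: sqr_ge0.
  by move=> i _ /eqP; exact: sampling_in_cell.
by rewrite ler_wpM2r ?sqr_ge0// cell_samples_le.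
Qed.

Let Q := delta ^+ 2 * q%:R.

Let Q_ge0 : 0 <= Q. Proof. by rewrite mulr_ge0// sqr_ge0. Qed.

Let u := (b / a) ^+ 2.
Let noise_factor := 1 + 512 * b ^+ 2 / a ^+ 2.

Let noise_factorE : noise_factor = 1 + 512 * u.
Proof. by rewrite /noise_factor /u expr_div_n -mulrA. Qed.

Let noise_factor_ge0 : 0 <= noise_factor.
Proof. rewrite noise_factorE; have : 0 <= u by exact: sqr_ge0. lra. Qed.

Let closeP : 128 / a ^+ 2 * Q <= lam ^+ 2 /\ 6 * noise_factor / tau ^+ 2 * Q <= lam ^+ 2.
Proof.
have A0 : 0 <= 128 / a ^+ 2 * Q.
  by rewrite mulr_ge0// mulr_ge0 ?invr_ge0 ?sqr_ge0// (ler0n _ 128).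
have B0 : 0 <= 6 * noise_factor / tau ^+ 2 * Q.
  rewrite mulr_ge0// mulr_ge0 ?invr_ge0 ?sqr_ge0//.
  exact: (mulr_ge0 (ler0n _ 6) noise_factor_ge0).
move: close; rewrite -/Q -/noise_factor mulrDl => h.
by split; [apply: le_trans h; rewrite lerDl|apply: le_trans h; rewrite lerDr].
Qed.

Let grid_two_point m (f : n.-tuple R -> R) : (0 < m)%N -> measurable_fun setT f -> (forall y, 0 <= f y <= 1) ->
  (\int[P]_w (f (grid_observations W sigma1 eps tau n (4 * (p * q) * m) w))%:E <=
   \int[P]_w (f (grid_observations W sigma0 eps tau n (4 * (p * q) * m) w))%:E +
   (12 * lam)%:E)%E.
Proof.
move=> m0 mf f01.
pose N := (p * q * (4 * (n * m)))%N.
have N0 : (0 < N)%N by rewrite !muln_gt0 p_gt0 q_gt0 n_gt0 m0.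
have N0' : 0 < N%:R :> R by rewrite ltr0n.
have NM : (n * (4 * (p * q) * m) = N)%N by exact: grid_size.
pose nu := distribution P (mk_mfun (@measurable_grid_noise _ _ _ _ W eps N n)).
have rt0 : 0 < Num.sqrt (N%:R^-1 : R) by rewrite sqrtr_gt0 invr_gt0.
have rt2 : Num.sqrt (N%:R^-1 : R) ^+ 2 = N%:R^-1 by rewrite sqr_sqrtr// invr_ge0.
have lin := fun P0 l c => @grid_noise_linear _ _ _ _ W eps noise N n P0 l c N0.
have pq0 : (0 < p * q)%N by rewrite muln_gt0 p_gt0.
pose s0 (j : nat) := sigma0 (j%:R / N%:R); pose s1 (j : nat) := sigma1 (j%:R / N%:R).
have point j : (j < N)%N -> j%:R / N%:R \in `[(0 : R), 1].
  by move=> jN; apply: itv01_ratio => //; exact: ltnW.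
have s0_ab j : (j < N)%N -> a <= s0 j <= b by move=> jN; exact/sigma0_ab/point.
have s1_ab j : (j < N)%N -> a <= s1 j <= b by move=> jN; exact/sigma1_ab/point.
have dD j : (j < N)%N -> `|s1 j - s0 j| <= D (j %/ (4 * (n * m))).
  move=> jN; rewrite /D; case: ifPn => [_|E]; first exact/sigma_close/point.
  rewrite /s1 sigma_eq ?subrr ?normr0//.
    by rewrite divr_ge0//= ltr_pdivrMr// mul1r ltr_nat.
  apply: contra E => /andP[h1 h2]; rewrite -divnMA.
  have w0 : (0 < 4 * (n * m) * q)%N by rewrite !muln_gt0 n_gt0 m0 q_gt0.
  rewrite eqn_leq; apply/andP; split.
    rewrite -ltnS ltn_divLR//.
    move: h2; rewrite mulrA ltr_pdivrMr// natr1 -!natrM ltr_nat /N => h2.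
    have : (p * j < p * (k0.+1 * (4 * (n * m) * q)))%N by rewrite -grid_cell_size.
    by rewrite ltn_pmul2l.
  rewrite leq_divRL//.
  move: h1; rewrite mulrA ler_pdivlMr// -!natrM ler_nat /N => h1.
  have : (p * (k0 * (4 * (n * m) * q)) <= p * j)%N by rewrite -grid_cell_size.
  by rewrite leq_pmul2l.
have D_ge0 r : 0 <= D r by rewrite /D; case: ifP.
have D_le r : D r <= delta by rewrite /D; case: ifP.
have [c1 c2] := closeP.
have a2 : 0 < a ^+ 2 by rewrite exprn_gt0.
have dQ : delta ^+ 2 <= Q.
  by rewrite /Q ler_peMr ?sqr_ge0// ler1n.
have delta_a : 64 * delta ^+ 2 <= a ^+ 2.
  have : 128 / a ^+ 2 * Q <= 1 by apply: (le_trans c1); rewrite expr_le1// ltW.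
  rewrite mulrAC ler_pdivrMr// mul1r => h; lra.
have cost_move : 128 / a ^+ 2 * (\sum_(0 <= r < p * q) D r ^+ 2) <= lam ^+ 2.
  apply: le_trans c1; apply: ler_wpM2l; last by rewrite /Q mulrC.
  by rewrite mulr_ge0 ?invr_ge0 ?sqr_ge0// (ler0n _ 128).
have cost_noise : 128 * (1 + 512 * b ^+ 2 / a ^+ 2) * ((n * m)%:R / N%:R) ^+ 3 / tau ^+ 2 *
    (\sum_(i < n) D ((4 * (p * q) * m * i.+1) %/ (4 * (n * m))) ^+ 2) <= lam ^+ 2.
  rewrite -/noise_factor.
  apply: le_trans c2; apply: le_trans (_ : _ <= 128 * noise_factor * ((n * m)%:R / N%:R) ^+ 3 /
     tau ^+ 2 * (3 * (n%:R / p%:R) * delta ^+ 2)) _.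
    apply: ler_wpM2l (sum_samples m0).
    apply: mulr_ge0; last by rewrite invr_ge0 sqr_ge0.
    apply: mulr_ge0; first exact: (mulr_ge0 (ler0n _ 128) noise_factor_ge0).
    exact/exprn_ge0/divr_ge0.
  have kN : (n * m)%:R / N%:R = (4 * (p%:R * q%:R))^-1 :> R.
    rewrite /N (natrM _ (p * q)) (natrM _ 4) (natrM _ p q); field.
    by rewrite !pnatr_eq0 -!lt0n n_gt0 m0 p_gt0 q_gt0.
  rewrite kN.
  have nle : n%:R <= (p%:R * q%:R) ^+ 4 :> R by rewrite -natrM -natrX ler_nat.
  have pq4 : 0 < (p%:R * q%:R) ^+ 4 :> R by rewrite exprn_gt0// mulr_gt0 ?ltr0n.
  have -> : 128 * noise_factor * (4 * (p%:R * q%:R))^-1 ^+ 3 / tau ^+ 2 *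
       (3 * (n%:R / p%:R) * delta ^+ 2) =
      6 * noise_factor / tau ^+ 2 * Q * (n%:R / (p%:R * q%:R) ^+ 4).
    rewrite /Q; field.
    by rewrite (gt_eqF tau_gt0) !pnatr_eq0 -!lt0n p_gt0 q_gt0.
  apply: ler_piMr; last by rewrite ler_pdivrMr// mul1r.
  rewrite mulr_ge0// mulr_ge0 ?invr_ge0 ?sqr_ge0//.
  exact: (mulr_ge0 (ler0n _ 6) noise_factor_ge0).
have := shift_chain n_gt0 m0 rt0 rt2 (@grid_noise_law _ _ _ _ W eps noise N n N0) lin a_gt0 tau_gt0
  s0_ab s1_ab dD D_ge0 D_le delta_a lam_gt0 cost_move cost_noise mf f01 pq0.
have f_ge0 (y : n.-tuple R) : 0 <= f y by case/andP: (f01 y).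
have push sigma : (\int[nu]_v (f [tuple signal_of n m (p * q) ((@entry _ (N + n))^~ v)
      (fun j => sigma (j%:R / N%:R)) i + tau * tnth v (rshift N i) | i < n])%:E =
    \int[P]_w (f (grid_observations W sigma eps tau n (4 * (p * q) * m) w))%:E)%E.
  rewrite ge0_integral_distribution; last 2 first.
  - apply/measurable_EFinP; apply: (measurableT_comp mf).
    apply/measurable_fun_tnthP => i.
    rewrite (_ : _ \o _ = fun v => signal_of n m (p * q) ((@entry _ (N + n))^~ v)
      (fun j => sigma (j%:R / N%:R)) i + tau * tnth v (rshift N i)); last first.
      by apply/funext => v /=; rewrite tnth_mktuple.
    apply: measurable_funD; last first.
      by apply: measurable_funM => //; exact: measurable_tnth.
    apply: measurable_sum => j; apply: measurable_funM => //.
    by apply: measurable_funM => //; exact: measurable_entry.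
  - by move=> v; rewrite lee_fin; exact: f_ge0.
  apply: eq_integral => w _ /=; congr ((f _)%:E).
  apply: eq_from_tnth => i; rewrite !tnth_mktuple; congr (_ + tau * _); last first.
    by rewrite (unsplitK (inr i)).
  rewrite /grid_signal NM; apply: eq_big_nat => j /andP[_ jK].
  have jN : (j < N)%N.
    by apply: (leq_trans jK); rewrite -NM mulnC leq_mul2r ltn_ord orbT.
  congr (_ * (_ * _)).
  rewrite /entry -[j in nth _ _ j]/(nat_of_ord (lshift n (Ordinal jN))) -tnth_nth tnth_mktuple.
  by rewrite (unsplitK (inl _)).
by rewrite /= (push sigma0) (push sigma1).
Qed.


Variables (X0 X1 : R -> {RV P >-> R}) (c : R).
Hypotheses (proc0 : is_integral_process W sigma0 X0)
  (proc1 : is_integral_process W sigma1 X1).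
Hypothesis c_ge0 : 0 <= c.
Hypotheses (lip0 : forall x y, x \in `[0, 1] -> y \in `[0, 1] ->
    `|sigma0 x - sigma0 y| <= c * `|x - y|)
  (lip1 : forall x y, x \in `[0, 1] -> y \in `[0, 1] ->
    `|sigma1 x - sigma1 y| <= c * `|x - y|).
Hypotheses (meas0 : measurable_fun setT sigma0) (meas1 : measurable_fun setT sigma1).

(** A grid fine enough for both volatilities is taken. *)
Lemma two_point_test (f : n.-tuple R -> R) : lipschitz_test f -> forall eta, 0 < eta ->
  (\int[P]_w (f (observations tau X1 eps n w))%:E <=
   \int[P]_w (f (observations tau X0 eps n w))%:E + (12 * lam + eta)%:E)%E.
Proof.
move=> ftest eta eta0; have [mf [f01 _]] := ftest; have [bmW _] := noise.
have eta2 : 0 < eta / 2 by rewrite divr_gt0.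
have [M1 h1] := test_discretisation bmW proc1 c_ge0 lip1 meas1 eps tau n_gt0 ftest eta2.
have [M0 h0] := test_discretisation bmW proc0 c_ge0 lip0 meas0 eps tau n_gt0 ftest eta2.
pose m := (M0 + M1).+1.
have Mm : (m <= 4 * (p * q) * m)%N by rewrite leq_pmull// !muln_gt0 p_gt0 q_gt0.
have [|g1 _] := h1 (4 * (p * q) * m)%N.
  by apply: leq_trans Mm; rewrite ltnW// ltnS leq_addl.
have [|_ g0] := h0 (4 * (p * q) * m)%N.
  by apply: leq_trans Mm; rewrite ltnW// ltnS leq_addr.
apply: (le_trans g1) => /=.
have -> : (12 * lam + eta)%:E = ((eta / 2)%:E + (12 * lam)%:E + (eta / 2)%:E)%E.
  by rewrite -!EFinD; congr (_%:E); field.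
rewrite !addeA; apply: leeD2r.
apply: (le_trans (grid_two_point (isT : 0 < m)%N mf f01)).
exact: leeD2r g0.
Qed.

(** The Lipschitz test is chosen for the sum of the two laws, so that the
    exceptional set is small for both. *)
Lemma two_point_le (A : set (n.-tuple R)) : measurable A -> 24 * lam <= 1 ->
  (P (observations tau X1 eps n @^-1` A) <=
   P (observations tau X0 eps n @^-1` A) + (3 / 4)%:E)%E.
Proof.
move=> mA lam24.
have mY1 : measurable_fun setT (observations tau X1 eps n).
  exact: (measurable_observations proc1 eps tau n_gt0).
have mY0 : measurable_fun setT (observations tau X0 eps n).
  exact: (measurable_observations proc0 eps tau n_gt0).
pose mu := measure_add (distribution P (mk_mfun mY1)) (distribution P (mk_mfun mY0)).
have muE B : mu B = (P (observations tau X1 eps n @^-1` B) +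
    P (observations tau X0 eps n @^-1` B))%E.
  by rewrite /mu measure_addE.
have mu_fin : (mu setT < +oo)%E.
  by rewrite muE !preimage_setT !probability_setT -EFinD ltry.
have [_ approx] := measurable_lip_approximable mu_fin mA.
have e12 : 0 < 1 / 12 :> R by rewrite divr_gt0.
have [f [E ftest [mE Elt fA]]] := approx _ e12.
have [mf [f01 _]] := ftest.
have [h1 _] := test_set_le P mY1 mA mE mf f01 fA.
have [_ h0] := test_set_le P mY0 mA mE mf f01 fA.
have {}Elt : (P (observations tau X1 eps n @^-1` E) +
    P (observations tau X0 eps n @^-1` E) <= (1 / 12)%:E)%E by rewrite -muE ltW.
apply: (le_trans h1).
apply: (le_trans (leeD2r _ (two_point_test ftest e12))).
apply: (le_trans (leeD2r _ (leeD2r _ h0))).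
rewrite -!addeA; apply: leeD2l.
apply: (@le_trans _ _ ((12 * lam + 1 / 12)%:E + (1 / 12)%:E)%E).
  by rewrite addeCA; apply: leeD2l; rewrite addeC.
by rewrite -EFinD lee_fin; lra.
Qed.

End two_point.

(** * Tests between two squared volatilities *)

Lemma sqrt_lipschitz (R : rcfType) (l x y : R) : 0 < l -> l <= x -> l <= y ->
  `|Num.sqrt x - Num.sqrt y| <= `|x - y| / Num.sqrt l.
Proof.
move=> l0 lx ly; have x0 := lt_le_trans l0 lx; have y0 := lt_le_trans l0 ly.
have sl : 0 < Num.sqrt l by rewrite sqrtr_gt0.
rewrite ler_pdivlMr//.
have -> : x - y = (Num.sqrt x - Num.sqrt y) * (Num.sqrt x + Num.sqrt y).
  by rewrite -subr_sqr !sqr_sqrtr// ltW.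
rewrite normrM ler_wpM2l// ger0_norm ?addr_ge0 ?sqrtr_ge0//.
by rewrite (le_trans (ler_wsqrtr lx))// lerDl sqrtr_ge0.
Qed.

Definition contrast_constant (R : realType) (l u tau : R) : R :=
  (128 / l + 6 * (1 + 512 * u / l) / tau ^+ 2) / l.

Lemma contrast_constant_gt0 (R : realType) (l u tau : R) : 0 < l -> l <= u -> 0 < tau ->
  0 < contrast_constant l u tau.
Proof.
move=> l0 lu t0; have u0 := lt_le_trans l0 lu; apply: divr_gt0; last exact: l0.
have x0 : 0 < l^-1 by rewrite invr_gt0.
have z0 : 0 < (tau ^+ 2)^-1 by rewrite invr_gt0 exprn_gt0.
have y0 : 0 < u * l^-1 by rewrite mulr_gt0.
rewrite -!mulrA; move: (l^-1) (u * _) x0 y0 => x y x0 y0.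
move: ((tau ^+ 2)^-1) z0 => z z0.
have yz := mulr_gt0 y0 z0.
have -> : 128 * x + 6 * ((1 + 512 * y) * z) = 128 * x + 6 * z + 3072 * (y * z) by ring.
lra.
Qed.

(** Two tests, of which at least one rejects whatever is observed, cannot both
    have a small probability of rejecting under their own model. The model is
    parametrised by the squared volatility, whose square root is Lipschitz
    away from 0. *)
Lemma volatility_tests {R : realType} d (T : measurableType d) (P : probability T R)
    (W : R -> {RV P >-> R}) (eps : forall n : nat, 'I_n -> {RV P >-> R}) (tau : R)
    (s0 s1 : R -> R) (X0 X1 : R -> {RV P >-> R}) (l u delta c : R) (n p q k0 : nat) :
  noise_model W eps -> 0 < tau -> 0 < l -> 0 <= delta -> 0 <= c ->
  is_integral_process W (fun x => Num.sqrt (s0 x)) X0 ->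
  is_integral_process W (fun x => Num.sqrt (s1 x)) X1 ->
  (0 < n)%N -> (0 < p)%N -> (0 < q)%N -> (p <= n)%N -> (n <= (p * q) ^ 4)%N ->
  (forall x, x \in `[0, 1] -> l <= s0 x <= u) ->
  (forall x, x \in `[0, 1] -> l <= s1 x <= u) ->
  (forall x y, x \in `[0, 1] -> y \in `[0, 1] -> `|s0 x - s0 y| <= c * `|x - y|) ->
  (forall x y, x \in `[0, 1] -> y \in `[0, 1] -> `|s1 x - s1 y| <= c * `|x - y|) ->
  measurable_fun setT s0 -> measurable_fun setT s1 ->
  (forall x, x \in `[0, 1] -> `|s1 x - s0 x| <= delta) ->
  (forall x, 0 <= x < 1 -> ~~ (k0%:R <= p%:R * x < k0%:R + 1) -> s1 x = s0 x) ->
  contrast_constant l u tau * (delta ^+ 2 * q%:R) <= (1 / 24) ^+ 2 ->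
  forall B0 B1 : set (n.-tuple R), measurable B0 -> measurable B1 -> B0 `|` B1 = setT ->
  ((1 / 4)%:E <= P (observations tau X0 eps n @^-1` B0) +
                 P (observations tau X1 eps n @^-1` B1))%E.
Proof.
move=> noise t0 l0 d0 c0 proc0 proc1 n0 p0 q0 pn npq s0lu s1lu lip0 lip1 m0 m1 close eqoff kle
  B0 B1 mB0 mB1 B01.
have rl0 : 0 < Num.sqrt l by rewrite sqrtr_gt0.
have u0 : 0 <= u.
  have z01 : (0 : R) \in `[0, 1] by rewrite in_itv/= lexx ler01.
  by have /andP[h1 h2] := s0lu _ z01; exact: le_trans (ltW l0) (le_trans h1 h2).
have sq_ab s : (forall x, x \in `[0, 1] -> l <= s x <= u) ->
    forall x : R, x \in `[0, 1] -> Num.sqrt l <= Num.sqrt (s x) <= Num.sqrt u.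
  by move=> h x /h/andP[h1 h2]; rewrite !ler_wsqrtr.
have sq_lip s : (forall x, x \in `[0, 1] -> l <= s x <= u) ->
    (forall x y, x \in `[0, 1] -> y \in `[0, 1] -> `|s x - s y| <= c * `|x - y|) ->
    forall x y : R, x \in `[0, 1] -> y \in `[0, 1] ->
    `|Num.sqrt (s x) - Num.sqrt (s y)| <= c / Num.sqrt l * `|x - y|.
  move=> h hl x y x1 y1; have /andP[lx _] := h _ x1; have /andP[ly _] := h _ y1.
  apply: (le_trans (sqrt_lipschitz l0 lx ly)).
  by rewrite mulrAC ler_pM2r ?invr_gt0// hl.
have sq_meas (s : R -> R) : measurable_fun setT s -> measurable_fun setT (fun x : R => Num.sqrt (s x)).
  by move=> ms; apply: measurableT_comp ms; apply: continuous_measurable_fun; exact: sqrt_continuous.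
have clo x : x \in `[0, 1] -> `|Num.sqrt (s1 x) - Num.sqrt (s0 x)| <= delta / Num.sqrt l.
  move=> x1; have /andP[lx _] := s0lu _ x1; have /andP[ly _] := s1lu _ x1.
  apply: (le_trans (sqrt_lipschitz l0 ly lx)).
  by rewrite ler_pM2r ?invr_gt0// close.
have off x : 0 <= x < 1 -> ~~ (k0%:R <= p%:R * x < k0%:R + 1) ->
    Num.sqrt (s1 x) = Num.sqrt (s0 x).
  by move=> x1 h; rewrite eqoff.
have lam0 : 0 < 1 / 24 :> R by rewrite divr_gt0.
have lam1 : 1 / 24 <= 1 :> R by lra.
have kle' : (128 / Num.sqrt l ^+ 2 + 6 * (1 + 512 * Num.sqrt u ^+ 2 / Num.sqrt l ^+ 2) /
    tau ^+ 2) * ((delta / Num.sqrt l) ^+ 2 * q%:R) <= (1 / 24) ^+ 2.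
  rewrite expr_div_n !sqr_sqrtr ?(ltW l0)//; apply: le_trans kle.
  by rewrite /contrast_constant le_eqVlt; apply/orP; left; apply/eqP; ring.
have mC : measurable (~` B1) by exact: measurableC.
have d'0 : 0 <= delta / Num.sqrt l by rewrite divr_ge0// ltW.
have c'0 : 0 <= c / Num.sqrt l by rewrite divr_ge0// ltW.
have := two_point_le noise rl0 t0 d'0 n0 p0 q0 pn npq (sq_ab _ s0lu) (sq_ab _ s1lu) clo off
  lam0 lam1 kle' proc0 proc1 c'0 (sq_lip _ s0lu lip0) (sq_lip _ s1lu lip1)
  (sq_meas _ m0) (sq_meas _ m1) mC.
have -> : 24 * (1 / 24) <= 1 :> R by lra.
move=> /(_ isT).
have mY1 := measurable_observations proc1 eps tau n0.
have mY0 := measurable_observations proc0 eps tau n0.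
have mpre (Y : T -> n.-tuple R) B : measurable_fun setT Y -> measurable B ->
    measurable (Y @^-1` B).
  by move=> mY mB; rewrite -[X in measurable X]setTI; exact: mY.
rewrite preimage_setC probability_setC; last exact: mpre.
have : (P (observations tau X0 eps n @^-1` (~` B1)) <= P (observations tau X0 eps n @^-1` B0))%E.
  apply: le_measure; rewrite ?inE; [exact: mpre|exact: mpre|].
  by move=> w /= nB1; have : (B0 `|` B1) (observations tau X0 eps n w) by [rewrite B01]; case.
have := @fin_num_measure _ _ _ P (observations tau X1 eps n @^-1` B1) (mpre _ _ mY1 mB1).
have := @fin_num_measure _ _ _ P (observations tau X0 eps n @^-1` B0) (mpre _ _ mY0 mB0).
have := @fin_num_measure _ _ _ P (observations tau X0 eps n @^-1` (~` B1)) (mpre _ _ mY0 mC).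
move=> /fineK <- /fineK <- /fineK <-.
have -> : 1%E = 1%:E :> \bar R by [].
by rewrite -EFinB -!EFinD !lee_fin; lra.
Qed.

(** * Clamped polynomials *)

Section clamped_polynomials.
Context {R : realType}.
Implicit Types (P Q : {poly R}) (x y : R).

(** Composing a polynomial with the projection on [0,1] makes it constant
    outside; if it vanishes to second order at 0 and 1, the result is
    differentiable with the clamped derivative. All derivatives of a bump are
    then clamped polynomials, and differentiability reduces to a quadratic
    estimate. *)
Definition clamp01 (x : R) : R := Num.max 0 (Num.min 1 x).

Lemma clamp01_bounds x : 0 <= clamp01 x <= 1.
Proof. by rewrite /clamp01; case: (leP 1 x) => h1; [case: (leP 0 1) => h2|case: (leP 0 x) => h2]; lra. Qed.

Lemma clamp01_id x : 0 <= x <= 1 -> clamp01 x = x.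
Proof. by rewrite /clamp01 => /andP[h1 h2]; rewrite min_r// max_r. Qed.

Lemma clamp01_le0 x : x <= 0 -> clamp01 x = 0.
Proof. by move=> h; rewrite /clamp01 min_r ?max_l//; lra. Qed.

Lemma clamp01_ge1 x : 1 <= x -> clamp01 x = 1.
Proof. by move=> h; rewrite /clamp01 min_l// max_r//; lra. Qed.

Lemma clamp01_out x : ~~ (0 <= x <= 1) -> clamp01 x = 0 \/ clamp01 x = 1.
Proof.
rewrite negb_and -!ltNge => /orP[h|h]; [left|right].
  by apply: clamp01_le0; exact: ltW.
by apply: clamp01_ge1; exact: ltW.
Qed.

Lemma clamp01_lipschitz x y : `|clamp01 y - clamp01 x| <= `|y - x|.
Proof.
wlog xy : x y / x <= y.
  by move=> h; case: (leP x y) => [|/ltW] /h//; rewrite distrC (distrC y).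
have : 0 <= clamp01 y - clamp01 x <= y - x.
  have m1 : Num.max 0 1 = 1 :> R by rewrite max_r.
  rewrite /clamp01; case: (leP 1 x) => h1; case: (leP 1 y) => h2; rewrite ?m1; try lra.
  - by case: (leP 0 x); lra.
  - by case: (leP 0 y); case: (leP 0 x); lra.
by move=> /andP[h1 h2]; rewrite !ger0_norm//; lra.
Qed.

Lemma poly_bounded01 P : exists2 B, 0 <= B & forall x, 0 <= x <= 1 -> `|P.[x]| <= B.
Proof.
elim/poly_ind: P => [|P c [B B0 h]].
  by exists 0 => // x _; rewrite horner0 normr0.
exists (B + `|c|) => [|x x01]; first by rewrite addr_ge0.
rewrite hornerMXaddC (le_trans (ler_normD _ _))// lerD2r normrM.
have /andP[x0 x1] := x01.
by rewrite -[leRHS]mulr1 ler_pM// ?h// ger0_norm.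
Qed.

(** By induction through P = Q X + c: the remainder of P is y times the one of
    Q, plus Q'(x) (y - x)^2. *)
Lemma poly_taylor01 P : exists2 C, 0 <= C & forall x y, 0 <= x <= 1 -> 0 <= y <= 1 ->
  `|P.[y] - P.[x] - P^`().[x] * (y - x)| <= C * (y - x) ^+ 2.
Proof.
elim/poly_ind: P => [|P c [C C0 h]].
  by exists 0 => // x y _ _; rewrite deriv0 !horner0 !mul0r !subr0 normr0.
have [B B0 hB] := poly_bounded01 P^`().
exists (C + B) => [|x y x01 y01]; first exact: addr_ge0.
rewrite derivD derivC addr0 derivM derivX mulr1 !(hornerD, hornerM, hornerX, hornerC).
have -> : P.[y] * y + c - (P.[x] * x + c) - (P^`().[x] * x + P.[x]) * (y - x) =
   y * (P.[y] - P.[x] - P^`().[x] * (y - x)) + P^`().[x] * (y - x) ^+ 2 by ring.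
rewrite (le_trans (ler_normD _ _))// mulrDl lerD//.
  rewrite normrM -[leRHS]mul1r ler_pM// ?h//.
  by have /andP[y0 y1] := y01; rewrite ger0_norm.
by rewrite normrM [`|_ ^+ 2|]ger0_norm ?sqr_ge0// ler_wpM2r ?sqr_ge0// hB.
Qed.

Lemma poly_lipschitz01 P : exists2 K, 0 <= K & forall x y, 0 <= x <= 1 -> 0 <= y <= 1 ->
  `|P.[y] - P.[x]| <= K * `|y - x|.
Proof.
have [C C0 h] := poly_taylor01 P; have [B B0 hB] := poly_bounded01 P^`().
exists (C + B) => [|x y x01 y01]; first exact: addr_ge0.
rewrite -[P.[y] - P.[x]](subrK (P^`().[x] * (y - x))).
rewrite (le_trans (ler_normD _ _))// mulrDl lerD//.
  apply: (le_trans (h x y x01 y01)); rewrite ler_wpM2l// -real_normK ?num_real//.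
  rewrite expr2 ler_piMl// ler_norml.
  by move: x01 y01 => /andP[? ?] /andP[? ?]; apply/andP; split; lra.
by rewrite normrM ler_wpM2r// hB.
Qed.

Definition hat : {poly R} := 'X * (1 - 'X).

Definition clamped P (x : R) : R := P.[clamp01 x].

Lemma hat_dvd_root P x : hat %| P -> x = 0 \/ x = 1 -> P.[x] = 0.
Proof.
move=> /dvdpP[Q ->] hx; rewrite !(hornerM, hornerX, hornerD, hornerN, hornerC).
by case: hx => ->; rewrite ?mul0r ?subrr ?mulr0.
Qed.

Lemma clamped_out P x : hat %| P -> ~~ (0 < x < 1) -> clamped P x = 0.
Proof.
move=> hP; rewrite negb_and -!leNgt => /orP[h|h]; apply: (hat_dvd_root hP).
  by left; exact: clamp01_le0.
by right; exact: clamp01_ge1.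
Qed.

Lemma clamped_bounded P : exists2 B, 0 <= B & forall x, `|clamped P x| <= B.
Proof.
have [B B0 h] := poly_bounded01 P; exists B => // x; apply: h.
exact: clamp01_bounds.
Qed.

Lemma clamped_lipschitz P : exists2 K, 0 <= K &
  forall x y, `|clamped P y - clamped P x| <= K * `|clamp01 y - clamp01 x|.
Proof.
have [K K0 h] := poly_lipschitz01 P; exists K => // x y.
exact: h (clamp01_bounds x) (clamp01_bounds y).
Qed.

Lemma hat_dvd_deriv s P : hat ^+ s.+1 %| P -> hat ^+ s %| P^`().
Proof.
move=> /dvdpP[Q ->]; rewrite derivM deriv_exp/=; rewrite dvdp_addr; last first.
  by apply: dvdp_mull; rewrite exprS; exact: dvdp_mull.
by apply: dvdp_mull; rewrite -mulr_natr; apply: dvdp_mulr; exact: dvdp_mull.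
Qed.

Lemma hat_dvd_derivn j s P : hat ^+ (s + j) %| P -> hat ^+ s %| P^`(j).
Proof.
elim: j s => [|j IH] s; first by rewrite addn0 derivn0.
by rewrite addnS -addSn derivnS => /IH; exact: hat_dvd_deriv.
Qed.

Lemma clamped_taylor P : hat ^+ 2 %| P -> exists2 C, 0 <= C & forall x y,
  `|clamped P y - clamped P x - clamped P^`() x * (y - x)| <= C * (y - x) ^+ 2.
Proof.
move=> hP2; have hP' : hat %| P^`() by rewrite -[hat]expr1; exact: hat_dvd_deriv.
have [C C0 hC] := poly_taylor01 P; have [K K0 hK] := poly_lipschitz01 P^`().
exists (C + 2 * K) => [|x y]; first by rewrite addr_ge0// mulr_ge0.
have cl := clamp01_lipschitz x y.
have cl2 : (clamp01 y - clamp01 x) ^+ 2 <= (y - x) ^+ 2.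
  by rewrite -real_normK ?num_real// -[leRHS]real_normK ?num_real// lerXn2r ?nnegrE.
have -> : clamped P y - clamped P x - clamped P^`() x * (y - x) =
   (P.[clamp01 y] - P.[clamp01 x] - P^`().[clamp01 x] * (clamp01 y - clamp01 x)) +
   P^`().[clamp01 x] * ((clamp01 y - clamp01 x) - (y - x)) by rewrite /clamped; ring.
rewrite (le_trans (ler_normD _ _))// mulrDl lerD//.
  apply: (le_trans (hC _ _ (clamp01_bounds _) (clamp01_bounds _))).
  by rewrite ler_wpM2l.
(* Where clamping moves a point, it is multiplied by a derivative that is
   Lipschitz and vanishes at the end points. *)
have [x01|/clamp01_out xo] := boolP (0 <= x <= 1); last first.
  rewrite (hat_dvd_root hP') ?mul0r ?normr0//.
  by rewrite mulr_ge0 ?sqr_ge0// mulr_ge0.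
have [y01|yo] := boolP (0 <= y <= 1).
  rewrite !clamp01_id// subrr mulr0 normr0.
  by rewrite mulr_ge0 ?sqr_ge0// mulr_ge0.
have E : P^`().[clamp01 y] = 0 by apply: (hat_dvd_root hP'); exact: clamp01_out.
have h1 : `|P^`().[clamp01 x]| <= K * `|y - x|.
  rewrite -normrN -[- _]add0r -E (le_trans (hK _ _ (clamp01_bounds _) (clamp01_bounds _)))//.
  by rewrite ler_wpM2l.
have h2 : `|clamp01 y - clamp01 x - (y - x)| <= 2 * `|y - x|.
  by rewrite (le_trans (ler_normB _ _))//; lra.
rewrite normrM -[in leRHS]real_normK ?num_real//.
have -> : 2 * K * `|y - x| ^+ 2 = K * `|y - x| * (2 * `|y - x|) by ring.
by rewrite ler_pM.
Qed.

End clamped_polynomials.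

(** * Superposed bumps in the Hoelder class *)

Section superposition.
Context {R : realType}.
Implicit Types (P : {poly R}) (h : R -> R).

Definition superpose p (theta : {ffun 'I_p -> bool}) h (x : R) : R :=
  \sum_(k < p) (if theta k then h (p%:R * x - k%:R) else 0).

(** At each point at most one of the translates is not 0. *)
Lemma superpose_bounded p (theta : {ffun 'I_p -> bool}) h B : 0 <= B ->
  (forall u, ~~ (0 < u < 1) -> h u = 0) -> (forall u, `|h u| <= B) ->
  forall x, `|superpose theta h x| <= B.
Proof.
move=> B0 hout hB x; rewrite /superpose.
have [/existsP[k kx]|/existsPn nox] := boolP [exists k : 'I_p, 0 < p%:R * x - k%:R < 1].
  rewrite (bigD1 k)//= big1 ?addr0; first by case: (theta k); rewrite ?normr0.
  move=> j jk; case: (theta j) => //; apply: hout.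
  apply: contra jk => /andP[h1 h2]; move: kx => /andP[h3 h4].
  by rewrite -val_eqE/= eqn_leq; apply/andP; split; rewrite -ltnS -(ltr_nat R) -natr1; lra.
rewrite big1 ?normr0// => j _; case: (theta j) => //; exact: hout.
Qed.

Lemma sum_clamp01 p (u : R) : \sum_(k < p) clamp01 (u - k%:R) = Num.max 0 (Num.min p%:R u).
Proof.
elim: p => [|p IH]; first by rewrite big_ord0 minC; case: (leP u 0) => h; rewrite ?max_l// max_l.
have p0 : 0 <= p%:R :> R by [].
rewrite big_ord_recr/= IH /clamp01 -natr1; move: (p%:R) p0 => q q0.
case: (leP q u) => h1; case: (leP 1 (u - q)) => h2; case: (leP (q + 1) u) => h3;
  rewrite ?(max_r ler01) ?(max_r q0); try lra.
- by rewrite !max_r//; lra.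
- by rewrite !max_r//; lra.
- rewrite (@max_l _ _ 0 (u - q)); last by lra.
  by rewrite addr0.
Qed.

(** The clamped translates of the identity add up to a clamped identity. This
    gives Lipschitz bounds that do not depend on the number of translates. *)
Lemma sum_clamp01_increments p (x y : R) :
  \sum_(k < p) `|clamp01 (y - k%:R) - clamp01 (x - k%:R)| <= `|y - x|.
Proof.
wlog xy : x y / x <= y.
  move=> h; case: (leP x y) => [|/ltW] /h//; rewrite (distrC x).
  by under eq_bigr do rewrite distrC.
have mono (a b : R) : a <= b -> clamp01 a <= clamp01 b.
  rewrite /clamp01 => ab; case: (leP 1 a) => h1; case: (leP 1 b) => h2; first by [].
  - lra.
  - by rewrite (max_r ler01); case: (leP 0 a); lra.
  - by case: (leP 0 a); case: (leP 0 b); lra.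
under eq_bigr => k _.
  rewrite ger0_norm; last by rewrite subr_ge0; apply: mono; lra.
  over.
rewrite sumrB !sum_clamp01 ger0_norm ?subr_ge0//.
case: (leP p%:R x) => h1; case: (leP p%:R y) => h2; last 2 first.
- by case: (leP 0 p%:R); case: (leP 0 x); lra.
- by case: (leP 0 x); case: (leP 0 y); lra.
- lra.
- lra.
Qed.

Lemma superpose_lipschitz p (theta : {ffun 'I_p -> bool}) h K : 0 <= K ->
  (forall x y, `|h y - h x| <= K * `|clamp01 y - clamp01 x|) ->
  forall x y, `|superpose theta h y - superpose theta h x| <= K * (p%:R * `|y - x|).
Proof.
move=> K0 hK x y; rewrite /superpose -sumrB.
have p0 : 0 <= p%:R :> R by [].
rewrite (le_trans (ler_norm_sum _ _ _))//.
have -> : p%:R * `|y - x| = `|p%:R * y - p%:R * x|.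
  by rewrite -mulrBr normrM (ger0_norm p0).
apply: le_trans (_ : _ <= K * \sum_(k < p)
    `|clamp01 (p%:R * y - k%:R) - clamp01 (p%:R * x - k%:R)|) _; last first.
  by rewrite ler_wpM2l// sum_clamp01_increments.
rewrite mulr_sumr; apply: ler_sum => k _.
by case: (theta k); rewrite ?subrr ?normr0 ?mulr_ge0.
Qed.

Lemma superpose_taylor p (theta : {ffun 'I_p -> bool}) h h' C : 0 <= C ->
  (forall x y, `|h y - h x - h' x * (y - x)| <= C * (y - x) ^+ 2) ->
  forall x y, `|superpose theta h y - superpose theta h x -
                 p%:R * superpose theta h' x * (y - x)| <= p%:R * C * p%:R ^+ 2 * (y - x) ^+ 2.
Proof.
move=> C0 hC x y.
have -> : p%:R * superpose theta h' x * (y - x) = \sum_(k < p)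
    (if theta k then h' (p%:R * x - k%:R) else 0) * (p%:R * (y - x)).
  by rewrite /superpose -mulr_suml; ring.
rewrite /superpose -!sumrB (le_trans (ler_norm_sum _ _ _))//.
have -> : p%:R * C * p%:R ^+ 2 * (y - x) ^+ 2 = \sum_(k < p) C * (p%:R * (y - x)) ^+ 2.
  by rewrite sumr_const card_ord -mulr_natl; ring.
apply: ler_sum => k _.
have E : p%:R * (y - x) = (p%:R * y - k%:R) - (p%:R * x - k%:R) by ring.
case: (theta k); first by rewrite E.
by rewrite mul0r !subr0 normr0 mulr_ge0// sqr_ge0.
Qed.

Lemma quadratic_is_derive01 (f f' : R -> R) C : 0 <= C ->
  (forall x y, `|f y - f x - f' x * (y - x)| <= C * (y - x) ^+ 2) -> is_derive01 f f'.
Proof.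
move=> C0 h x x01; apply/cvgrPdist_le => e e0.
have r0 : 0 < e / (C + 1) by rewrite divr_gt0// ltr_wpDl.
rewrite !near_withinE; apply/nbhs_ballP; exists (e / (C + 1)) => //= t xt tx _.
have d0 : t - x != 0 by rewrite subr_eq0.
have n0 : 0 < `|t - x| by rewrite normr_gt0.
rewrite -(ler_pM2r n0) -normrM.
have -> : (f' x - (f t - f x) / (t - x)) * (t - x) = - (f t - f x - f' x * (t - x)).
  by field.
rewrite normrN (le_trans (h x t))// -real_normK ?num_real// expr2 mulrA ler_pM2r//.
move: xt; rewrite /ball/= distrC ltr_pdivlMr ?ltr_wpDl// => /ltW.
by apply: le_trans; rewrite mulrC ler_wpM2l// lerDl.
Qed.

End superposition.

Section volatility.
Context {R : realType} (alpha l : R).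
Hypothesis alpha_gt0 : 0 < alpha.
Let m := Num.truncn alpha.
Let beta := alpha - m%:R.

Let beta01 : 0 <= beta <= 1.
Proof.
have /andP[h1 h2] := truncn_itv (ltW alpha_gt0).
by move: h2; rewrite /beta subr_ge0 h1/= lerBlDr -/m -nat1r => /ltW.
Qed.

(** Its derivatives up to order m vanish to second order at 0 and 1. *)
Definition profile : {poly R} := hat ^+ m.+2.

Let profile_hat j : (j <= m)%N -> hat ^+ 2 %| profile^`(j).
Proof.
move=> jm; apply: hat_dvd_derivn; rewrite /profile.
have -> : (m.+2 = (2 + j) + (m - j))%N by lia.
by rewrite (exprD _ (2 + j)) dvdp_mulIl.
Qed.

Let profile_out j u : (j <= m)%N -> ~~ (0 < u < 1) -> clamped profile^`(j) u = 0.
Proof.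
move=> jm; apply: clamped_out; apply: dvdp_trans (profile_hat jm).
by rewrite expr2 dvdp_mulIl.
Qed.

(** The squared volatility with the bumps chosen by [theta]. *)
Definition volatility (c : R) p (theta : {ffun 'I_p -> bool}) (x : R) : R :=
  l + c * (p%:R `^ (- alpha)) * superpose theta (clamped profile) x.

(** The j-th derivative; the constant l disappears from j = 1 on. *)
Let volatility_deriv c p (theta : {ffun 'I_p -> bool}) j (x : R) : R :=
  (if j is 0%N then l else 0) +
  c * (p%:R `^ (- alpha)) * (p%:R ^+ j * superpose theta (clamped profile^`(j)) x).

Let volatility_derivE c p (theta : {ffun 'I_p -> bool}) j :
  (j <= m)%N -> is_derive01n j (volatility c theta) (volatility_deriv c theta j).
Proof.
elim: j => [|j IH] jm /=.
  by move=> x _; rewrite /volatility_deriv /volatility derivn0 expr0 mul1r.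
exists (volatility_deriv c theta j); first exact/IH/ltnW.
have [C C0 hC] := clamped_taylor (profile_hat (ltnW jm)).
have p0 : 0 <= p%:R :> R by [].
apply: (@quadratic_is_derive01 _ _ _ (`|c * (p%:R `^ (- alpha)) * p%:R ^+ j| *
   (p%:R * C * p%:R ^+ 2))).
  by rewrite !mulr_ge0// exprn_ge0.
move=> x y.
have -> : volatility_deriv c theta j y - volatility_deriv c theta j x -
    volatility_deriv c theta j.+1 x * (y - x) =
  c * (p%:R `^ (- alpha)) * p%:R ^+ j * (superpose theta (clamped profile^`(j)) y -
    superpose theta (clamped profile^`(j)) x -
    p%:R * superpose theta (clamped profile^`(j.+1)) x * (y - x)).
  by rewrite /volatility_deriv exprS; case: (j); intros; ring.
rewrite normrM -[leRHS]mulrA ler_wpM2l//.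
by apply: superpose_taylor => // u v; rewrite derivnS; exact: hC.
Qed.

(** Since 0 <= beta <= 1, min(1, z) <= z^beta. *)
Let power_interpolation p (t : R) : (0 < p)%N -> 0 <= t ->
  p%:R `^ (- beta) * Num.min 1 (p%:R * t) <= t `^ beta.
Proof.
move=> p0 t0; have p0' : 0 < p%:R :> R by rewrite ltr0n.
have pt0 : 0 <= p%:R * t by rewrite mulr_ge0// ltW.
have /andP[b0 b1] := beta01.
have h : Num.min 1 (p%:R * t) <= (p%:R * t) `^ beta.
  have [h|h] := leP 1 (p%:R * t).
    by rewrite -[leLHS](powRr0 (p%:R * t)) ler_powR.
  have [->|ptn0] := eqVneq (p%:R * t) 0; first exact: powR_ge0.
  rewrite -[leLHS]powRr1//.
  by apply: ger_powR => //; rewrite lt0r ptn0 pt0/= ltW.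
apply: (@le_trans _ _ (p%:R `^ (- beta) * (p%:R * t) `^ beta)).
  by rewrite ler_wpM2l ?powR_ge0.
rewrite (powRM _ (ltW p0') t0) mulrA -powRD; last by rewrite (gt_eqF p0') implybT.
by rewrite addNr powRr0 mul1r.
Qed.

Lemma profile_bounds : exists2 B, 0 <= B & forall u, 0 <= clamped profile u <= B.
Proof.
have [B B0 hB] := clamped_bounded profile; exists B => // u.
have := hB u; rewrite ler_norml => /andP[_ ->]; rewrite andbT.
rewrite /clamped /profile horner_exp; apply: exprn_ge0.
rewrite !(hornerM, hornerX, hornerD, hornerN, hornerC).
by have /andP[? ?] := clamp01_bounds u; rewrite mulr_ge0// subr_ge0.
Qed.

(** The m-th derivative is of size c p^(m - alpha) and has Lipschitz constant
    of order c p^(m + 1 - alpha); interpolating between the two bounds gives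
    the Hoelder condition with a constant of order c, uniformly in p. *)
Lemma volatility_hoelder (L u : R) : 0 < L -> l < u -> 0 < l ->
  exists2 c0, 0 < c0 & forall c, 0 < c <= c0 -> forall p (theta : {ffun 'I_p -> bool}),
    (0 < p)%N -> bounded_hoelder alpha L l u (volatility c theta).
Proof.
move=> L0 lu l0.
have [B B0 hB] := profile_bounds.
have [B' B'0 hB'] := clamped_bounded profile^`(m).
have [K K0 hK] := clamped_lipschitz profile^`(m).
have den : 0 < B + 2 * B' + K + 1 by lra.
exists (Num.min L (u - l) / (B + 2 * B' + K + 1)).
  by rewrite divr_gt0// lt_min L0 subr_gt0.
move=> c /andP[c0 cle] p theta p0.
have p1 : 1 <= p%:R :> R by rewrite ler1n.
have {cle} : c * (B + 2 * B' + K + 1) <= Num.min L (u - l) by rewrite -ler_pdivlMr.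
rewrite le_min => /andP[cL cu].
have cB := mulr_ge0 (ltW c0) B0; have cB' := mulr_ge0 (ltW c0) B'0.
have cK := mulr_ge0 (ltW c0) K0.
have pa0 : 0 <= p%:R `^ (- alpha) :> R by exact: powR_ge0.
have pa1 : p%:R `^ (- alpha) <= 1 :> R.
  by rewrite -[leRHS](powRr0 p%:R) ler_powR// oppr_le0 ltW.
split; last first.
  move=> x _; rewrite /volatility lerDl.
  have S0 : 0 <= superpose theta (clamped profile) x.
    by apply: sumr_ge0 => k _; case: (theta k) => //; have /andP[] := hB (p%:R * x - k%:R).
  rewrite mulr_ge0 ?mulr_ge0 ?(ltW c0)//=.
  have SB : superpose theta (clamped profile) x <= B.
    apply: le_trans (ler_norm _) _; apply: superpose_bounded => //.
      by move=> v; have := @profile_out 0%N v isT; rewrite derivn0.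
    by move=> v; have /andP[h1 h2] := hB v; rewrite ger0_norm.
  have : c * p%:R `^ (- alpha) * superpose theta (clamped profile) x <= c * 1 * B.
    by apply: ler_pM => //; rewrite ?mulr_ge0 ?(ltW c0)// ler_wpM2l// ltW.
  lra.
exists (volatility_deriv c theta m) => [|x y _ _]; first exact: volatility_derivE.
rewrite -/m -/beta.
have -> : volatility_deriv c theta m x - volatility_deriv c theta m y =
   c * (p%:R `^ (- beta) * (superpose theta (clamped profile^`(m)) x -
       superpose theta (clamped profile^`(m)) y)).
  rewrite /volatility_deriv.
  have -> : p%:R `^ (- beta) = p%:R `^ (- alpha) * p%:R ^+ m :> R.
    rewrite -powR_mulrn ?ler0n// -powRD; last by rewrite (gt_eqF (lt_le_trans ltr01 p1)) implybT.
    by rewrite /beta opprB addrC.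
  by ring.
rewrite normrM (gtr0_norm c0) normrM (ger0_norm (powR_ge0 _ _)).
set S := superpose _ _.
have S1 : `|S x - S y| <= 2 * B'.
  have h v : `|S v| <= B' by apply: superpose_bounded => // w; exact: profile_out.
  by rewrite (le_trans (ler_normB _ _))//; have := h x; have := h y; lra.
have S2 : `|S x - S y| <= K * (p%:R * `|x - y|) by exact: superpose_lipschitz.
have pt0 : 0 <= p%:R * `|x - y| by rewrite mulr_ge0.
have S3 : `|S x - S y| <= (2 * B' + K) * Num.min 1 (p%:R * `|x - y|).
  have [h|h] := leP 1 (p%:R * `|x - y|).
    by rewrite mulr1 (le_trans S1)// lerDl.
  by rewrite mulrDl (le_trans S2)// lerDr !mulr_ge0.
apply: (@le_trans _ _ (c * (2 * B' + K) * (p%:R `^ (- beta) * Num.min 1 (p%:R * `|x - y|)))).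
  rewrite -mulrA ler_wpM2l ?(ltW c0)// mulrCA ler_wpM2l ?powR_ge0//.
apply: ler_pM.
- by rewrite mulr_ge0 ?(ltW c0)// addr_ge0// mulr_ge0.
- by rewrite mulr_ge0 ?powR_ge0// le_min ler01 pt0.
- lra.
- exact: power_interpolation.
Qed.

End volatility.

(** * Flipping one bump, and losses on a cell *)

Lemma lipschitz_measurable (R : realType) (f : R -> R) K : 0 <= K ->
  (forall x y, `|f x - f y| <= K * `|x - y|) -> measurable_fun setT f.
Proof.
move=> K0 h; apply: continuous_measurable_fun => x; apply/cvgrPdist_le => e e0.
apply/nbhs_ballP; exists (e / (K + 1)) => /=; first by rewrite divr_gt0// ltr_wpDl.
move=> y; rewrite /ball/= ltr_pdivlMr ?ltr_wpDl// => /ltW xy.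
by rewrite (le_trans (h _ _))// (le_trans _ xy)// mulrC ler_wpM2l// lerDl.
Qed.

Definition flip p (theta : {ffun 'I_p -> bool}) (k : 'I_p) : {ffun 'I_p -> bool} :=
  [ffun j => theta j (+) (j == k)].

Lemma flipK p (k : 'I_p) : involutive (fun theta => flip theta k).
Proof. by move=> theta; apply/ffunP => j; rewrite !ffunE -addbA addbb addbF. Qed.

Section flip.
Context {R : realType} (alpha l c : R) (p : nat) (theta : {ffun 'I_p -> bool}).
Hypotheses (c_gt0 : 0 < c).

Lemma superpose_flip (h : R -> R) (k : 'I_p) (x : R) : `|superpose (flip theta k) h x - superpose theta h x| =
  `|h (p%:R * x - k%:R)|.
Proof.
rewrite /superpose -sumrB (bigD1 k)//= big1 ?addr0.
  by rewrite ffunE eqxx; case: (theta k); rewrite /= ?sub0r ?subr0 ?normrN.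
by move=> j jk; rewrite ffunE (negbTE jk) addbF subrr.
Qed.

Lemma volatility_flip (k : 'I_p) (x : R) :
  `|volatility alpha l c (flip theta k) x - volatility alpha l c theta x| =
  c * p%:R `^ (- alpha) * clamped (profile alpha) (p%:R * x - k%:R).
Proof.
have [B _ hB] := profile_bounds alpha; have /andP[h0 _] := hB (p%:R * x - k%:R).
rewrite /volatility opprD addrACA subrr add0r -mulrBr normrM superpose_flip (ger0_norm h0).
by rewrite ger0_norm// mulr_ge0 ?powR_ge0// ltW.
Qed.

Lemma volatility_flip_out (k : 'I_p) (x : R) : ~~ (k%:R <= p%:R * x < k%:R + 1) ->
  volatility alpha l c (flip theta k) x = volatility alpha l c theta x.
Proof.
move=> out; apply/eqP; rewrite -subr_eq0 -normr_eq0 volatility_flip.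
rewrite (@clamped_out _ (profile alpha)) ?mulr0//.
  by rewrite /profile exprS dvdp_mulIl.
by apply: contra out => /andP[h1 h2]; apply/andP; split; lra.
Qed.

(** u (1 - u) is at least 3/16 there. *)
Lemma profile_middle (v : R) : 1 / 4 <= v <= 3 / 4 ->
  (3 / 16) ^+ (Num.truncn alpha).+2 <= clamped (profile alpha) v.
Proof.
move=> /andP[h1 h2]; rewrite /clamped clamp01_id; last by apply/andP; split; lra.
rewrite horner_exp lerXn2r ?nnegrE ?divr_ge0//;
  rewrite !(hornerM, hornerX, hornerD, hornerN, hornerC); nra.
Qed.

Lemma volatility_lipschitz : exists2 K, 0 <= K & forall (eta : {ffun 'I_p -> bool}) (x y : R),
  `|volatility alpha l c eta x - volatility alpha l c eta y| <= K * `|x - y|.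
Proof.
have [K K0 hK] := clamped_lipschitz (profile alpha).
exists (c * p%:R `^ (- alpha) * (K * p%:R)) => [|eta x y].
  by rewrite mulr_ge0 ?mulr_ge0 ?powR_ge0 ?(ltW c_gt0).
rewrite /volatility opprD addrACA subrr add0r -mulrBr normrM.
rewrite ger0_norm; last by rewrite mulr_ge0 ?powR_ge0// ltW.
rewrite -[leRHS]mulrA ler_wpM2l//; first by rewrite mulr_ge0 ?powR_ge0// ltW.
by rewrite -mulrA; exact: superpose_lipschitz.
Qed.

End flip.

Section cells.
Context {R : realType}.
Notation mu := (@lebesgue_measure R).

Definition sqr_dist (I : set R) (f g : R -> R) : \bar R :=
  (\int[mu]_(x in I) ((f x - g x) ^+ 2)%:E)%E.

Lemma in_L2_measurable (f : R -> R) (I : set R) : in_L2 f -> I `<=` `[0, 1]%classic ->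
  measurable I -> measurable_fun I f.
Proof.
move=> f2 I01 mI.
have mf : measurable_fun setT (f \_ `[0, 1]).
  by move: f2; rewrite /in_L2 inE => /andP[]; rewrite inE.
apply: (eq_measurable_fun (f \_ `[0, 1])); last exact: measurable_funTS.
by move=> x; rewrite inE => /I01 x01; rewrite patchE mem_set.
Qed.

(** These sets are the ones for which the measurability of an estimator is
    used. *)
Lemma sqr_dist_open (I : set R) (g : R -> R) (D : R) : measurable I ->
  I `<=` `[0, 1]%classic -> measurable_fun setT g -> 0 < D ->
  L2_open [set f | (sqr_dist I f g < D%:E)%E].
Proof.
move=> mI I01 mg D0 f f2 /= fD.
have v0 : (0 <= sqr_dist I f g)%E by apply: integral_ge0 => x _; rewrite lee_fin sqr_ge0.
have [v Ev] : exists v, sqr_dist I f g = v%:E.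
  by exists (fine (sqr_dist I f g)); rewrite fineK// ge0_fin_numE// (lt_trans fD)// ltry.
rewrite Ev lte_fin in fD; rewrite Ev lee_fin in v0.
pose c := (D - v) / (2 * (v + 1)).
have v1 : 0 < v + 1 by lra.
have c0 : 0 < c by rewrite divr_gt0 ?subr_gt0// mulr_gt0.
have cv : (1 + c) * v < v + (D - v) / 2 + (D - v) / 4 .
  have -> : (1 + c) * v = v + (D - v) / 2 * (v / (v + 1)) by rewrite /c; field; rewrite gt_eqF.
  have : v / (v + 1) <= 1 by rewrite ler_pdivrMr// mul1r lerDl.
  have : 0 <= v / (v + 1) by rewrite divr_ge0// ltW.
  move: (v / _) => z z0 z1; nra.
have b0 : 0 < 1 + c^-1 by rewrite addr_gt0// invr_gt0.
exists (Num.sqrt ((D - v) / 4 / (1 + c^-1))) => [|h h2 hf].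
  by rewrite sqrtr_gt0 !divr_gt0 ?subr_gt0.
have -> : sqr_dist I h g = (\int[mu]_(x in I) (((f x - g x) + (h x - f x)) ^+ 2)%:E)%E.
  by apply: eq_integral => x _; congr ((_ ^+ 2)%:E); ring.
have mf := in_L2_measurable f2 I01 mI; have mh := in_L2_measurable h2 I01 mI.
have mgI : measurable_fun I g by exact: measurable_funTS.
apply: (le_lt_trans (integral_sqrD_young mu c0 mI (measurable_funB mf mgI) (measurable_funB mh mf))).
rewrite -/(sqr_dist I f g) Ev.
have hle : (\int[mu]_(x in I) ((h x - f x) ^+ 2)%:E <= ((D - v) / 4 / (1 + c^-1))%:E)%E.
  apply: (@le_trans _ _ (L2norm (h \- f)%R ^+ 2)%E).
    rewrite L2norm_sqr; apply: ge0_subset_integral => //.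
      apply/measurable_EFinP; apply: measurable_funX; apply: measurable_funB;
        exact: in_L2_measurable.
    by move=> x _; rewrite lee_fin sqr_ge0.
  have n0 : (0 <= L2norm (h \- f)%R)%E by exact: Lnorm_ge0.
  move: hf n0; case: (L2norm _) => [r| |]//; rewrite lte_fin lee_fin -EFin_expe lee_fin => rlt r0.
  have w0 : 0 <= (D - v) / 4 / (1 + c^-1) by rewrite !divr_ge0 ?subr_ge0// ltW.
  by rewrite -(sqr_sqrtr w0) lerXn2r ?nnegrE ?sqrtr_ge0// ltW.
apply: (@le_lt_trans _ _ ((1 + c)%:E * v%:E + (1 + c^-1)%:E * ((D - v) / 4 / (1 + c^-1))%:E)%E).
  by apply: leeD2l; apply: lee_wpmul2l => //; rewrite lee_fin ltW.
rewrite -!EFinM -EFinD lte_fin [X in _ + X]mulrC divfK; last by rewrite gt_eqF.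
lra.
Qed.

(** The integral of a nonnegative function is a supremum over simple
    functions, hence monotone even if the functions are not measurable; the
    loss need not be examined for measurability. *)
Lemma ge0_le_integral_lower d (T : measurableType d) (m : {measure set T -> \bar R})
    (f g : T -> \bar R) : (forall x, 0 <= f x)%E -> (forall x, f x <= g x)%E ->
  (\int[m]_x f x <= \int[m]_x g x)%E.
Proof.
move=> f0 fg; have g0 x : (0 <= g x)%E by exact: le_trans (f0 x) (fg x).
rewrite !ge0_integralTE//; apply: le_ereal_sup => _ [h hf <-]; exists h => //= x.
exact: le_trans (hf x) (fg x).
Qed.

Lemma limn_einf_ge (u : nat -> \bar R) (C : \bar R) n0 :
  (forall n, (n0 <= n)%N -> (C <= u n)%E) -> (C <= limn_einf u)%E.
Proof.
move=> h; rewrite limn_einf_lim.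
rewrite (cvg_lim _ (@cvg_einfs_sup _ u))//.
apply: (@le_trans _ _ (einfs u n0)); last by apply: ereal_sup_ubound; exists n0.
by apply: le_ereal_inf_tmp => _ [n nn <-]; exact: h.
Qed.

End cells.

(** * Constant volatility *)

(** Blocks of length at most n^(-1/4), as few of them per cell as possible. *)
Lemma block_count (R : realType) (n p : nat) : (0 < p)%N ->
  let q := (Num.truncn (n%:R `^ (1 / 4) / p%:R : R)).+1 in
  (n <= (p * q) ^ 4)%N /\ q%:R <= n%:R `^ (1 / 4) / p%:R + 1 :> R.
Proof.
move=> p0 q; have p0' : 0 < p%:R :> R by rewrite ltr0n.
have s0 : 0 <= n%:R `^ (1 / 4) / p%:R :> R by rewrite divr_ge0 ?powR_ge0// ltW.
have /andP[h1 h2] := truncn_itv s0; split; last by rewrite /q -natr1 lerD2r.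
rewrite -(ler_nat R) natrX natrM.
have -> : n%:R = (n%:R `^ (1 / 4)) ^+ 4 :> R.
  rewrite -powR_mulrn ?powR_ge0// -powRrM.
  have -> : 1 / 4 * 4%:R = 1 :> R by field.
  by rewrite powRr1.
rewrite lerXn2r ?nnegrE ?powR_ge0 ?mulr_ge0//.
by move: h2; rewrite ltr_pdivrMr// -/q => /ltW; rewrite [leRHS]mulrC.
Qed.

Lemma expectation_ge_indicators {R : realType} d (T : measurableType d)
    (P : probability T R) (I : finType) (A : I -> set T) (a : R) (f : T -> \bar R) :
  0 <= a -> (forall i, measurable (A i)) ->
  (forall w, (\sum_i a%:E * (\1_(A i) w)%:E <= f w)%E) ->
  (a%:E * \sum_i P (A i) <= \int[P]_w f w)%E.
Proof.
move=> a0 mA hf.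
have i0 i w : (0 <= (\1_(A i) w : R)%:E)%E by rewrite lee_fin indicE.
have ai0 i w : (0 <= a%:E * (\1_(A i) w : R)%:E)%E by rewrite mule_ge0.
have mi i : measurable_fun setT (fun w => (\1_(A i) w : R)%:E).
  by apply/measurable_EFinP; exact: measurable_indic.
have g0 w : (0 <= \sum_i a%:E * (\1_(A i) w)%:E)%E by apply: sume_ge0.
apply: le_trans (ge0_le_integral_lower P g0 hf).
rewrite ge0_integral_sum//; last by move=> i; apply: emeasurable_funM.
rewrite ge0_sume_distrr//; apply: lee_sum => i _.
by rewrite ge0_integralZl_EFin// integral_indic// setIT.
Qed.

Lemma max_of_pair {R : realType} (x y : \bar R) (a : R) : ((2 * a)%:E <= x + y)%E ->
  (a%:E <= x)%E \/ (a%:E <= y)%E.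
Proof.
move=> h; have [|xa] := leP a%:E x; [by left|right].
rewrite leNgt; apply/negP => ya; move: h; rewrite leNgt => /negP; apply.
have -> : (2 * a)%:E = (a%:E + a%:E)%E :> \bar R by rewrite -EFinD; congr (_%:E); ring.
exact: lteD.
Qed.

Lemma far_from_one {R : realFieldType} (a D : R) : 0 < D ->
  a ^+ 2 < D ^+ 2 / 4 -> D ^+ 2 / 4 <= (a - D) ^+ 2.
Proof.
move=> D0 h; have aD : a < D / 2.
  by rewrite ltNge; apply/negP => h'; nra.
have -> : (a - D) ^+ 2 = (D / 2 - a) * (3 * (D / 2) - a) + D ^+ 2 / 4 by field.
by rewrite lerDr mulr_ge0//; lra.
Qed.

(** A gap g that meets the closeness condition of [volatility_tests] once the
    rates have been taken out, the factor 2 coming from rounding the number of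
    blocks. *)
Lemma contrast_choice {R : realFieldType} (K g : R) : 0 < K -> 0 <= g ->
  g <= 1 / 48 / (K + 1) -> K * (2 * g ^+ 2) <= (1 / 24) ^+ 2.
Proof.
move=> K0 g0; have K1 : 0 < K + 1 by rewrite addr_gt0.
rewrite ler_pdivlMr// mulrC => h.
have a1 : K * g <= 1 / 48 by nra.
have a2 : g <= 1 / 48 by nra.
by nra.
Qed.

Section constant_volatility.
Context {R : realType} (tau smin smax : R).
Hypotheses (tau_gt0 : 0 < tau) (smin_gt0 : 0 < smin) (smin_lt : smin < smax).

Let K := contrast_constant smin smax tau.
Let K_gt0 : 0 < K. Proof. by apply: contrast_constant_gt0 => //; exact: ltW. Qed.

Let gap := Num.min (smax - smin) (1 / 48 / (K + 1)).
Let gap_gt0 : 0 < gap.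
Proof. by rewrite lt_min subr_gt0 smin_lt/= divr_gt0 ?addr_gt0// divr_gt0. Qed.

Let gap_sqr : K * (2 * gap ^+ 2) <= (1 / 24) ^+ 2.
Proof. by apply: contrast_choice => //; [exact: ltW|rewrite /gap ge_min lexx orbT]. Qed.

Context d (T : measurableType d) (P : probability T R).
Variables (W : R -> {RV P >-> R}) (eps : forall n : nat, 'I_n -> {RV P >-> R})
  (X : R -> R -> {RV P >-> R}).
Hypothesis noise : noise_model W eps.
Hypothesis proc : forall s : R, s \in `[smin, smax] ->
  is_integral_process W (cst (Num.sqrt s)) (X (Num.sqrt s)).

(** The candidates are smin and smin + D with D = gap * n^(-1/8): an estimate
    is at distance at least D / 2 from one of them. *)
Lemma constant_volatility_risk n (est : n.-tuple R -> R) : (0 < n)%N ->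
  measurable_fun setT est -> exists2 s, s \in `[smin, smax] &
  ((gap ^+ 2 / 32)%:E <= \int[P]_w (n%:R `^ (1 / 4) *
      (est (observations tau (X (Num.sqrt s)) eps n w) - s) ^+ 2)%:E)%E.
Proof.
move=> n0 mest.
have n1 : 1 <= n%:R :> R by rewrite ler1n.
have n0' : 0 < n%:R :> R by rewrite ltr0n.
pose r := n%:R `^ (1 / 4) : R; pose v := n%:R `^ (- (1 / 8)) : R.
have r1 : 1 <= r by rewrite -[leLHS](powRr0 n%:R) ler_powR.
have v0 : 0 < v by exact: powR_gt0.
have v1 : v <= 1 by rewrite -[leRHS](powRr0 n%:R) ler_powR// oppr_le0.
have rv : r * v ^+ 2 = 1.
  rewrite /r /v -powR_mulrn ?powR_ge0// -powRrM -powRD; last by rewrite (gt_eqF n0') implybT.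
  by rewrite (_ : 1 / 4 + _ = 0) ?powRr0//; field.
pose q := (Num.truncn (r / 1%:R : R)).+1.
have [nq qle] : (n <= (1 * q) ^ 4)%N /\ q%:R <= r + 1 :> R.
  by have := @block_count R n 1 isT; rewrite /= -/r -/q divr1.
pose D := gap * v; have D0 : 0 < D by rewrite mulr_gt0.
have DleS : D <= smax - smin.
  rewrite (@le_trans _ _ gap)//; first by rewrite /D ler_piMr// ltW.
  by rewrite /gap ge_min lexx.
have in0 : smin \in `[smin, smax] by rewrite in_itv/= lexx ltW.
have in1 : smin + D \in `[smin, smax] by rewrite in_itv/= lerDl (ltW D0) -lerBrDl.
pose B s := [set y : n.-tuple R | D ^+ 2 / 4 <= (est y - s) ^+ 2].
have mB s : measurable (B s).
  have me : measurable_fun setT (fun y : n.-tuple R => (est y - s) ^+ 2).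
    by apply: measurable_funX; exact: measurable_funB.
  have := me measurableT `[D ^+ 2 / 4, +oo[%classic (measurable_itv _).
  rewrite setTI; congr measurable; apply/seteqP; split => y; rewrite /B /= in_itv/= andbT//.
have BU : B smin `|` B (smin + D) = setT.
  apply/seteqP; split => // y _; rewrite /B /=.
  have [|h] := leP (D ^+ 2 / 4) ((est y - smin) ^+ 2); [by left|right].
  by rewrite opprD addrA; exact: far_from_one.
have close : contrast_constant smin smax tau * (D ^+ 2 * q%:R) <= (1 / 24) ^+ 2.
  apply: le_trans gap_sqr; rewrite -/K ler_wpM2l ?(ltW K_gt0)// /D exprMn -mulrA mulrC ler_wpM2r ?sqr_ge0//.
  apply: (@le_trans _ _ (v ^+ 2 * (r + 1))); first by rewrite ler_wpM2l// sqr_ge0.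
  rewrite mulrDr mulrC rv mulr1.
  have : v ^+ 2 <= 1 by rewrite expr_le1// ltW.
  lra.
have lu0 (s : R) : s \in `[smin, smax] -> forall x : R, x \in `[0, 1] -> smin <= s <= smax.
  by rewrite in_itv.
have lip0 (s x y : R) : x \in `[0, 1] -> y \in `[0, 1] -> `|s - s| <= (0 : R) * `|x - y|.
  by move=> _ _; rewrite subrr normr0 mul0r.
have near0 (x : R) : x \in `[0, 1] -> `|smin + D - smin| <= D.
  by move=> _; rewrite addrAC subrr add0r gtr0_norm.
have off0 (x : R) : 0 <= x < 1 -> ~~ (0%:R <= 1%:R * x < 0%:R + 1) -> smin + D = smin.
  by rewrite mul1r add0r => ->.
have := @volatility_tests R d T P W eps tau (cst smin) (cst (smin + D)) (X (Num.sqrt smin))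
  (X (Num.sqrt (smin + D))) smin smax D 0 n 1 q 0 noise tau_gt0 smin_gt0 (ltW D0) (lexx 0)
  (proc in0) (proc in1) n0 isT isT n0 nq (lu0 _ in0) (lu0 _ in1) (lip0 smin) (lip0 (smin + D))
  (measurable_cst _) (measurable_cst _) near0 off0 close _ _ (mB _) (mB _) BU.
have risk s : s \in `[smin, smax] ->
    ((gap ^+ 2 / 4)%:E * P (observations tau (X (Num.sqrt s)) eps n @^-1` B s) <=
     \int[P]_w (n%:R `^ (1 / 4) *
      (est (observations tau (X (Num.sqrt s)) eps n w) - s) ^+ 2)%:E)%E.
  move=> sS; have mY := measurable_observations (proc sS) eps tau n0.
  have := @expectation_ge_indicators R d T P unit
    (fun=> observations tau (X (Num.sqrt s)) eps n @^-1` B s) (gap ^+ 2 / 4)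
    (fun w => (n%:R `^ (1 / 4) *
      (est (observations tau (X (Num.sqrt s)) eps n w) - s) ^+ 2)%:E).
  rewrite (big_pred1 tt)//.
  apply; first by rewrite divr_ge0// sqr_ge0.
    by move=> _; rewrite -[X in measurable X]setTI; exact: mY.
  move=> w; rewrite (big_pred1 tt)//.
  rewrite -EFinM lee_fin indicE -/r.
  have [wB|_] := boolP (w \in _); last by rewrite mulr0 mulr_ge0 ?sqr_ge0// (le_trans ler01).
  move: wB; rewrite inE /B /= => wB; rewrite mulr1.
  have -> : gap ^+ 2 / 4 = r * (D ^+ 2 / 4).
    by rewrite /D exprMn -[LHS]mulr1 -rv; ring.
  by rewrite ler_wpM2l// (le_trans ler01).
have -> : (1 / 4)%:E = (2 * (1 / 8))%:E :> \bar R by congr (_%:E); field.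
have half (x : \bar R) : ((1 / 8)%:E <= x)%E -> ((gap ^+ 2 / 32)%:E <= (gap ^+ 2 / 4)%:E * x)%E.
  move=> h; have -> : (gap ^+ 2 / 32)%:E = ((gap ^+ 2 / 4)%:E * (1 / 8)%:E)%E :> \bar R.
    by rewrite -EFinM; congr (_%:E); field.
  by apply: lee_wpmul2l => //; rewrite lee_fin divr_ge0// sqr_ge0.
move=> /max_of_pair[] /half h.
  by exists smin => //; apply: (le_trans h); exact: risk.
by exists (smin + D) => //; apply: (le_trans h); exact: risk.
Qed.

End constant_volatility.

(** A bound for every estimator at one parameter, which may depend on the
    estimator and on n. *)
Lemma liminf_minimax_ge {R : realType} (I : nat -> Type) (K : Type) (S : set K)
    (E : forall n, set (I n)) (risk : forall n, I n -> K -> \bar R) (C : R) n0 :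
  (forall n, (n0 <= n)%N -> forall est, E n est ->
     exists2 s, S s & (C%:E <= risk n est s)%E) ->
  (C%:E <= limn_einf (fun n => ereal_inf [set ereal_sup [set risk n est s | s in S]
    | est in E n]))%E.
Proof.
move=> h; apply: (@limn_einf_ge _ _ _ n0) => n nn.
apply: le_ereal_inf_tmp => _ [est Eest <-].
have [s Ss Cs] := h n nn est Eest.
by apply: (le_trans Cs); apply: ereal_sup_ubound; exists s.
Qed.


Lemma constant_volatility_minimax {R : realType} (tau smin smax : R) :
  0 < tau -> 0 < smin -> smin < smax ->
  exists2 C : R, 0 < C &
   forall (d : measure_display) (T : measurableType d) (P : probability T R)
     (W : R -> {RV P >-> R}) (eps : forall n : nat, 'I_n -> {RV P >-> R})
     (X : R -> R -> {RV P >-> R}),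
   noise_model W eps ->
   (forall sigma2 : R, sigma2 \in `[smin, smax] ->
      is_integral_process W (cst (Num.sqrt sigma2)) (X (Num.sqrt sigma2))) ->
   (C%:E <= limn_einf (fun n : nat =>
      ereal_inf [set
        ereal_sup [set
          \int[P]_w (n%:R `^ (1 / 4) *
            (est (observations tau (X (Num.sqrt sigma2)) eps n w)
               - sigma2) ^+ 2)%:E
        | sigma2 in `[smin, smax]]
      | est in real_estimators n]))%E.
Proof.
move=> t0 s0 sl.
pose gap := Num.min (smax - smin) (1 / 48 / (contrast_constant smin smax tau + 1)).
have K0 := contrast_constant_gt0 s0 (ltW sl) t0.
have g0 : 0 < gap by rewrite lt_min subr_gt0 sl/= divr_gt0 ?addr_gt0// divr_gt0.
exists (gap ^+ 2 / 32); first by rewrite divr_gt0// exprn_gt0.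
move=> d T P W eps X noise proc.
apply: (@liminf_minimax_ge R (fun n => n.-tuple R -> R) R `[smin, smax]%classic
  (fun n => real_estimators n) _ _ 1%N) => n n0 est mest.
have [s sS h] := constant_volatility_risk t0 s0 sl noise proc n0 mest.
by exists s.
Qed.

(** * Assouad's argument for the Hoelder class *)

(** Flipping at k permutes the configurations, so that the average of a theta
    k over theta is at least b / 2 for each k; for some theta the sum over k
    is not below its average. *)
Lemma assouad_sum {R : realFieldType} p (a : {ffun 'I_p -> bool} -> 'I_p -> R) (b : R) :
  (forall theta k, b <= a theta k + a (flip theta k) k) ->
  exists theta, p%:R * b / 2 <= \sum_(k < p) a theta k.
Proof.
move=> h; apply: contrapT => no.
have lt theta : \sum_(k < p) a theta k < p%:R * b / 2.
  by rewrite ltNge; apply/negP => ?; apply: no; exists theta.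
pose S := \sum_(theta : {ffun 'I_p -> bool}) \sum_(k < p) a theta k.
have S1 : S < \sum_(theta : {ffun 'I_p -> bool}) (p%:R * b / 2).
  rewrite /S (bigD1 [ffun=> false])//= [ltRHS](bigD1 [ffun=> false])//=.
  by apply: ltr_leD => //; apply: ler_sum => theta _; exact: ltW.
have E : S + S = \sum_(theta : {ffun 'I_p -> bool}) \sum_(k < p) (a theta k + a (flip theta k) k).
  rewrite /S; under [RHS]eq_bigr do rewrite big_split/=.
  rewrite big_split/=; congr (_ + _).
  rewrite exchange_big/= [RHS]exchange_big/=; apply: eq_bigr => k _.
  by rewrite (reindex_inj (can_inj (flipK k)))/=.
have S2 : \sum_(theta : {ffun 'I_p -> bool}) (p%:R * b) <= S + S.
  rewrite E; apply: ler_sum => theta _.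
  have -> : p%:R * b = \sum_(k < p) b by rewrite sumr_const card_ord mulr_natl.
  by apply: ler_sum => k _; exact: h.
move: S1 S2; rewrite !sumr_const -[_ *+ _]mulr_natl -[X in X <= _]mulr_natl.
move: (_%:R) (p%:R * b) => N y; nra.
Qed.

Section middle_cells.
Context {R : realType}.
Notation mu := (@lebesgue_measure R).

(** The central half of cell k, where the bump is bounded below. *)
Definition middle_cell (p k : nat) : set R :=
  `[(k%:R + 1 / 4) / p%:R, (k%:R + 3 / 4) / p%:R]%classic.

Lemma middle_cellP p k (x : R) : (0 < p)%N -> middle_cell p k x ->
  1 / 4 <= p%:R * x - k%:R <= 3 / 4.
Proof.
move=> p0; have p0' : 0 < p%:R :> R by rewrite ltr0n.
rewrite /middle_cell/= in_itv/= ler_pdivrMr// ler_pdivlMr// mulrC => /andP[h1 h2].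
by apply/andP; split; lra.
Qed.

Lemma middle_cell01 p (k : 'I_p) : middle_cell p k `<=` `[0, 1]%classic.
Proof.
have p0 : (0 < p)%N by exact: leq_ltn_trans (ltn_ord k).
have p0' : 0 < p%:R :> R by rewrite ltr0n.
move=> x /(middle_cellP p0)/andP[h1 h2] /=; rewrite in_itv/=.
have k0 : 0 <= k%:R :> R by [].
have kp : k%:R + 1 <= p%:R :> R by rewrite natr1 ler_nat.
apply/andP; split; first by rewrite -(ler_pM2l p0') mulr0; lra.
by rewrite -(ler_pM2l p0') mulr1; lra.
Qed.

Lemma measurable_middle_cell p k : measurable (middle_cell p k).
Proof. exact: measurable_itv. Qed.

Lemma middle_cell_measure p k : (0 < p)%N -> mu (middle_cell p k) = (1 / (2 * p%:R))%:E.
Proof.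
move=> p0; have p0' : 0 < p%:R :> R by rewrite ltr0n.
rewrite /middle_cell lebesgue_measure_itv/= lte_fin ltr_pM2r ?invr_gt0//.
rewrite ltrD2l ltr_pM2r ?invr_gt0// (_ : 1 < 3 = true); last by rewrite ltr1n.
by rewrite -EFinD; congr (_%:E); field; rewrite gt_eqF.
Qed.

Lemma sum_sqr_dist_middle_cells p (f g : R -> R) : (0 < p)%N -> in_L2 f ->
  measurable_fun setT g ->
  (\sum_(k < p) sqr_dist (middle_cell p k) f g <= L2norm (f \- g)%R ^+ 2)%E.
Proof.
move=> p0 f2 mg; rewrite L2norm_sqr.
pose F x := ((f x - g x) ^+ 2)%:E.
have F0 x : (0 <= F x)%E by rewrite lee_fin sqr_ge0.
have mF (I : set R) : I `<=` `[0, 1]%classic -> measurable I -> measurable_fun I F.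
  move=> I01 mI; apply/measurable_EFinP; apply: measurable_funX.
  by apply: measurable_funB; [exact: in_L2_measurable|exact: measurable_funTS].
have mFk (k : 'I_p) : measurable_fun setT (F \_ (middle_cell p k)).
  apply/(measurable_restrictT _ (measurable_middle_cell p k)).
  by apply: mF; [exact: middle_cell01|exact: measurable_middle_cell].
have Fk0 (I : set R) x : (0 <= (F \_ I) x)%E by rewrite patchE; case: ifP.
rewrite /sqr_dist; under eq_bigr do rewrite integral_mkcond.
rewrite -ge0_integral_sum// [leRHS]integral_mkcond.
apply: ge0_le_integral_lower => x; first exact: sume_ge0.
have [/existsP[k kx]|/existsPn no] := boolP [exists k : 'I_p, x \in middle_cell p k].
  have kx' : middle_cell p k x by rewrite inE in kx.
  rewrite (bigD1 k)//= big1 ?adde0.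
    by rewrite !patchE kx mem_set//; exact: middle_cell01 kx'.
  move=> j jk; rewrite patchE; case: ifPn => // /set_mem jx; move/eqP: jk; case.
  apply/val_inj/eqP; have /andP[h1 h2] := middle_cellP p0 kx'; have /andP[h3 h4] := middle_cellP p0 jx.
  by rewrite /= eqn_leq; apply/andP; split; rewrite -ltnS -(ltr_nat R) -natr1; lra.
by rewrite big1// => k _; rewrite patchE (negbTE (no k)).
Qed.

Lemma sqr_dist_ge p (k : 'I_p) (f g : R -> R) (h : R) : 0 <= h ->
  measurable_fun setT f -> measurable_fun setT g ->
  (forall x, middle_cell p k x -> h <= `|f x - g x|) ->
  ((h ^+ 2 / (2 * p%:R))%:E <= sqr_dist (middle_cell p k) f g)%E.
Proof.
move=> h0 mf mg hfg.
have p0 : (0 < p)%N by exact: leq_ltn_trans (ltn_ord k).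
have -> : (h ^+ 2 / (2 * p%:R))%:E = (\int[mu]_(x in middle_cell p k) (h ^+ 2)%:E)%E.
  rewrite integral_cst; last exact: measurable_middle_cell.
  transitivity ((h ^+ 2)%:E * (1 / (2 * p%:R))%:E)%E; first by rewrite -EFinM mulrA mulr1.
  by congr (_ * _)%E; apply/esym; exact: middle_cell_measure.
apply: ge0_le_integral => //.
- exact: measurable_middle_cell.
- by move=> x _; rewrite lee_fin sqr_ge0.
- apply/measurable_EFinP; apply: measurable_funX.
  by apply: measurable_funTS; exact: measurable_funB.
move=> x /hfg hx; rewrite lee_fin -[leRHS]real_normK ?num_real//.
by rewrite lerXn2r ?nnegrE.
Qed.

Lemma sqr_dist_separation (I : set R) (f g g' : R -> R) (D : R) : measurable I ->
  I `<=` `[0, 1]%classic -> in_L2 f -> measurable_fun setT g -> measurable_fun setT g' ->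
  (D%:E <= sqr_dist I g g')%E ->
  ((D / 4)%:E <= sqr_dist I f g)%E \/ ((D / 4)%:E <= sqr_dist I f g')%E.
Proof.
move=> mI I01 f2 mg mg' h.
have mfI := in_L2_measurable f2 I01 mI.
have mgI : measurable_fun I g by exact: measurable_funTS.
have mgI' : measurable_fun I g' by exact: measurable_funTS.
have hD : (sqr_dist I g g' <= 2%:E * sqr_dist I f g + 2%:E * sqr_dist I f g')%E.
  have := integral_sqrD_le mu mI (measurable_funB mgI mfI) (measurable_funB mfI mgI').
  rewrite /sqr_dist.
  have -> : (\int[mu]_(x in I) ((g \- f) x ^+ 2)%:E = \int[mu]_(x in I) ((f x - g x) ^+ 2)%:E)%E.
    by apply: eq_integral => x _; congr (_%:E); rewrite /=; ring.
  apply: le_trans; rewrite le_eqVlt; apply/orP; left; apply/eqP.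
  by apply: eq_integral => x _; congr ((_ ^+ 2)%:E); rewrite /=; ring.
apply: max_of_pair; have -> : (2 * (D / 4))%:E = ((1 / 2)%:E * D%:E)%E :> \bar R.
  by rewrite -EFinM; congr (_%:E); field.
apply: (@le_trans _ _ ((1 / 2)%:E * (2%:E * sqr_dist I f g + 2%:E * sqr_dist I f g'))%E).
  by apply: lee_wpmul2l; [rewrite lee_fin|exact: le_trans h hD].
have s0 (g0 : R -> R) : (0 <= sqr_dist I f g0)%E.
  by apply: integral_ge0 => x _; rewrite lee_fin sqr_ge0.
rewrite -muleDr ?ge0_adde_def ?inE ?s0// muleA -EFinM.
by rewrite (_ : 1 / 2 * 2 = 1) ?mul1e//; field.
Qed.

End middle_cells.

(** With gamma = 1 / (8 alpha + 4), p is n^gamma up to a factor 2, and gamma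
    (2 alpha + 1) = 1/4: this balances p^(-2 alpha) q. The last bound says
    that p^(-2 alpha) has the order of the rate. *)
Lemma cell_number {R : realType} (alpha : R) (n : nat) : 1 / 2 < alpha -> (1 < n)%N ->
  let p := (Num.truncn (n%:R `^ (1 / (8 * alpha + 4)) : R)).+1 in
  let q := (Num.truncn (n%:R `^ (1 / 4) / p%:R : R)).+1 in
  [/\ (p <= n)%N, p%:R `^ (- alpha) ^+ 2 * q%:R <= 2 :> R &
      2 `^ (- (2 * alpha)) <= n%:R `^ (alpha / (4 * alpha + 2)) * p%:R `^ (- alpha) ^+ 2 :> R].
Proof.
pose gamma := 1 / (8 * alpha + 4).
rewrite -/gamma => a2 n1; set t := Num.truncn _ => p q.
have a0 : 0 < alpha by lra.
have den : 0 < 8 * alpha + 4 by lra.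
have g0 : 0 < gamma by rewrite divr_gt0.
have n1' : 1 < n%:R :> R by rewrite ltr1n.
have n0' : 0 < n%:R :> R by rewrite (lt_trans ltr01).
have /andP[h1 h2] := truncn_itv (powR_ge0 (n%:R : R) gamma).
rewrite -/t -/p in h1 h2.
have p0' : 0 < p%:R :> R by rewrite ltr0n.
have np : n%:R `^ gamma <= p%:R :> R by exact: ltW.
have ng1 : 1 <= n%:R `^ gamma :> R.
  by rewrite -[leLHS](powRr0 n%:R); apply: ler_powR; exact: ltW.
have ng0 : 0 < n%:R `^ gamma :> R by exact: powR_gt0.
have one_powR (x : R) : 1 `^ x = 1 by rewrite powR1.
have sq (x : R) : 0 < x -> x `^ (- alpha) ^+ 2 = x `^ (- (2 * alpha)).
  by move=> x0; rewrite -powR_mulrn ?powR_ge0// -powRrM; congr (_ `^ _); ring.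
have anti (x y : R) : 0 < x -> x <= y -> y `^ (- (2 * alpha)) <= x `^ (- (2 * alpha)).
  move=> x0 xy; have y0 := lt_le_trans x0 xy.
  rewrite !powRN lef_pV2 ?posrE ?powR_gt0//.
  by apply: ge0_ler_powR; rewrite ?nnegrE ?(ltW x0) ?(ltW y0)// mulr_ge0 ?(ltW a0).
split.
- rewrite -(ltr_nat R) (le_lt_trans h1)//.
  pose z := n%:R `^ (1 / 2) : R.
  have z1 : 1 < z.
    rewrite -[ltLHS](one_powR (1 / 2)).
    by apply: gt0_ltr_powR; rewrite ?nnegrE ?divr_gt0 ?ler01 ?(ltW n0').
  have nz : n%:R = z * z.
    by rewrite /z -powRD ?(gt_eqF n0') ?implybT// (_ : 1 / 2 + 1 / 2 = 1) ?powRr1 ?(ltW n0')//; field.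
  apply: (@le_lt_trans _ _ z); last by rewrite nz ltr_pMr// (lt_trans ltr01).
  apply: ler_powR; first exact: ltW.
  by rewrite /gamma ler_pdivrMr//; lra.
- rewrite (sq _ p0'); set y := p%:R `^ _.
  have y0 : 0 < y by exact: powR_gt0.
  have y1 : y <= 1.
    by rewrite /y -[leRHS](one_powR (- (2 * alpha))); apply: anti => //; rewrite ler1n.
  have [_ qle] := @block_count R n p isT.
  apply: (@le_trans _ _ (y * (n%:R `^ (1 / 4) / p%:R + 1))).
    by rewrite ler_wpM2l// ltW.
  suff : y * (n%:R `^ (1 / 4) / p%:R) <= 1 by lra.
  have -> : n%:R `^ (1 / 4) = (n%:R `^ gamma) `^ (2 * alpha + 1) :> R.
    rewrite -powRrM; congr (_ `^ _); rewrite /gamma; field.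
    by rewrite gt_eqF.
  rewrite /y powRN mulrA ler_pdivrMr// mul1r mulrC ler_pdivrMr ?powR_gt0//.
  have -> : p%:R * p%:R `^ (2 * alpha) = p%:R `^ (2 * alpha + 1) :> R.
    by rewrite powRD ?(gt_eqF p0') ?implybT// powRr1 ?(ltW p0')// mulrC.
  by apply: ge0_ler_powR; rewrite ?nnegrE ?(ltW p0')// ?(ltW ng0)// addr_ge0 ?mulr_ge0 ?(ltW a0).
rewrite (sq _ p0').
have ple : p%:R <= 2 * n%:R `^ gamma :> R by rewrite /p -natr1; lra.
apply: le_trans (_ : _ <= n%:R `^ (alpha / (4 * alpha + 2)) *
    (2 * n%:R `^ gamma) `^ (- (2 * alpha))) _; last first.
  by rewrite ler_wpM2l ?powR_ge0// anti.
rewrite powRM ?(ltW ng0)// mulrCA -powRrM -powRD; last by rewrite (gt_eqF n0') implybT.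
rewrite (_ : alpha / _ + _ = 0) ?powRr0 ?mulr1//.
by rewrite /gamma; field; rewrite !gt_eqF//; lra.
Qed.

Section hoelder_risk.
Context {R : realType} (tau alpha L l u : R).
Hypotheses (tau_gt0 : 0 < tau) (alpha_gt : 1 / 2 < alpha) (l_gt0 : 0 < l) (lu : l < u).
Variables (c B : R).
Hypotheses (c_gt0 : 0 < c) (B_ge0 : 0 <= B)
  (profile_B : forall v, 0 <= clamped (profile alpha) v <= B)
  (c_hoelder : forall p (theta : {ffun 'I_p -> bool}), (0 < p)%N ->
     bounded_hoelder alpha L l u (volatility alpha l c theta))
  (c_close : contrast_constant l u tau * (2 * (c * B) ^+ 2) <= (1 / 24) ^+ 2).
Context d (T : measurableType d) (P : probability T R).
Variables (W : R -> {RV P >-> R}) (eps : forall n : nat, 'I_n -> {RV P >-> R})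
  (X : (R -> R) -> R -> {RV P >-> R}).
Hypothesis noise : noise_model W eps.
Hypothesis proc : forall sigma2 : R -> R, bounded_hoelder alpha L l u sigma2 ->
  is_integral_process W (fun x => Num.sqrt (sigma2 x)) (X (fun x => Num.sqrt (sigma2 x))).

Let b := (3 / 16) ^+ (Num.truncn alpha).+2 : R.

(** A bump is wrongly decided when the estimate is far on its middle cell from
    the configuration; this holds for one of the two configurations that
    differ by this bump, hence [volatility_tests] applies. The losses on
    disjoint cells add up. *)
Lemma hoelder_risk n (est : n.-tuple R -> R -> R) : (1 < n)%N -> L2_estimators n est ->
  exists2 s, bounded_hoelder alpha L l u s &
  ((c ^+ 2 * b ^+ 2 * 2 `^ (- (2 * alpha)) / 64)%:E <=
   \int[P]_w ((n%:R `^ (alpha / (4 * alpha + 2)))%:E *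
      L2norm (est (observations tau (X (fun x => Num.sqrt (s x))) eps n w) \- s)%R ^+ 2))%E.
Proof.
move=> n1 [est2 mest].
have n0 : (0 < n)%N by exact: ltnW.
have [pn pq rp] := cell_number alpha_gt n1.
set p := (Num.truncn _).+1 in pn pq rp; set q := (Num.truncn _).+1 in pq.
have p0 : (0 < p)%N by []; have q0 : (0 < q)%N by [].
have p0' : 0 < p%:R :> R by rewrite ltr0n.
have [npq _] := @block_count R n p p0; rewrite -/q in npq.
pose r := n%:R `^ (alpha / (4 * alpha + 2)) : R; pose y := p%:R `^ (- alpha) : R.
rewrite -/r -/y in pq rp.
have r0 : 0 <= r by exact: powR_ge0.
have y0 : 0 < y by exact: powR_gt0.
have b0 : 0 < b by rewrite exprn_gt0// divr_gt0.
pose v (theta : {ffun 'I_p -> bool}) := volatility alpha l c theta.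
have vS theta : bounded_hoelder alpha L l u (v theta) by exact: c_hoelder.
have vlu theta (x : R) : x \in `[0, 1] -> l <= v theta x <= u by have [_ h] := vS theta; exact: h.
have [K K0 vlip] := volatility_lipschitz alpha l p c_gt0.
have mv theta : measurable_fun setT (v theta) := lipschitz_measurable K0 (vlip theta).
pose h := c * y * b; have h0 : 0 < h := mulr_gt0 (mulr_gt0 c_gt0 y0) b0.
pose D := h ^+ 2 / (2 * p%:R); have D0 : 0 < D.
  by apply: divr_gt0; [exact: exprn_gt0|exact: (mulr_gt0 (ltr0Sn _ 1) p0')].
pose I k : set R := middle_cell p k.
have vsep theta (k : 'I_p) : (D%:E <= sqr_dist (I k) (v theta) (v (flip theta k)))%E.
  apply: sqr_dist_ge => //; first exact: ltW.
  move=> x /(middle_cellP p0) kx; rewrite distrC volatility_flip// -/y /h ler_wpM2l//.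
    by rewrite mulr_ge0 ?(ltW c_gt0) ?(ltW y0).
  exact: profile_middle.
pose Bad theta (k : 'I_p) := [set z : n.-tuple R | ((D / 4)%:E <= sqr_dist (I k) (est z) (v theta))%E].
have mBad theta k : measurable (Bad theta k).
  have -> : Bad theta k = ~` (est @^-1` [set f | (sqr_dist (I k) f (v theta) < (D / 4)%:E)%E]).
    by apply/seteqP; split => z /=; [move=> h1; apply/negP; rewrite -leNgt|move/negP; rewrite -leNgt].
  apply: measurableC; apply: mest; apply: sqr_dist_open => //; last by rewrite divr_gt0.
    exact: measurable_middle_cell.
  exact: middle_cell01.
have BadU theta k : Bad theta k `|` Bad (flip theta k) k = setT.
  apply/seteqP; split => // z _.
  by apply: (sqr_dist_separation (measurable_middle_cell p k)) => //; exact: middle_cell01.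
pose Y theta := observations tau (X (fun x => Num.sqrt (v theta x))) eps n.
have mY theta : measurable_fun setT (Y theta).
  exact: (measurable_observations (proc (vS theta)) eps tau n0).
have mYB theta k : measurable (Y theta @^-1` Bad theta k).
  by rewrite -[X in measurable X]setTI; exact: mY.
have close : contrast_constant l u tau * ((c * B * y) ^+ 2 * q%:R) <= (1 / 24) ^+ 2.
  apply: le_trans c_close; apply: ler_wpM2l.
    by apply/ltW/contrast_constant_gt0 => //; exact: ltW.
  rewrite exprMn -mulrA [leRHS]mulrC ler_wpM2l ?sqr_ge0//.
have pair theta k : ((1 / 4)%:E <= P (Y theta @^-1` Bad theta k) +
    P (Y (flip theta k) @^-1` Bad (flip theta k) k))%E.
  apply: (@volatility_tests R d T P W eps tau (v theta) (v (flip theta k)) _ _ l u (c * B * y) K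
    n p q k noise tau_gt0 l_gt0 _ K0 (proc (vS theta)) (proc (vS (flip theta k))) n0 p0 q0 pn npq
    (vlu theta) (vlu _)) => //.
  - by rewrite !mulr_ge0 ?(ltW c_gt0) ?(ltW y0).
  - move=> x _; rewrite volatility_flip// -/y mulrAC ler_wpM2r ?(ltW y0)//.
    by rewrite ler_wpM2l ?(ltW c_gt0)//; have /andP[] := profile_B (p%:R * x - k%:R).
  - by move=> x _ out; exact: volatility_flip_out.
have fin theta k : P (Y theta @^-1` Bad theta k) \is a fin_num by exact: fin_num_measure.
have [theta sumP] : exists theta, p%:R * (1 / 4) / 2 <=
    \sum_(k < p) fine (P (Y theta @^-1` Bad theta k)).
  apply: (assouad_sum (a := fun theta k => fine (P (Y theta @^-1` Bad theta k)))) => theta k.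
  by have := pair theta k; rewrite -{1}(fineK (fin theta k)) -{1}(fineK (fin (flip theta k) k)) -EFinD lee_fin.
exists (v theta) => //.
have a0 : 0 <= r * (D / 4) by rewrite mulr_ge0// divr_ge0// ltW.
have lower w : (\sum_(k < p) (r * (D / 4))%:E * (\1_(Y theta @^-1` Bad theta k) w)%:E <=
    r%:E * L2norm (est (Y theta w) \- v theta)%R ^+ 2)%E.
  apply: (@le_trans _ _ (r%:E * \sum_(k < p) sqr_dist (I k) (est (Y theta w)) (v theta))%E); last first.
    by apply: lee_wpmul2l; [rewrite lee_fin|exact: sum_sqr_dist_middle_cells].
  have s0 (k : 'I_p) : (0 <= sqr_dist (I k) (est (Y theta w)) (v theta))%E.
    by apply: integral_ge0 => x _; rewrite lee_fin sqr_ge0.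
  rewrite ge0_sume_distrr//; apply: lee_sum => k _.
  rewrite EFinM -muleA; apply: lee_wpmul2l; first by rewrite lee_fin.
  rewrite indicE; have [|_] := boolP (w \in _); last by rewrite mule0.
  by rewrite inE mule1.
apply: (le_trans _ (expectation_ge_indicators P a0 (mYB theta) lower)).
have -> : (\sum_(k < p) P (Y theta @^-1` Bad theta k))%E =
    (\sum_(k < p) fine (P (Y theta @^-1` Bad theta k)))%:E.
  by rewrite -sumEFin; apply: eq_bigr => k _; rewrite fineK.
rewrite -EFinM lee_fin.
apply: (@le_trans _ _ (r * (D / 4) * (p%:R * (1 / 4) / 2))); last first.
  by rewrite ler_wpM2l// mulr_ge0 ?divr_ge0 ?(ltW D0).
have -> : r * (D / 4) * (p%:R * (1 / 4) / 2) = c ^+ 2 * b ^+ 2 / 64 * (r * y ^+ 2).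
  by rewrite /D /h; field; rewrite gt_eqF.
have cb : 0 <= c ^+ 2 * b ^+ 2 / 64 by rewrite divr_ge0// mulr_ge0 ?sqr_ge0.
apply: (@le_trans _ _ (c ^+ 2 * b ^+ 2 / 64 * 2 `^ (- (2 * alpha)))); last by rewrite ler_wpM2l.
by rewrite mulrAC.
Qed.

End hoelder_risk.

Lemma hoelder_minimax {R : realType} (tau alpha L l u : R) : 0 < tau ->
  1 / 2 < alpha -> 0 < L -> 0 < l -> l < u ->
  exists2 C : R, 0 < C &
   forall (d : measure_display) (T : measurableType d) (P : probability T R)
     (W : R -> {RV P >-> R}) (eps : forall n : nat, 'I_n -> {RV P >-> R})
     (X : (R -> R) -> R -> {RV P >-> R}),
   noise_model W eps ->
   (forall sigma2 : R -> R, bounded_hoelder alpha L l u sigma2 ->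
      is_integral_process W (fun x => Num.sqrt (sigma2 x))
        (X (fun x => Num.sqrt (sigma2 x)))) ->
   (C%:E <= limn_einf (fun n : nat =>
      ereal_inf [set
        ereal_sup [set
          \int[P]_w ((n%:R `^ (alpha / (4 * alpha + 2)))%:E *
            L2norm (est (observations tau
                           (X (fun x => Num.sqrt (sigma2 x))) eps n w)
                    \- sigma2)%R ^+ 2)
        | sigma2 in bounded_hoelder alpha L l u]
      | est in L2_estimators n]))%E.
Proof.
move=> t0 a2 L0 l0 lu; have a0 : 0 < alpha by lra.
have [c0 c0_gt0 hc] := volatility_hoelder a0 L0 lu l0.
have [B B0 hB] := profile_bounds alpha.
have K0 := contrast_constant_gt0 l0 (ltW lu) t0.
set K := contrast_constant _ _ _ in K0.
have g0 : 0 < 1 / 48 / (K + 1) by rewrite divr_gt0 ?addr_gt0// divr_gt0.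
have B1 : 0 < B + 1 by rewrite ltr_wpDl.
pose c := Num.min c0 (1 / 48 / (K + 1) / (B + 1)).
have c_gt0 : 0 < c by rewrite lt_min c0_gt0/= divr_gt0.
have c_hoelder p (theta : {ffun 'I_p -> bool}) : (0 < p)%N ->
    bounded_hoelder alpha L l u (volatility alpha l c theta).
  by apply: hc; rewrite c_gt0/= /c ge_min lexx.
have c_close : K * (2 * (c * B) ^+ 2) <= (1 / 24) ^+ 2.
  apply: contrast_choice => //; first by rewrite mulr_ge0// ltW.
  apply: (@le_trans _ _ (c * (B + 1))); first by rewrite ler_wpM2l ?(ltW c_gt0)// lerDl.
  by rewrite -ler_pdivlMr// /c ge_min lexx orbT.
exists (c ^+ 2 * ((3 / 16) ^+ (Num.truncn alpha).+2) ^+ 2 * 2 `^ (- (2 * alpha)) / 64).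
  have w0 : 0 < 2 `^ (- (2 * alpha)) :> R by exact: powR_gt0.
  have b0 : 0 < (3 / 16) ^+ (Num.truncn alpha).+2 :> R by rewrite exprn_gt0// divr_gt0.
  by apply: divr_gt0 => //; apply: mulr_gt0 w0; apply: mulr_gt0; exact: exprn_gt0.
move=> d T P W eps X noise proc.
apply: (@liminf_minimax_ge R (fun n => n.-tuple R -> R -> R) (R -> R) (bounded_hoelder alpha L l u)
  (fun n => L2_estimators n) _ _ 2%N) => n n1 est Eest.
exact: (hoelder_risk t0 a2 l0 lu c_gt0 B0 hB c_hoelder c_close noise proc n1 Eest).
Qed.

Theorem theorem2p2 (R : realType) (tau : R) (tau_gt0 : 0 < tau) :
  (forall alpha L l u : R, 1 / 2 < alpha -> 0 < L -> 0 < l -> l < u ->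
   exists2 C : R, 0 < C &
   forall (d : measure_display) (T : measurableType d) (P : probability T R)
     (W : R -> {RV P >-> R}) (eps : forall n : nat, 'I_n -> {RV P >-> R})
     (X : (R -> R) -> R -> {RV P >-> R}),
   noise_model W eps ->
   (forall sigma2 : R -> R, bounded_hoelder alpha L l u sigma2 ->
      is_integral_process W (fun x => Num.sqrt (sigma2 x))
        (X (fun x => Num.sqrt (sigma2 x)))) ->
   (C%:E <= limn_einf (fun n : nat =>
      ereal_inf [set
        ereal_sup [set
          \int[P]_w ((n%:R `^ (alpha / (4 * alpha + 2)))%:E *
            L2norm (est (observations tau
                           (X (fun x => Num.sqrt (sigma2 x))) eps n w)
                    \- sigma2)%R ^+ 2)
        | sigma2 in bounded_hoelder alpha L l u]
      | est in L2_estimators n]))%E) /\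
  (forall sigma_min sigma_max : R, 0 < sigma_min -> sigma_min < sigma_max ->
   exists2 C : R, 0 < C &
   forall (d : measure_display) (T : measurableType d) (P : probability T R)
     (W : R -> {RV P >-> R}) (eps : forall n : nat, 'I_n -> {RV P >-> R})
     (X : R -> R -> {RV P >-> R}),
   noise_model W eps ->
   (forall sigma2 : R, sigma2 \in `[sigma_min, sigma_max] ->
      is_integral_process W (cst (Num.sqrt sigma2)) (X (Num.sqrt sigma2))) ->
   (C%:E <= limn_einf (fun n : nat =>
      ereal_inf [set
        ereal_sup [set
          \int[P]_w (n%:R `^ (1 / 4) *
            (est (observations tau (X (Num.sqrt sigma2)) eps n w)
               - sigma2) ^+ 2)%:E
        | sigma2 in `[sigma_min, sigma_max]]
      | est in real_estimators n]))%E).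
Proof.
split=> [alpha L l u|sigma_min sigma_max]; first exact: hoelder_minimax.
exact: constant_volatility_minimax.
Qed.
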